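(* Let $d\in\mathbb{N}$, $s>0$ and let $s_n\in\{\lambda_n,d_n\}$ (that is, $s_n$ denotes either the linear $n$-width or the Kolmogorov $n$-width). Let $\boldsymbol{W}^s_2(\mathbb{R}^d,\gamma)$ and $\boldsymbol{H}^s(\mathbb{R}^d,\gamma)$ denote the unit balls of $W^s_2(\mathbb{R}^d,\gamma)$ and $H^s(\mathbb{R}^d,\gamma)$. Then $$s_n\big(\boldsymbol{W}^s_{2}(\mathbb{R}^d,\gamma),L_2(\mathbb{R}^d,\gamma)\big)\asymp s_n\big(\boldsymbol{H}^s(\mathbb{R}^d,\gamma),L_2(\mathbb{R}^d,\gamma)\big)\asymp n^{-\frac{s}{2d}}.$$ Moreover, $$\lim_{n\to\infty}\frac{s_n\big(\boldsymbol{H}^s(\mathbb{R}^d,\gamma),L_2(\mathbb{R}^d,\gamma)\big)}{n^{-\frac{s}{2d}}}=\Big(\frac{1}{\sqrt[d]{d!}}\Big)^{s/2}.$$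
   Context: $\gamma$ is the standard Gaussian measure on $\mathbb{R}^d$: $\mathrm{d}\gamma(\boldsymbol{x})=(2\pi)^{-d/2}e^{-|\boldsymbol{x}|^2/2}\,\mathrm{d}\boldsymbol{x}$, with $|\cdot|$ the Euclidean norm. $L_2(\mathbb{R}^d,\gamma)$ has norm $\|f\|_{L_2(\mathbb{R}^d,\gamma)}=(\int_{\mathbb{R}^d}|f|^2\,\mathrm{d}\gamma)^{1/2}$. For $s\in\mathbb{N}_0$, $W^s_2(\mathbb{R}^d,\gamma)$ is the space of all $f\in L_2(\mathbb{R}^d,\gamma)$ whose generalized partial derivatives $D^{\boldsymbol{\alpha}}f$ belong to $L_2(\mathbb{R}^d,\gamma)$ for all $\boldsymbol{\alpha}\in\mathbb{N}_0^d$ with $|\boldsymbol{\alpha}|_1\le s$ ($|\boldsymbol{\alpha}|_1=\sum_i\alpha_i$), normed by $\|f\|_{W^s_2(\mathbb{R}^d,\gamma)}=\big(\sum_{|\boldsymbol{\alpha}|_1\le s}\|D^{\boldsymbol{\alpha}}f\|^2_{L_2(\mathbb{R}^d,\gamma)}\big)^{1/2}$. For $t>0$ the Mehler kernel is $$M_t(\boldsymbol{x},\boldsymbol{y})=\frac{1}{(1-e^{-2t})^{d/2}}\exp\Big(-\frac{e^{-2t}|\boldsymbol{x}|^2-2e^{-t}\boldsymbol{x}\cdot\boldsymbol{y}+e^{-2t}|\boldsymbol{y}|^2}{2(1-e^{-2t})}\Big),$$ and for $\sigma>0$, $K_\sigma(\boldsymbol{x},\boldsymbol{y})=\int_0^\infty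 M_t(\boldsymbol{x},\boldsymbol{y})\,t^{-\frac{\sigma}{2}-1}\,\mathrm{d}t$. For $s>0$, $s\notin\mathbb{N}$, write $s=\bar s+\tilde s$ with $\bar s=\lfloor s\rfloor$ and $\tilde s\in(0,1)$. Then $W^s_2(\mathbb{R}^d,\gamma)$ is the space of all $f\in W^{\bar s}_2(\mathbb{R}^d,\gamma)$ with $[f]_{W^s_2(\mathbb{R}^d,\gamma)}<\infty$, where $$[f]_{W^s_2(\mathbb{R}^d,\gamma)}=\sum_{|\boldsymbol{\alpha}|_1=\bar s}\Big(\int_{\mathbb{R}^d}\int_{\mathbb{R}^d}|D^{\boldsymbol{\alpha}}f(\boldsymbol{x})-D^{\boldsymbol{\alpha}}f(\boldsymbol{y})|^2K_{2\tilde s}(\boldsymbol{x},\boldsymbol{y})\,\mathrm{d}\gamma(\boldsymbol{x})\,\mathrm{d}\gamma(\boldsymbol{y})\Big)^{1/2},$$ normed by $\|f\|_{W^s_2(\mathbb{R}^d,\gamma)}=\|f\|_{W^{\bar s}_2(\mathbb{R}^d,\gamma)}+[f]_{W^s_2(\mathbb{R}^d,\gamma)}$. Hermite polynomials: $H_k(x)=\frac{(-1)^k}{\sqrt{k!}}e^{x^2/2}\frac{\mathrm{d}^k}{\mathrm{d}x^k}e^{-x^2/2}$ for $k\in\mathbb{N}_0$, and $H_{\boldsymbol{k}}(\boldsymbol{x})=\prod_{j=1}^dH_{k_j}(x_j)$ for $\boldsymbol{k}\in\mathbb{N}_0^d$; $(H_{\boldsymbol{k}})_{\boldsymbol{k}\in\mathbb{N}_0^d}$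 is an orthonormal basis of $L_2(\mathbb{R}^d,\gamma)$. For $f\in L_2(\mathbb{R}^d,\gamma)$ put $\widehat f(\boldsymbol{k})=\int_{\mathbb{R}^d}fH_{\boldsymbol{k}}\,\mathrm{d}\gamma$. For $s>0$, $H^s(\mathbb{R}^d,\gamma)$ is the space of all $f\in L_2(\mathbb{R}^d,\gamma)$ with $\|f\|_{H^s(\mathbb{R}^d,\gamma)}=\big(\sum_{\boldsymbol{k}\in\mathbb{N}_0^d}(1+|\boldsymbol{k}|_1)^s|\widehat f(\boldsymbol{k})|^2\big)^{1/2}<\infty$. Widths. Let $Y$ be a Banach space, $F\subset Y$ a centrally symmetric compact set, and $n\in\mathbb{N}$. The Kolmogorov width is $d_n(F,Y)=\inf_{L_n}\sup_{f\in F}\inf_{g\in L_n}\|f-g\|_Y$, the infimum being over all linear subspaces $L_n\subset Y$ of dimension at most $n$. The linear width is $\lambda_n(F,Y)=\inf_{A_n}\sup_{f\in F}\|f-A_n(f)\|_Y$, the infimum being over all linear operators $A_n:Y\to Y$ of rank at most $n$. $A_n\asymp B_n$ means that there are constants $c,C>0$ independent of $n$ with $cB_n\le A_n\le CB_n$ for all $n\in\mathbb{N}$. *)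

(* Defs.v *)
From HB Require Import structures.
From mathcomp Require Import all_boot all_order all_algebra.
From mathcomp Require Import all_classical all_reals all_analysis.
From mathcomp Require Import ess_sup_inf measurable_realfun.
Set Implicit Arguments.
Unset Strict Implicit.
Unset Printing Implicit Defensive.
Import Order.TTheory GRing.Theory Num.Theory.
Import numFieldNormedType.Exports.
Local Open Scope classical_set_scope.
Local Open Scope ring_scope.

(* [LspaceType mu p1] is the type of a.e. classes of p-integrable functions; the
   section below makes it a normed module. *)
Section Lspace_normed.
Local Open Scope quotient_scope.
Context d (T : measurableType d) (R : realType).
Variables (mu : {measure set T -> \bar R}) (p : \bar R) (p1 : (1 <= p)%E).
Local Notation L := (LspaceType mu p1).
Local Notation Q := {mfun_ mu, T >-> measurableTypeR R}.
Implicit Types f g h : L.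

(* a representative of the class *)
Definition Lspace_fun (f : L) : T -> R := (f : Q).

Lemma Lspace_eqP f g : Lspace_fun f = Lspace_fun g %[ae mu] -> f = g.
Proof.
move=> /(ae_eqP (f : Q) (g : Q)) /eqP; rewrite !reprK.
case: f g => [f [[ff]]] [g [[gf]]]/= fg; subst g.
by rewrite (bool_irrelevance ff gf).
Qed.

Lemma measurable_Lspace_fun f : measurable_fun setT (Lspace_fun f).
Proof. exact: (@measurable_funPT _ _ _ _ (repr (f : Q))). Qed.

Lemma Lspace_Lfun f : Lspace_fun f \in Lfun mu p.
Proof.
rewrite inE; apply/andP; split; rewrite inE/=; last exact: Lebesgue_finite.
exact: measurable_Lspace_fun.
Qed.

Lemma ae_eq_Lnorm (f g : T -> R) : f = g %[ae mu] ->
  measurable_fun setT f -> measurable_fun setT g ->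
  (Lnorm mu p (EFin \o f) = Lnorm mu p (EFin \o g)).
Proof.
move=> fg mf mg; rewrite unlock; case: p p1 => [r r1|_|//].
- have mr (h : T -> R) : measurable_fun setT h ->
      measurable_fun setT (fun x => `|(EFin \o h) x| `^ r)%E.
    move=> mh; apply/measurable_EFinP.
    apply: (@measurableT_comp _ _ _ _ _ _ (@powR R ^~ r)) => //.
    exact: measurableT_comp.
  congr (_ `^ _)%E; apply: ge0_ae_eq_integral => //; [exact: mr|exact: mr| | |].
  + by move=> x _; exact: poweR_ge0.
  + by move=> x _; exact: poweR_ge0.
  + by apply: filterS fg => x /= /[apply] ->.
- by case: ifP => // _; apply: eq_ess_sup; apply: filterS fg => x /= ->.
Qed.

Lemma Lclass_key (f : T -> R) : f \in Lfun mu p ->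
  exists g : L, Lspace_fun g = f %[ae mu].
Proof.
move=> fL; have /andP[mf ff] : (f \in @mfun _ _ T R) && (f \in finLfun mu p).
  by move: fL; rewrite inE.
pose F : {mfun T >-> measurableTypeR R} :=
  @mfun_Sub _ _ T (measurableTypeR R) f mf.
pose q : Q := \pi_Q F.
have qF : repr q = F %[ae mu].
  have : repr q = F %[mod Q] by rewrite reprK.
  by move=> /eqP; rewrite eqmodE => /asboolP.
have fq : finite_norm mu p (q : T -> R).
  rewrite /finite_norm (@ae_eq_Lnorm _ f) //.
  - by apply: set_mem; exact: ff.
  - exact: (@measurable_funPT _ _ _ _ (repr q)).
  - by apply: set_mem; exact: mf.
by exists (@LebesgueSpace.Pack _ _ _ _ _ p1 q
  (LebesgueSpace.Class (@isFinLebesgue.Axioms_ _ _ _ _ _ p1 q fq))).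
Qed.

Definition Lclass (f : T -> R) (fL : f \in Lfun mu p) : L :=
  projT1 (cid (Lclass_key fL)).

Lemma LclassK (f : T -> R) (fL : f \in Lfun mu p) :
  Lspace_fun (Lclass fL) = f %[ae mu].
Proof. exact: projT2 (cid (Lclass_key fL)). Qed.

HB.instance Definition _ := gen_eqMixin L.
HB.instance Definition _ := gen_choiceMixin L.

Lemma Lfun0 : (fun=> 0 : R) \in Lfun mu p.
Proof. exact: (rpred0 (Lfun mu p)). Qed.
Lemma LfunN f : \- Lspace_fun f \in Lfun mu p.
Proof. by rewrite rpredN; exact: Lspace_Lfun. Qed.
Lemma LfunD f g : Lspace_fun f \+ Lspace_fun g \in Lfun mu p.
Proof. by apply: rpredD; exact: Lspace_Lfun. Qed.
Lemma LfunZ a f : a \*: Lspace_fun f \in Lfun mu p.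
Proof. by apply: rpredZ; exact: Lspace_Lfun. Qed.


Definition Lspace_zero : L := Lclass Lfun0.
Definition Lspace_opp f : L := Lclass (LfunN f).
Definition Lspace_add f g : L := Lclass (LfunD f g).
Definition Lspace_scale (a : R) f : L := Lclass (LfunZ a f).

Let addA : associative Lspace_add.
Proof.
move=> f g h; apply: Lspace_eqP.
near=> x => _.
rewrite (near (LclassK (LfunD f (Lspace_add g h))) x)//=.
rewrite (near (LclassK (LfunD g h)) x)//=.
rewrite (near (LclassK (LfunD (Lspace_add f g) h)) x)//=.
by rewrite (near (LclassK (LfunD f g)) x)//= addrA.
Unshelve. all: by end_near. Qed.

Let addC : commutative Lspace_add.
Proof.
move=> f g; apply: Lspace_eqP.
apply: filterS2 (LclassK (LfunD f g)) (LclassK (LfunD g f)).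
by move=> x e1 e2 _; rewrite e1// e2//= addrC.
Qed.

Let add0 : left_id Lspace_zero Lspace_add.
Proof.
move=> f; apply: Lspace_eqP.
apply: filterS2 (LclassK (LfunD Lspace_zero f)) (LclassK Lfun0).
by move=> x e1 e2 _; rewrite e1//= e2// add0r.
Qed.

Let addN : left_inverse Lspace_zero Lspace_opp Lspace_add.
Proof.
move=> f; apply: Lspace_eqP.
apply: filterS3 (LclassK (LfunD (Lspace_opp f) f)) (LclassK (LfunN f))
  (LclassK Lfun0).
by move=> x e1 e2 e3 _; rewrite e1//= e2// e3// addNr.
Qed.

HB.instance Definition _ := GRing.isZmodule.Build L addA addC add0 addN.

Let scaleA a b f :
  Lspace_scale a (Lspace_scale b f) = Lspace_scale (a * b) f.
Proof.
apply: Lspace_eqP.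
apply: filterS3 (LclassK (LfunZ a (Lspace_scale b f))) (LclassK (LfunZ b f))
  (LclassK (LfunZ (a * b) f)).
by move=> x e1 e2 e3 _; rewrite e1//= e2// e3//= scalerA.
Qed.

Let scale1 : left_id 1 Lspace_scale.
Proof.
move=> f; apply: Lspace_eqP.
apply: filterS (LclassK (LfunZ 1 f)) => x e1 _.
by rewrite e1//= scale1r.
Qed.

Let scaleDr : right_distributive Lspace_scale +%R.
Proof.
move=> a f g; apply: Lspace_eqP.
near=> x => _.
rewrite (near (LclassK (LfunZ a (f + g))) x)//=.
rewrite (near (LclassK (LfunD f g)) x)//=.
rewrite (near (LclassK (LfunD (Lspace_scale a f) (Lspace_scale a g))) x)//=.
rewrite (near (LclassK (LfunZ a f)) x)//= (near (LclassK (LfunZ a g)) x)//=.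
by rewrite scalerDr.
Unshelve. all: by end_near. Qed.

Let scaleDl f : {morph Lspace_scale^~ f : a b / a + b}.
Proof.
move=> a b; apply: Lspace_eqP.
near=> x => _.
rewrite (near (LclassK (LfunZ (a + b) f)) x)//=.
rewrite (near (LclassK (LfunD (Lspace_scale a f) (Lspace_scale b f))) x)//=.
rewrite (near (LclassK (LfunZ a f)) x)//= (near (LclassK (LfunZ b f)) x)//=.
by rewrite scalerDl.
Unshelve. all: by end_near. Qed.

HB.instance Definition _ := GRing.Zmodule_isLmodule.Build R L
  scaleA scale1 scaleDr scaleDl.

Definition Lspace_norm f : R := fine ('N[mu]_p[EFin \o Lspace_fun f]%E).

Lemma Lspace_normE f :
  (Lspace_norm f)%:E = ('N[mu]_p[EFin \o Lspace_fun f])%E.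
Proof.
rewrite fineK// fin_numElt (lt_le_trans ltNy0) ?Lnorm_ge0//=.
exact: Lebesgue_finite.
Qed.

Let Lspace_normD f g : Lspace_norm (f + g) <= Lspace_norm f + Lspace_norm g.
Proof.
rewrite -lee_fin EFinD !Lspace_normE (ae_eq_Lnorm (LclassK (LfunD f g))).
- exact: (eminkowski _ (measurable_Lspace_fun f) (measurable_Lspace_fun g) p1).
- exact: measurable_Lspace_fun.
- by apply: measurable_funD; exact: measurable_Lspace_fun.
Qed.

Let Lspace_normZ a f : Lspace_norm (a *: f) = `|a| * Lspace_norm f.
Proof.
apply: EFin_inj; rewrite EFinM !Lspace_normE (ae_eq_Lnorm (LclassK (LfunZ a f))).
- exact: (LnormZ (Lfun_Sub p1 (Lspace_Lfun f))).
- exact: measurable_Lspace_fun.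
- by apply: set_mem; apply: sub_Lfun_mfun; exact: LfunZ.
Qed.

Let Lspace_norm_eq0 f : Lspace_norm f = 0 -> f = 0.
Proof.
move=> /(@fine_Lnormr_eq0 _ _ _ _ _ p1 (Lfun_Sub p1 (Lspace_Lfun f))) f0.
apply: Lspace_eqP; apply: filterS2 f0 (LclassK Lfun0).
by move=> x e1 e2 _; rewrite e2//; exact: e1.
Qed.

HB.instance Definition _ := Lmodule_isNormed.Build R L
  Lspace_normD Lspace_normZ Lspace_norm_eq0.

End Lspace_normed.

(* R^d is ['rV[R]_d], with the product sigma-algebra (as for tuples). Its
   library norm is the sup norm: it only serves for the topology, and the
   Euclidean norm is expressed through [dot_rV]. *)
Section measurable_rV.
Context {R : realType}.
Variable d : nat.

Let coord (i : 'I_d) (x : 'rV[R]_d) : R := x ord0 i.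

Let rV_set0 : g_sigma_preimage coord set0.
Proof. exact: sigma_algebra0. Qed.

Let rV_setC A : g_sigma_preimage coord A -> g_sigma_preimage coord (~` A).
Proof. exact: sigma_algebraC. Qed.

Let rV_bigcup (F : (set 'rV[R]_d)^nat) :
  (forall i, g_sigma_preimage coord (F i)) ->
  g_sigma_preimage coord (\bigcup_i (F i)).
Proof. exact: sigma_algebra_bigcup. Qed.

HB.instance Definition _ := @isMeasurable.Build default_measure_display
  'rV[R]_d (g_sigma_preimage coord) rV_set0 rV_setC rV_bigcup.

Lemma measurable_coord (i : 'I_d) :
  measurable_fun setT (fun x : 'rV[R]_d => x ord0 i).
Proof.
move=> _ Y mY; rewrite setTI; apply: sub_sigma_algebra => /=.
rewrite -bigcup_seq/=; exists i => /=; first by rewrite mem_index_enum.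
by exists Y => //; rewrite setTI.
Qed.

Lemma measurable_fun_rV d1 (T1 : measurableType d1) (f : T1 -> 'rV[R]_d) :
  (forall i, measurable_fun setT (fun x => f x ord0 i)) ->
  measurable_fun setT f.
Proof.
move=> mf.
suff sub : g_sigma_preimage coord `<=` [set A | measurable (f @^-1` A)].
  by move=> _ A mA; rewrite setTI; exact: sub.
apply: smallest_sub.
  split => /=; first by rewrite preimage_set0.
  - by move=> A mA; rewrite setTD preimage_setC; exact: measurableC.
  - by move=> F mF; rewrite preimage_bigcup; exact: bigcup_measurable.
move=> A; rewrite -bigcup_seq/= => -[i _ [B mB <-]].
by rewrite setTI; have := mf i measurableT B mB; rewrite setTI.
Qed.

End measurable_rV.

Definition image_measure d d' (T1 : measurableType d) (T2 : measurableType d')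
    (R : realFieldType) (mu : {measure set T1 -> \bar R}) (f : T1 -> T2)
    (mf : measurable_fun setT f) : {measure set T2 -> \bar R}.
Proof. by refine [the {measure set T2 -> \bar R} of pushforward mu f]. Defined.

Section gaussian.
Context {R : realType}.

Definition cons_rV d (p : 'rV[R]_d * measurableTypeR R) : 'rV[R]_d.+1 :=
  row_mx (p.2)%:M p.1 : 'rV[R]_(1 + d).

Lemma measurable_cons_rV d : measurable_fun setT (@cons_rV d).
Proof.
apply: measurable_fun_rV => i.
rewrite /cons_rV; case: (@splitP 1 d i) => j ij.
- have -> : i = @lshift 1 d j by exact/val_inj.
  rewrite [X in measurable_fun _ X](_ : _ = snd) //; apply/funext => x.
  by rewrite (@row_mxEl R 1 1 d) mxE (ord1 j) eqxx mulr1n.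
- have -> : i = @rshift 1 d j by exact/val_inj.
  rewrite [X in measurable_fun _ X]
    (_ : _ = (fun y : 'rV[R]_d => y ord0 j) \o fst).
    by apply: measurableT_comp; [exact: measurable_coord|exact: measurable_fst].
  by apply/funext => x; rewrite (@row_mxEr R 1 1 d).
Qed.

(* [cons_rV] identifies R^n * R with R^(n+1); R^0 carries the unit mass. *)
Fixpoint lebesgue_rV d : {measure set 'rV[R]_d -> \bar R} :=
  match d with
  | 0 => [the {measure set _ -> \bar R} of dirac (0 : 'rV[R]_0)]
  | n.+1 => image_measure
      [the {measure set _ -> \bar R} of (lebesgue_rV n \x lebesgue_measure)%E]
      (@measurable_cons_rV n)
  end.

Variable d : nat.
Implicit Types (x y : 'rV[R]_d).

Definition dot_rV x y : R := \sum_(i < d) x ord0 i * y ord0 i.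

Definition gauss_density x : R :=
  (2 * pi) `^ (- (d%:R / 2)) * expR (- dot_rV x x / 2).

Lemma gauss_density_ge0 x : 0 <= gauss_density x.
Proof. by rewrite mulr_ge0 ?powR_ge0 ?expR_ge0. Qed.

Lemma measurable_gauss_density : measurable_fun setT gauss_density.
Proof.
apply: measurable_funM => //; apply: measurableT_comp => //.
apply: measurable_funM => //; apply: measurableT_comp => //.
apply: measurable_sum => i.
by apply: measurable_funM; exact: measurable_coord.
Qed.

Definition gauss_measure (A : set 'rV[R]_d) : \bar R :=
  (\int[lebesgue_rV d]_(x in A) (gauss_density x)%:E)%E.

Let gauss0 : gauss_measure set0 = 0%E.
Proof. exact: integral_set0. Qed.

Let gauss_ge0 A : (0 <= gauss_measure A)%E.
Proof. by apply: integral_ge0 => x _; rewrite lee_fin gauss_density_ge0. Qed.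

Let gauss_sigma_additive : semi_sigma_additive gauss_measure.
Proof.
move=> /= A mA tA mUA; rewrite /gauss_measure ge0_integral_bigcup//=.
- apply: is_cvg_ereal_nneg_natsum_cond => n _ _; exact: gauss_ge0.
- apply: measurable_funTS; apply/measurable_EFinP.
  exact: measurable_gauss_density.
- by move=> x _; rewrite lee_fin gauss_density_ge0.
Qed.

HB.instance Definition _ := isMeasure.Build _ _ _
  gauss_measure gauss0 gauss_ge0 gauss_sigma_additive.

End gaussian.
Arguments gauss_measure : clear implicits.
Arguments lebesgue_rV : clear implicits.

Definition L2 (R : realType) (d : nat) : normedModType R :=
  LspaceType2 (gauss_measure R d).

Section sobolev.
Variables (R : realType) (d : nat).
Implicit Types (a : {ffun 'I_d -> nat}) (f g : L2 R d) (u : 'rV[R]_d -> R).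

Definition mabs a : nat := (\sum_(i < d) a i)%N.

Definition partial (i : 'I_d) u : 'rV[R]_d -> R :=
  fun x => 'D_(delta_mx ord0 i) u x.

Definition mpartial a u : 'rV[R]_d -> R :=
  foldr (fun i => iter (a i) (partial i)) u (enum 'I_d).

(* foldr partial u [:: i1; ...; ik] is the iterated partial derivative
   D_i1 (... (D_ik u)). *)
Definition smooth u := forall s : seq 'I_d,
  continuous (foldr partial u s) /\
  forall i x, derivable (foldr partial u s) x (delta_mx ord0 i).

Definition test_function u :=
  smooth u /\ exists2 K : set 'rV[R]_d, compact K & forall x, ~ K x -> u x = 0.

(* D^a f in the sense of distributions, i.e. with respect to the Lebesgue
   measure. The class g is unique when it exists. *)
Definition is_weak_derivative a f g := forall u, test_function u ->
  \int[lebesgue_rV R d]_x (Lspace_fun f x * mpartial a u x) =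
  (-1) ^+ mabs a * \int[lebesgue_rV R d]_x (Lspace_fun g x * u x).

Definition weak_derivative a f : L2 R d :=
  xget 0 [set g | is_weak_derivative a f g].

Definition sobolev_int (m : nat) : set (L2 R d) :=
  [set f | forall a, (mabs a <= m)%N -> exists g, is_weak_derivative a f g].

Definition sobolev_int_norm (m : nat) f : R :=
  Num.sqrt (\sum_(a \in [set a | (mabs a <= m)%N]) `|weak_derivative a f| ^+ 2).

Definition mehler (t : R) (x y : 'rV[R]_d) : R :=
  (1 - expR (- 2 * t)) `^ (- (d%:R / 2)) *
  expR (- ((expR (- 2 * t) * dot_rV x x - 2 * expR (- t) * dot_rV x y
            + expR (- 2 * t) * dot_rV y y) / (2 * (1 - expR (- 2 * t))))).

(* Infinite on the diagonal, hence valued in \bar R. *)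
Definition mehlerK (sigma : R) (x y : 'rV[R]_d) : \bar R :=
  (\int[lebesgue_measure]_(t in `]0%R, +oo[)
     (mehler t x y * t `^ (- (sigma / 2) - 1))%:E)%E.

Definition sobolev_seminorm (s : R) f : \bar R :=
  let m := Num.truncn s in
  (\sum_(a \in [set a | mabs a = m])
    (\int[gauss_measure R d]_y \int[gauss_measure R d]_x
       ((`|Lspace_fun (weak_derivative a f) x
           - Lspace_fun (weak_derivative a f) y| ^+ 2)%:E
        * mehlerK (2 * (s - m%:R)) x y)) `^ 2^-1)%E.

(* for s > 0 : integer order and fractional order *)
Definition sobolev (s : R) : set (L2 R d) :=
  if s \is a Num.nat then sobolev_int (Num.truncn s)
  else [set f | sobolev_int (Num.truncn s) f /\ (sobolev_seminorm s f < +oo)%E].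

Definition sobolev_norm (s : R) f : \bar R :=
  if s \is a Num.nat then (sobolev_int_norm (Num.truncn s) f)%:E
  else ((sobolev_int_norm (Num.truncn s) f)%:E + sobolev_seminorm s f)%E.

Definition sobolev_ball (s : R) : set (L2 R d) :=
  [set f | sobolev s f /\ (sobolev_norm s f <= 1)%E].

Definition hermite (k : nat) (x : R) : R :=
  (-1) ^+ k / Num.sqrt (k`!%:R) * expR (x ^+ 2 / 2)
  * derive1n k (fun y : R => expR (- (y ^+ 2) / 2)) x.

Definition mhermite (k : {ffun 'I_d -> nat}) (x : 'rV[R]_d) : R :=
  \prod_(j < d) hermite (k j) (x ord0 j).

Definition hermite_coef f (k : {ffun 'I_d -> nat}) : R :=
  \int[gauss_measure R d]_x (Lspace_fun f x * mhermite k x).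

Definition hermite_norm (s : R) f : \bar R :=
  ((\esum_(k in [set: {ffun 'I_d -> nat}])
     ((1 + (mabs k)%:R) `^ s * `|hermite_coef f k| ^+ 2)%:E) `^ 2^-1)%E.

Definition hermite_space (s : R) : set (L2 R d) :=
  [set f | (hermite_norm s f < +oo)%E].

Definition hermite_ball (s : R) : set (L2 R d) :=
  [set f | hermite_space s f /\ (hermite_norm s f <= 1)%E].

End sobolev.
Arguments sobolev_ball {R} d s.
Arguments hermite_ball {R} d s.

Section widths.
Variables (R : realType) (Y : normedModType R).

(* V is a linear subspace of dimension at most n, i.e. the span of n vectors. *)
Definition dim_le (n : nat) (V : set Y) :=
  exists e : 'I_n -> Y,
    V = [set \sum_(i < n) c i *: e i | c in [set: 'I_n -> R]].

Definition kolmogorov_width (n : nat) (F : set Y) : \bar R :=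
  ereal_inf [set ereal_sup [set ereal_inf [set (`|f - g|)%:E | g in V] | f in F]
            | V in [set V | dim_le n V]].

Definition linear_width (n : nat) (F : set Y) : \bar R :=
  ereal_inf [set ereal_sup [set (`|f - A f|)%:E | f in F]
            | A in [set A : {linear Y -> Y} | dim_le n (range A)]].

End widths.
Arguments kolmogorov_width {R Y} n F.
Arguments linear_width {R Y} n F.

(* The positive integers only: n starts at 1. *)
Definition asymp_equiv (R : realType) (A B : nat -> \bar R) :=
  exists c C : R, [/\ 0 < c, 0 < C &
    forall n, (0 < n)%N -> (c%:E * B n <= A n /\ A n <= C%:E * B n)%E].

(* Main.v *)
Require Import Defs.
From HB Require Import structures.
From mathcomp Require Import all_boot all_order all_algebra.
From mathcomp Require Import all_classical all_reals all_analysis.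
From mathcomp Require Import ring lra zify measurable_realfun.
Set Implicit Arguments.
Unset Strict Implicit.
Unset Printing Implicit Defensive.
Import Order.TTheory GRing.Theory Num.Theory.
Import numFieldNormedType.Exports HBNNSimple.
Local Open Scope classical_set_scope.
Local Open Scope ring_scope.

(** The Hermite polynomials diagonalize the whole problem. In terms of the
    coefficients [hermite_coef f k] the space H^s is a weighted l2 space with
    weights (1 + |k|)^s, and the widths of its unit ball are explicit. Cutting the
    expansion after total degree m - 1 is a linear map whose rank is the number of
    k with |k| <= m - 1, and its error is at most (1 + m)^(-s/2)
    ([linear_width_le]). Conversely, a subspace whose dimension n is smaller than
    the number of k with |k| <= m is orthogonal to some combination of the
    corresponding basis elements, so that the ball contains an element at distance
    (1 + m)^(-s/2) from the subspace ([kolmogorov_hbound_ge]). Hence both widths of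
    the ball of H^s are equal to (1 + M)^(-s/2), where M = M(n) is determined by
    binomial(M - 1 + d, d) <= n < binomial(M + d, d). As M^d is asymptotic to n d!,
    the order n^(-s/(2d)) and the limit follow.

    The upper bound only uses that the set is contained in a multiple of the ball of
    H^s, the lower bound only uses that it contains the finite Hermite expansions
    of small H^s norm; [widths_of_comparison] is stated for every such set. The
    remaining task is to show that the Sobolev ball is one.

    Testing a weak derivative of order a against cut-offs of the functions
    He_k exp (-|x|^2/2) shows that its coefficient of index k is
    sqrt ((k + a)! / k!) times the coefficient of index k + a of the function
    ([hermite_coef_weak_derivative]). Differentiating m times along the largest
    coordinate of k thus multiplies the squared coefficient by a factor of order
    |k|^m, and Bessel's inequality controls the integer part of the norm ([hbound_of_derivatives]). In the other
    direction, integration by parts shows that polynomials have weak derivatives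
    ([hcomb_weak_derivative]), and Parseval's identity bounds them
    ([hbound_weak_derivative]).

    The fractional part of the norm is diagonal as well. By Mehler's formula the
    kernel M_t maps H_k to e^(-t|k|) H_k ([integral_mhermite_mehler]), so that the
    double integral of |f(x) - f(y)|^2 M_t(x, y) is the sum of
    2 (1 - e^(-t|k|)) times the squared coefficients ([mehler_form_ge],
    [mehler_form_hcomb]). Integrated against t^(-th-1) dt, the factor
    1 - e^(-t|k|) becomes |k|^th up to constants ([frac_integral_le],
    [frac_integral_ge]).

    Parseval's identity rests on the completeness of the Hermite system. It is
    obtained by the closure argument of [papprox_Lfun2]: the bounded functions whose
    multiplication preserves approximability by polynomials form an algebra stable
    under bounded limits, which contains Gaussian bells, hence the indicators of
    half-spaces and of all measurable sets. *)

(** * Integration with respect to Lebesgue and Gauss measure on R^d *)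

Section density.
Context (disp : measure_display) (T : measurableType disp) (R : realType).
Context (mu nu : {measure set T -> \bar R}) (w : T -> R).
Hypotheses (w0 : forall x, 0 <= w x) (mw : measurable_fun setT w).
Hypothesis nuE : forall A, measurable A ->
  nu A = (\int[mu]_(x in A) (w x)%:E)%E.
Local Open Scope ereal_scope.

Let integral_nnsfun_density (f : {nnsfun T >-> R}) :
  \int[nu]_x (f x)%:E = \int[mu]_x ((f x)%:E * (w x)%:E).
Proof.
under [LHS]eq_integral do rewrite fimfunE -fsumEFin//.
rewrite [LHS]ge0_integral_fsum//; last 2 first.
  - by move=> r; exact/measurable_EFinP/measurableT_comp.
  - by move=> n x _; rewrite EFinM nnfun_muleindic_ge0.
under [RHS]eq_integral.
  move=> x xD; rewrite fimfunE -fsumEFin// muleC ge0_mule_fsumr; last first.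
    by move=> r; rewrite EFinM nnfun_muleindic_ge0.
  over.
rewrite [RHS]ge0_integral_fsum//; last 2 first.
  - move=> r; apply/measurable_EFinP; apply: measurable_funM => //.
    by do 2 apply/measurableT_comp => //.
  - move=> n x _; rewrite mule_ge0// ?lee_fin//.
    by rewrite -lee_fin EFinM nnfun_muleindic_ge0.
apply: eq_fsbigr => r /set_mem[t _ ftr].
have r0 : (0 <= r)%R by rewrite -ftr.
under [RHS]eq_integral do rewrite EFinM muleCA.
under [LHS]eq_integral do rewrite EFinM.
rewrite [LHS]ge0_integralZl//; first last.
  by apply/measurable_EFinP; exact: measurable_indic.
rewrite [RHS]ge0_integralZl//; first last.
- by move=> x _; rewrite mule_ge0// lee_fin.
- by apply/measurable_EFinP; apply: measurable_funM => //.
congr (_ * _); rewrite integral_indic// setIT nuE// integral_mkcond.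
apply: eq_integral => x _; rewrite patchE indicE.
by case: ifP => _; rewrite ?mule1 ?mule0.
Qed.

(** Simple functions first, then monotone limits of them. *)
Lemma ge0_integral_density (f : T -> \bar R) : measurable_fun setT f ->
  (forall x, 0 <= f x) -> \int[nu]_x f x = \int[mu]_x (f x * (w x)%:E).
Proof.
move=> mf f0; pose f_ := nnsfun_approx measurableT mf.
transitivity (lim (\int[nu]_x (f_ n x)%:E @[n --> \oo])).
  rewrite -monotone_convergence//=.
  - apply: eq_integral => ? /[!inE] xD; apply/esym/cvg_lim => //=.
    exact: cvg_nnsfun_approx.
  - by move=> n; exact/measurable_EFinP/measurable_funTS.
  - by move=> n ? _; rewrite lee_fin.
  - by move=> ? _ ? ? mn; rewrite lee_fin; exact/lefP/nd_nnsfun_approx.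
transitivity (lim (\int[mu]_x ((f_ n x)%:E * (w x)%:E) @[n --> \oo])).
  by apply: congr_lim; apply/funext => n /=; exact: integral_nnsfun_density.
rewrite -monotone_convergence//=.
- apply: eq_integral => x /[!inE] xD; apply/cvg_lim => //=.
  by apply: cvgeZr => //; exact: cvg_nnsfun_approx.
- by move=> n; apply: emeasurable_funM; exact/measurable_EFinP.
- by move=> n x _; rewrite mule_ge0// lee_fin.
- move=> x _ a b ab; rewrite lee_wpmul2r// lee_fin//.
  exact/lefP/nd_nnsfun_approx.
Qed.

Lemma integral_density (f : T -> R) : measurable_fun setT f ->
  \int[nu]_x (f x)%:E = \int[mu]_x (f x * w x)%:E.
Proof.
move=> mf; have mf' : measurable_fun setT (EFin \o f) by exact/measurable_EFinP.
rewrite integralE [RHS]integralE; congr (_ - _).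
- rewrite ge0_integral_density//; last exact: measurable_funepos.
  by apply: eq_integral => x _; rewrite !funeposE -!EFin_max -EFinM maxr_pMl// mul0r.
- rewrite ge0_integral_density//; last exact: measurable_funeneg.
  apply: eq_integral => x _; rewrite !funenegE -!EFin_max -EFinM.
  by rewrite maxr_pMl// mul0r mulNr.
Qed.

Lemma integrable_density (f : T -> R) : measurable_fun setT f ->
  nu.-integrable setT (EFin \o f) <->
  mu.-integrable setT (fun x => (f x * w x)%:E).
Proof.
move=> mf; have mf' : measurable_fun setT (EFin \o f) by exact/measurable_EFinP.
have E : \int[nu]_x `|(EFin \o f) x| = \int[mu]_x `|(f x * w x)%:E|.
  rewrite ge0_integral_density//; last exact: measurableT_comp.
  by apply: eq_integral => x _ /=; rewrite normrM (ger0_norm (w0 x)).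
split=> /integrableP[_ h]; apply/integrableP; split => //.
- by apply/measurable_EFinP; exact: measurable_funM.
- by rewrite -E.
- by rewrite E.
Qed.

End density.

Section lebesgue_rV.
Context {R : realType}.
Local Notation leb := (@lebesgue_measure R).
Local Open Scope ereal_scope.

Lemma cons_rV0 d (x : 'rV[R]_d) (t : R) : (cons_rV (x, t) ord0 ord0 = t)%R.
Proof.
rewrite /cons_rV (_ : ord0 = @lshift 1 d ord0); last exact/val_inj.
by rewrite (@row_mxEl R 1 1 d) mxE eqxx mulr1n.
Qed.

Lemma cons_rVS d (x : 'rV[R]_d) (t : R) (i : 'I_d) :
  (cons_rV (x, t) ord0 (lift ord0 i) = x ord0 i)%R.
Proof.
rewrite /cons_rV (_ : lift ord0 i = @rshift 1 d i); last exact/val_inj.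
by rewrite (@row_mxEr R 1 1 d).
Qed.

Definition box_rV d (n : nat) : set 'rV[R]_d :=
  [set x | forall i, (`|x ord0 i| <= n%:R)%R].

Lemma measurable_box_rV d n : measurable (@box_rV d n).
Proof.
rewrite (_ : box_rV _ = \bigcap_(i in [set: 'I_d])
   ((fun x : 'rV[R]_d => x ord0 i) @^-1` [set t | (`|t| <= n%:R)%R])).
  apply: fin_bigcap_measurable => // i _; rewrite -[X in measurable X]setTI.
  apply: measurable_coord => //.
  rewrite (_ : [set t | _] = `[(- n%:R)%R, n%:R]%classic).
    exact: measurable_itv.
  by apply/seteqP; split => t /=; rewrite in_itv/= ler_norml.
by apply/seteqP; split => x /= h i; [move=> _; exact: h|exact: (h i I)].
Qed.

Lemma lebesgue_box_rV d n : lebesgue_rV R d (box_rV n) < +oo.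
Proof.
elim: d => [|d IH].
  by rewrite /= diracE; case: (_ \in _); rewrite ltry.
rewrite /= /pushforward.
rewrite (_ : _ @^-1` _ = @box_rV d n `*` `[(- n%:R)%R, n%:R]%classic).
  rewrite product_measure1E//; last exact: measurable_box_rV.
  rewrite lte_mul_pinfty ?fin_numElt//.
  - by rewrite IH andbT (lt_le_trans _ (measure_ge0 _ _)).
  - by rewrite /= lebesgue_measure_itv/=; case: ifP; rewrite ?ltry.
apply/seteqP; split => [[x t]/= h|[x t]/= [h1 h2] i].
  split; first by move=> i; have := h (lift ord0 i); rewrite cons_rVS.
  by have := h ord0; rewrite cons_rV0 in_itv/= ler_norml.
have [j ->|->] := unliftP ord0 i; first by rewrite cons_rVS.
by rewrite cons_rV0; move: h2; rewrite in_itv/= ler_norml.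
Qed.

Lemma sigma_finite_lebesgue_rV d : sigma_finite setT (lebesgue_rV R d).
Proof.
exists (@box_rV d) => [|n]; last first.
  by split; [exact: measurable_box_rV|exact: lebesgue_box_rV].
apply/esym; rewrite -subTset => x _.
exists (Num.truncn (\sum_i `|x ord0 i|)%R).+1 => // i.
rewrite (@le_trans _ _ (\sum_i `|x ord0 i|)%R)//.
  by rewrite (bigD1 i)//= lerDl sumr_ge0.
by rewrite ltW// truncnS_gt.
Qed.

(** [lebesgue_rV] is a bundled measure already, so that the sigma-finite
    structure has to be attached to the underlying set function. *)
Definition leb_rV d : set 'rV[R]_d -> \bar R := lebesgue_rV R d.
HB.instance Definition _ d := Measure.on (@leb_rV d).
HB.instance Definition _ d := @Measure_isSigmaFinite.Build _ _ R
  (@leb_rV d) (@sigma_finite_lebesgue_rV d).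

Lemma ge0_integral_lebesgue_rVS d (f : 'rV[R]_d.+1 -> \bar R) :
  measurable_fun setT f -> (forall x, 0 <= f x) ->
  \int[lebesgue_rV R d.+1]_x f x =
  \int[lebesgue_rV R d]_x \int[leb]_t f (cons_rV (x, t)).
Proof.
move=> mf f0; rewrite /= /image_measure.
rewrite ge0_integral_pushforward//=; last exact: measurable_cons_rV.
rewrite preimage_setT.
have := @fubini_tonelli1 _ _ _ _ _ (@leb_rV d) leb (f \o @cons_rV R d).
apply => [|x]; last exact: f0.
by apply: (measurableT_comp mf); exact: measurable_cons_rV.
Qed.

Lemma ge0_integral_lebesgue_rV0 (f : 'rV[R]_0 -> \bar R) :
  measurable_fun setT f -> \int[lebesgue_rV R 0]_x f x = f 0%R.
Proof. by move=> mf; rewrite /= integral_dirac// diracT mul1e. Qed.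

Lemma integrable_cons_rV d (f : 'rV[R]_d.+1 -> R) :
  (lebesgue_rV R d.+1).-integrable setT (EFin \o f) ->
  (lebesgue_rV R d \x leb).-integrable setT ((EFin \o f) \o @cons_rV R d).
Proof.
move=> /integrableP[mf /= fi].
have mc : measurable_fun setT (@cons_rV R d) by exact: measurable_cons_rV.
apply/integrableP; split; first exact: measurableT_comp.
move: fi; rewrite /image_measure ge0_integral_pushforward//=.
by apply/measurable_EFinP; apply: measurableT_comp => //; exact/measurable_EFinP.
Qed.

Lemma integral_lebesgue_rVS d (f : 'rV[R]_d.+1 -> R) :
  (lebesgue_rV R d.+1).-integrable setT (EFin \o f) ->
  \int[lebesgue_rV R d.+1]_x (f x)%:E =
  \int[lebesgue_rV R d]_x \int[leb]_t (f (cons_rV (x, t)))%:E.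
Proof.
move=> fi; have fi' := integrable_cons_rV fi.
have mc : measurable_fun setT (@cons_rV R d) by exact: measurable_cons_rV.
have mf : measurable_fun setT (EFin \o f) by case/integrableP: fi.
rewrite /= /image_measure.
have := integral_pushforward (mu := (lebesgue_rV R d \x leb)) mc mf.
move=> -> //.
rewrite preimage_setT.
by have := @integral12_prod_meas1 _ _ _ _ _ (@leb_rV d) leb _ fi' => <-.
Qed.

(** Tonelli gives the formula for nonnegative factors; applied to the absolute
    values it yields the integrability that Fubini needs in general. *)
Lemma integral_prod_coord d (g : 'I_d -> R -> R) :
  (forall i, leb.-integrable setT (EFin \o g i)) ->
  (lebesgue_rV R d).-integrable setT (fun x => (\prod_i g i (x ord0 i))%:E) /\
  \int[lebesgue_rV R d]_x (\prod_i g i (x ord0 i))%:E =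
    (\prod_i \int[leb]_t g i t)%:E.
Proof.
have mg d' (h : 'I_d' -> R -> R) : (forall i, measurable_fun setT (h i)) ->
    measurable_fun setT (fun x : 'rV[R]_d' => \prod_i h i (x ord0 i))%R.
  move=> mh; apply: measurable_prod => i _; apply: measurableT_comp => //.
  exact: measurable_coord.
have step d' (h : 'I_d'.+1 -> R -> R) :
    (forall i, leb.-integrable setT (EFin \o h i)) -> forall x,
    \int[leb]_t (\prod_i h i (cons_rV (x, t) ord0 i))%:E =
    (\int[leb]_t h ord0 t * \prod_i h (lift ord0 i) (x ord0 i))%:E.
  move=> ih x; under eq_integral => t _.
    rewrite big_ord_recl cons_rV0 (eq_bigr (fun i => h (lift ord0 i) (x ord0 i))).
      rewrite EFinM; over.
    by move=> i _; rewrite cons_rVS.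
  rewrite /= integralZr//; last exact: ih.
  rewrite [RHS]EFinM; congr (_ * _).
  by rewrite /Rintegral fineK//; exact: integrable_fin_num (ih ord0).
have E d' (h : 'I_d' -> R -> R) :
    (forall i, leb.-integrable setT (EFin \o h i)) ->
    (forall i t, (0 <= h i t)%R) ->
    \int[lebesgue_rV R d']_x (\prod_i h i (x ord0 i))%:E =
    (\prod_i \int[leb]_t h i t)%:E.
  elim: d' h => [|d' IH] h ih h0.
    rewrite ge0_integral_lebesgue_rV0; last first.
      by apply/measurable_EFinP; apply: mg; case.
    by rewrite !big_ord0.
  have mh i : measurable_fun setT (h i).
    by have /integrableP[/measurable_EFinP] := ih i.
  rewrite ge0_integral_lebesgue_rVS; last 2 first.
  - by apply/measurable_EFinP; exact: mg.
  - by move=> x; rewrite lee_fin prodr_ge0.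
  under eq_integral do rewrite step//.
  under eq_integral do rewrite EFinM.
  rewrite ge0_integralZl//=; last 3 first.
  - apply/measurable_EFinP.
    by apply: (mg _ (fun i => h (lift ord0 i))) => i; exact: mh.
  - by move=> x _; rewrite lee_fin prodr_ge0.
  - by rewrite lee_fin Rintegral_ge0.
  rewrite (IH (fun i => h (lift ord0 i)))//.
  by rewrite big_ord_recl EFinM.
move=> ig; have mgi i : measurable_fun setT (g i).
  by have /integrableP[/measurable_EFinP] := ig i.
have igi d' (h : 'I_d' -> R -> R) :
   (forall i, leb.-integrable setT (EFin \o h i)) ->
   (lebesgue_rV R d').-integrable setT (fun x => (\prod_i h i (x ord0 i))%:E).
  move=> ih; have mh i : measurable_fun setT (h i).
    by have /integrableP[/measurable_EFinP] := ih i.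
  apply/integrableP; split; first by apply/measurable_EFinP; exact: mg.
  have := E _ (fun i t => `|h i t|%R) => E'.
  under eq_integral do rewrite /= normr_prod.
  by rewrite E' ?ltry// => i; exact: (integrable_norm (ih i)).
split; first exact: igi.
elim: d g ig mgi => [|d IH] g ig mgi.
  rewrite ge0_integral_lebesgue_rV0; last first.
    by apply/measurable_EFinP; apply: mg; case.
  by rewrite !big_ord0.
rewrite integral_lebesgue_rVS; last exact: igi.
under eq_integral do rewrite step//.
under eq_integral do rewrite EFinM.
have ig' i : leb.-integrable setT (EFin \o g (lift ord0 i)) by exact: ig.
rewrite integralZl//=; last exact: (igi _ (fun i => g (lift ord0 i))).
rewrite (IH (fun i => g (lift ord0 i)))//.
by rewrite big_ord_recl EFinM.
Qed.

End lebesgue_rV.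

(** * One-dimensional Gaussian integrals and Hermite polynomials *)

Section line_integrals.
Context {R : realType}.
Local Notation leb := (@lebesgue_measure R).
Implicit Types (f F : R -> R).

Lemma cvg_integral_sym_itv f : leb.-integrable setT (EFin \o f) ->
  (\int[leb]_(t in `[(- n%:R)%R, n%:R%R]) (f t)%:E)%E @[n --> \oo] -->
  (\int[leb]_t (f t)%:E)%E.
Proof.
move=> fi; have mf : measurable_fun setT (EFin \o f) by case/integrableP: fi.
pose g n := (EFin \o f) \_ `[- n%:R, n%:R]%classic.
have [] := @dominated_convergence _ _ _ leb setT measurableT g (EFin \o f)
  (abse \o (EFin \o f)).
- by move=> n; apply/(measurable_restrictT _ _).1 => //; exact: measurable_funTS.
- by [].
- apply: aeW => x _; apply: cvg_near_cst.
  exists (Num.truncn `|x|).+1 => // n /= xn; rewrite /g patchE mem_set//=.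
  rewrite in_itv/= -ler_norml (le_trans (ltW (truncnS_gt _)))//.
  by rewrite ler_nat.
- exact: integrable_abse.
- apply: aeW => x n _; rewrite /g patchE; case: ifP => //= _.
  by rewrite normr0 lee_fin.
move=> _ _; apply: cvg_trans.
rewrite (_ : (fun n => _) =
   (fun n => \int[leb]_(t in `[(- n%:R)%R, n%:R%R]) (f t)%:E)%E)//.
by apply/funext => n; rewrite [RHS]integral_mkcond.
Qed.

(** The integral over [-n, n] is F(n) - F(-n). *)
Lemma integral_derivative_eq0 F f :
  (forall x, is_derive x (1:R) F (f x)) -> continuous f ->
  leb.-integrable setT (EFin \o f) ->
  F n%:R @[n --> \oo] --> 0 -> F (- n%:R) @[n --> \oo] --> 0 ->
  \int[leb]_t f t = 0.
Proof.
move=> dF cf fi F1 F2.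
suff : (\int[leb]_t (f t)%:E = 0)%E by rewrite /Rintegral => ->.
have /cvg_lim <- // := cvg_integral_sym_itv fi; apply/cvg_lim => //.
have cF : continuous F.
  by move=> x; apply: differentiable_continuous; apply/derivable1_diffP; case: (dF x).
have E n : (\int[leb]_(t in `[(- n.+1%:R)%R, n.+1%:R%R]) (f t)%:E =
    (F n.+1%:R - F (- n.+1%:R))%:E)%E.
  rewrite (@continuous_FTC2 _ f F)//.
  - by rewrite gtrN// ltr0Sn.
  - exact: continuous_subspaceT.
  - split=> [x _||]; first by case: (dF x).
    + by apply: cvg_at_right_filter; exact: cF.
    + by apply: cvg_at_left_filter; exact: cF.
  - by move=> x _; rewrite derive1E; apply: derive_val; exact: dF.
rewrite -(cvg_shiftS (fun n => \int[leb]_(t in `[(- n%:R)%R, n%:R%R]) (f t)%:E)%E).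
rewrite (_ : (fun n => _) = (fun n => (F n.+1%:R - F (- n.+1%:R))%:E)); last first.
  by apply/funext => n; exact: E.
apply: cvg_EFin; first by near=> n.
rewrite -[X in _ --> X](subrr 0); apply: cvgB.
  by rewrite (cvg_shiftS (fun n => F n%:R)).
by rewrite (cvg_shiftS (fun n => F (- n%:R))).
Unshelve. all: by end_near. Qed.

End line_integrals.

Section gauss_growth.
Context {R : realType}.
Local Notation leb := (@lebesgue_measure R).
Implicit Types (p q : {poly R}) (m s a b t : R).

Lemma normal_pdfE1 m s t : s != 0 ->
  normal_pdf m s t = normal_peak s * expR (- (t - m) ^+ 2 / (s ^+ 2 *+ 2)).
Proof. by move=> s0; rewrite normal_pdfE. Qed.

Lemma poly_growth p b : 0 < b ->
  exists2 C : R, 0 <= C & forall t, `|p.[t]| <= C * expR (b * `|t|).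
Proof.
elim/poly_ind: p b => [|p c IH] b b0.
  by exists 0 => // t; rewrite horner0 normr0 mul0r.
have [C C0 h] := IH (b / 2) (divr_gt0 b0 (ltr0Sn _ 1)).
exists (C * (2 / b) + `|c|) => [|t].
  by rewrite addr_ge0// mulr_ge0// divr_ge0// ltW.
rewrite hornerMXaddC (le_trans (ler_normD _ _))// mulrDl lerD//; last first.
  rewrite ler_peMr// -[leLHS]expR0 ler_expR mulr_ge0// ltW//.
rewrite normrM.
have -> : expR (b * `|t|) = expR (b / 2 * `|t|) * expR (b / 2 * `|t|).
  by rewrite -expRD; congr expR; lra.
rewrite (_ : C * (2 / b) * _ = (C * expR (b / 2 * `|t|)) * (2 / b * expR (b / 2 * `|t|))); last by ring.
apply: ler_pM => //.
have := expR_ge1Dx (b / 2 * `|t|); move/(le_trans (_ : _ <= 1 + _)) => /(_ (b / 2 * `|t|)).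
rewrite lerDr ler01 => /(_ isT) h1.
rewrite -(@ler_pM2l _ (b / 2)) ?divr_gt0// mulrA.
by rewrite (_ : b / 2 * (2 / b) = 1) ?mul1r//; field; rewrite gt_eqF.
Qed.

Let square_completion a b m t u v M : u = v - a -> u * 2 * M = b + 2 * m * v ->
  b * t + a * t ^+ 2 + - (t - m) ^+ 2 * v =
  (u * M ^+ 2 - m ^+ 2 * v) + - (t - M) ^+ 2 * u.
Proof.
move=> uE hM; apply/eqP; rewrite -subr_eq0.
have -> : b * t + a * t ^+ 2 + - (t - m) ^+ 2 * v -
    (u * M ^+ 2 - m ^+ 2 * v + - (t - M) ^+ 2 * u) =
    - t * (u * 2 * M - (b + 2 * m * v)) by rewrite uE; ring.
by rewrite hM subrr mulr0.
Qed.

(** Completing the square turns a sub-Gaussian weight into a multiple of a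
    normal density. *)
Lemma integrable_exp_normal m s a b : s != 0 -> a < (s ^+ 2 *+ 2)^-1 ->
  leb.-integrable setT
    (fun t => (expR (b * `|t| + a * t ^+ 2) * normal_pdf m s t)%:E).
Proof.
move=> s0; set v := (s ^+ 2 *+ 2)^-1 => as2.
have [u uE] : exists u, u = v - a by exists (v - a).
have u0 : 0 < u by rewrite uE subr_gt0.
have [s' s'0 s'2] : exists2 s', s' != 0 & (s' ^+ 2 *+ 2)^-1 = u.
  exists (Num.sqrt ((u *+ 2)^-1)).
    by rewrite gt_eqF// sqrtr_gt0 invr_gt0 mulrn_wgt0.
  rewrite sqr_sqrtr ?invr_ge0 ?mulrn_wge0 ?(ltW u0)//.
  by rewrite -(mulr_natl u) -(mulr_natl (_^-1)) invfM invrK mulKf// pnatr_eq0.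
have hM b' : exists M, u * 2 * M = b' + 2 * m * v.
  exists ((u * 2)^-1 * (b' + 2 * m * v)).
  by rewrite mulVKf// mulf_neq0// gt_eqF.
have P0 : normal_peak s' != 0 by rewrite gt_eqF// normal_peak_gt0.
have E b' : exists K M, forall t, expR (b' * t + a * t ^+ 2) * normal_pdf m s t =
    K * normal_pdf M s' t.
  have [M ME] := hM b'; exists (normal_peak s * expR (u * M ^+ 2 - m ^+ 2 * v)
    / normal_peak s'), M => t.
  rewrite !normal_pdfE1// s'2 -/v mulrCA -expRD (square_completion t uE ME) expRD.
  by rewrite !mulrA divfK.
have I b' : leb.-integrable setT
    (fun t => (expR (b' * t + a * t ^+ 2) * normal_pdf m s t)%:E).
  have [K [M KM]] := E b'; under eq_fun do rewrite KM EFinM.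
  by apply: integrableZl => //; exact: integrable_normal_pdf.
have mI : measurable_fun setT (fun t : R => expR (b * `|t| + a * t ^+ 2) * normal_pdf m s t).
  apply: measurable_funM; last exact: measurable_normal_pdf.
  apply: measurableT_comp => //; apply: measurable_funD.
    by apply: measurable_funM => //; exact: measurableT_comp.
  by apply: measurable_funM => //; exact: measurable_funX.
apply: (le_integrable measurableT _ _ (integrableD measurableT (I b) (I (- b)))).
  by apply/measurable_EFinP.
move=> t _ /=; rewrite lee_fin normrM (ger0_norm (expR_ge0 _)).
rewrite (ger0_norm (normal_pdf_ge0 _ _ _)) -mulrDl normrM.
rewrite (ger0_norm (normal_pdf_ge0 _ _ _)) (@ger0_norm _ (_ + _)) ?addr_ge0 ?expR_ge0//.
rewrite ler_wpM2r ?normal_pdf_ge0//.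
have [t0|t0] := leP 0 t.
  by rewrite ger0_norm// lerDl expR_ge0.
by rewrite ltr0_norm// mulNr mulrN lerDr expR_ge0.
Qed.

Lemma integrable_poly_normal p m s : s != 0 ->
  leb.-integrable setT (fun t => (p.[t] * normal_pdf m s t)%:E).
Proof.
move=> s0; have [C C0 h] := poly_growth p ltr01.
have := @integrable_exp_normal m s 0 1 s0.
rewrite invr_gt0 mulrn_wgt0 ?exprn_even_gt0// => /(_ isT) I.
apply: (le_integrable measurableT _ _ (integrableZl measurableT C I)).
  apply/measurable_EFinP; apply: measurable_funM; last exact: measurable_normal_pdf.
  by apply: continuous_measurable_fun; exact: continuous_horner.
move=> t _ /=; rewrite lee_fin !normrM (ger0_norm (normal_pdf_ge0 _ _ _)).
rewrite mulrA ler_wpM2r ?normal_pdf_ge0// (ger0_norm C0) (ger0_norm (expR_ge0 _)).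
by rewrite mul0r addr0 (le_trans (h t))// ler_wpM2l// ler_expR.
Qed.

End gauss_growth.

Section stein.
Context {R : realType}.
Local Notation leb := (@lebesgue_measure R).
Variables (m s : R).
Hypothesis s0 : s != 0.
Implicit Types (p q : {poly R}).

Definition normal_mean p : R := \int[leb]_t (p.[t] * normal_pdf m s t).

Lemma normal_meanD p q : normal_mean (p + q) = normal_mean p + normal_mean q.
Proof.
rewrite /normal_mean -RintegralD//; try exact: integrable_poly_normal.
by apply: eq_Rintegral => t _; rewrite hornerD mulrDl.
Qed.

Lemma normal_meanZ c p : normal_mean (c *: p) = c * normal_mean p.
Proof.
rewrite /normal_mean -RintegralZl//; last exact: integrable_poly_normal.
by apply: eq_Rintegral => t _; rewrite hornerZ mulrA.
Qed.

Lemma normal_meanB p q : normal_mean (p - q) = normal_mean p - normal_mean q.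
Proof. by rewrite normal_meanD -scaleN1r normal_meanZ mulN1r. Qed.

Lemma normal_mean1 : normal_mean 1 = 1.
Proof.
rewrite /normal_mean /Rintegral.
under eq_integral do rewrite hornerC mul1r.
by rewrite integral_normal_pdf.
Qed.

Lemma is_derive_normal_pdf x :
  is_derive x (1:R) (normal_pdf m s) (- (x - m) / s ^+ 2 * normal_pdf m s x).
Proof.
have -> : normal_pdf m s = (fun t => normal_peak s * expR (- (t - m) ^+ 2 / (s ^+ 2 *+ 2))).
  by apply/funext => t; rewrite normal_pdfE1.
apply: is_derive_eq; rewrite /GRing.scale/=.
by rewrite -(mulr_natr (s ^+ 2)); field.
Qed.

(** Decay of order 1/|t| is all that the boundary terms of an integration by parts
    require; it follows from the bound of |t p(t)| by an exponential. *)
Lemma normal_pdf_decay p :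
  exists C : R, forall t, `|t| * `|p.[t] * normal_pdf m s t| <= C.
Proof.
have [C C0 h] := poly_growth ('X * p) ltr01.
have s2 : 0 < s ^+ 2 by rewrite exprn_even_gt0.
exists (C * normal_peak s * expR (`|m| + s ^+ 2 / 2)) => t.
rewrite normrM mulrA -normrM (ger0_norm (normal_pdf_ge0 _ _ _)).
have := h t; rewrite hornerM hornerX => ht.
rewrite (le_trans (ler_wpM2r (normal_pdf_ge0 _ _ _) ht))//.
rewrite normal_pdfE1// -mulrA -mulrA ler_wpM2l// mulrCA ler_wpM2l ?normal_peak_ge0//.
rewrite -expRD ler_expR mul1r.
have : `|t| <= `|m| + `|t - m| by rewrite (le_trans _ (ler_normD _ _))// subrKC.
have -> : - (t - m) ^+ 2 = - `|t - m| ^+ 2 by rewrite real_normK// num_real.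
move=> H; apply: (le_trans (lerD H (lexx _))); rewrite -addrA lerD2l.
rewrite -subr_ge0 (_ : _ - _ = (`|t - m| - s ^+ 2) ^+ 2 / (s ^+ 2 *+ 2)).
  by rewrite divr_ge0 ?sqr_ge0// mulrn_wge0// ltW.
by rewrite -(mulr_natr (s ^+ 2)); field; rewrite s0.
Qed.

(** Stein's identity: p times the normal density has derivative
    (p' - (t - m) p / s^2) times that density. *)
Lemma normal_stein p :
  normal_mean (('X - m%:P) * p) = s ^+ 2 * normal_mean p^`().
Proof.
have s2 : s ^+ 2 != 0 by rewrite expf_neq0.
suff : normal_mean (p^`() - (s ^+ 2)^-1 *: (('X - m%:P) * p)) = 0.
  rewrite normal_meanB normal_meanZ => /eqP; rewrite subr_eq0 => /eqP ->.
  by rewrite mulrA divff// mul1r.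
have dec C (F : R -> R) (u : nat -> R) : (forall t, `|t| * `|F t| <= C) ->
    (forall n, `|u n| = n%:R) -> F (u n) @[n --> \oo] --> 0.
  move=> FC un; have C0 : 0 <= C by rewrite (le_trans _ (FC 0))// normr0 mul0r.
  rewrite -(cvg_shiftS (fun n => F (u n))); apply/norm_cvg0P.
  apply: (@squeeze_cvgr _ _ _ _ (cst 0) (fun n => C * harmonic n)).
  - near=> n; rewrite normr_ge0/= /harmonic.
    by rewrite ler_pdivlMr// mulrC -un.
  - exact: cvg_cst.
  - rewrite -[X in _ --> X](mulr0 C); apply: cvgM; first exact: cvg_cst.
    exact: cvg_harmonic.
have [C hC] := normal_pdf_decay p.
apply: (integral_derivative_eq0 (F := fun t => p.[t] * normal_pdf m s t)).
- move=> x; have := is_derive_normal_pdf x => ?.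
  apply: is_derive_eq; rewrite /GRing.scale/=.
  by rewrite hornerD hornerN hornerZ hornerM hornerXsubC; field.
- move=> x; apply: cvgM; first exact: continuous_horner.
  exact: continuous_normal_pdf.
- exact: integrable_poly_normal.
- by apply: (dec C _ (fun n => n%:R) hC) => n; rewrite normr_nat.
- by apply: (dec C _ (fun n => - n%:R) hC) => n; rewrite normrN normr_nat.
Unshelve. all: by end_near. Qed.

End stein.

Section hermite_polynomials.
Context {R : realType}.
Local Notation leb := (@lebesgue_measure R).
Implicit Types (p q : {poly R}).

(** Normalized to be monic. The recursion comes from differentiating
    (-1)^k He_k exp (-x^2/2), which is the k-th derivative of exp (-x^2/2). *)
Fixpoint He (k : nat) : {poly R} :=
  if k is k'.+1 then 'X * He k' - (He k')^`() else 1.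

Lemma HeS k : He k.+1 = 'X * He k - (He k)^`(). Proof. by []. Qed.

Lemma deriv_He k : (He k.+1)^`() = k.+1%:R *: He k.
Proof.
elim: k => [|k IH]; first by rewrite /= derivC subr0 mulr1 derivX scale1r.
rewrite HeS derivB derivM derivX mul1r !IH derivZ -scalerAr -addrA -scalerBr.
by rewrite -HeS -[X in X + _]scale1r -scalerDl nat1r.
Qed.

Lemma deriv_He' k : (He k)^`() = k%:R *: He k.-1.
Proof. by case: k => [|k]; rewrite ?deriv_He// derivC scale0r. Qed.

Lemma derivn_He k n : (He k)^`(n) = (k ^_ n)%:R *: He (k - n).
Proof.
elim: n k => [|n IH] k; first by rewrite derivn0 subn0 ffactn0 scale1r.
rewrite derivSn deriv_He' derivnZ IH scalerA -natrM -ffactnS.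
by rewrite subnS -subn1 subnAC subn1.
Qed.

Lemma size_He k : size (He k) = k.+1.
Proof.
elim: k => [|k IH]; first by rewrite size_poly1.
have Hk0 : He k != 0 by rewrite -size_poly_eq0 IH.
rewrite HeS size_polyDl mulrC size_mulX// ?IH// size_polyN.
by rewrite (leq_trans (lt_size_deriv Hk0))// IH.
Qed.

Lemma He_lead k : lead_coef (He k) = 1.
Proof.
elim: k => [|k IH]; first by rewrite lead_coef1.
rewrite /= lead_coefDl ?lead_coefM ?lead_coefX ?mul1r//.
have Hk0 : He k != 0 by rewrite -size_poly_eq0 size_He.
rewrite size_polyN mulrC size_mulX// (leq_trans (lt_size_deriv Hk0))//.
Qed.

(** The Hermite polynomials have every degree, hence span all polynomials. *)
Lemma poly_sum_He p n : (size p <= n)%N ->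
  exists c : nat -> R, p = \sum_(k < n) c k *: He k.
Proof.
elim: n p => [|n IH] p sp.
  exists (fun=> 0); rewrite big_ord0.
  by apply/eqP; rewrite -size_poly_eq0 -leqn0.
have [|c hc] := IH (p - p`_n *: He n).
  apply/leq_sizeP => j nj; rewrite coefB coefZ.
  move: nj; rewrite leq_eqVlt => /predU1P[<-|nj].
    by have := He_lead n; rewrite lead_coefE size_He/= => ->; rewrite mulr1 subrr.
  rewrite (nth_default _ (leq_trans sp nj)) [X in _ * X]nth_default ?size_He//.
  by rewrite mulr0 subr0.
exists (fun k => if (k < n)%N then c k else p`_n).
rewrite big_ord_recr/= ltnn -[LHS](subrK (p`_n *: He n)) hc; congr (_ + _).
by apply: eq_bigr => i _; rewrite ltn_ord.
Qed.

Lemma hermiteE k x : hermite k x = (He k).[x] / Num.sqrt k`!%:R.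
Proof.
pose g (y : R) := expR (- (y ^+ 2) / 2).
have dg n (x0 : R) : is_derive x0 (1:R) (fun y : R => (-1) ^+ n * (He n).[y] * g y)
    ((-1) ^+ n.+1 * (He n.+1).[x0] * g x0).
  have gd : is_derive x0 (1:R) g (- x0 * g x0).
    rewrite /g; apply: is_derive_eq; rewrite /GRing.scale/=.
    by field.
  apply: is_derive_eq; rewrite /GRing.scale/= hornerD hornerN hornerM hornerX.
  by rewrite exprS; ring.
have E n : derive1n n g = fun y : R => (-1) ^+ n * (He n).[y] * g y.
  elim: n => [|n IH]; first by apply/funext => y; rewrite /= hornerC expr0 !mul1r.
  rewrite derive1nS IH; apply/funext => y; rewrite derive1E.
  by apply: derive_val; exact: dg.
rewrite /hermite -/g E /g.
rewrite (_ : - x ^+ 2 / 2 = - (x ^+ 2 / 2)); last by rewrite mulNr.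
rewrite expRN; have := expR_eq0 (x ^+ 2 / 2); move: (expR _) => e e0.
rewrite (_ : _ * _ * _ * _ = ((-1) ^+ k * (-1) ^+ k) * ((He k).[x] / Num.sqrt k`!%:R) * (e * e^-1)); last by ring.
by rewrite divff ?e0// mulr1 -expr2 sqrr_sign mul1r.
Qed.

Local Notation E := (normal_mean 0 (1:R)).

Lemma normal_mean_He k p : E (He k * p) = E p^`(k).
Proof.
elim: k p => [|k IH] p; first by rewrite mul1r derivn0.
have o0 : (1:R) != 0 by exact: oner_neq0.
rewrite derivSn -IH /= mulrBl normal_meanB//.
have := normal_stein 0 o0 (He k * p); rewrite subr0 mulrA => ->.
rewrite expr1n mul1r derivM normal_meanD//; ring.
Qed.

(** Orthogonality, by moving k derivatives onto the other factor. *)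
Lemma normal_mean_HeHe j k : E (He j * He k) = (j == k)%:R * k`!%:R.
Proof.
have o0 : (1:R) != 0 by exact: oner_neq0.
wlog jk : j k / (k <= j)%N => [h|].
  have [jk|/ltnW jk] := leqP k j; first exact: h.
  by rewrite mulrC h// eq_sym; case: eqP => [->//|_]; rewrite !mul0r.
rewrite normal_mean_He derivn_He normal_meanZ//.
move: jk; rewrite leq_eqVlt => /predU1P[->|kj].
  by rewrite eqxx ffactnn subnn/= normal_mean1 mulr1 mul1r.
by rewrite ffact_small// gtn_eqF// !mul0r.
Qed.

(** Mehler's formula in one variable: the conditional law of the second of two
    standard Gaussians with correlation r, given that the first is x, is
    N(r x, 1 - r^2), and conditioning multiplies [He k] by r^k. *)
Lemma normal_mean_mehler (r s x : R) k : s != 0 -> s ^+ 2 = 1 - r ^+ 2 ->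
  normal_mean (r * x) s (He k) = r ^+ k * (He k).[x].
Proof.
move=> s0 s2.
have step n : normal_mean (r * x) s (He n.+1) =
    r * x * normal_mean (r * x) s (He n) - r ^+ 2 * normal_mean (r * x) s (He n)^`().
  rewrite /= (_ : 'X * He n = ('X - (r * x)%:P) * He n + (r * x) *: He n).
    rewrite normal_meanB// normal_meanD// normal_meanZ// normal_stein// s2.
    by ring.
  by rewrite -mul_polyC; ring.
suff H n : normal_mean (r * x) s (He n) = r ^+ n * (He n).[x] /\
           normal_mean (r * x) s (He n.+1) = r ^+ n.+1 * (He n.+1).[x].
  by have [] := H k.
elim: n => [|n [IH1 IH2]].
  rewrite step normal_mean1// derivC mulr1 expr0 hornerC mul1r; split=> //.
  rewrite (_ : normal_mean _ _ 0 = 0).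
    by rewrite mulr0 subr0 expr1 /= derivC subr0 mulr1 hornerX.
  by rewrite -(scale0r (0 : {poly R})) normal_meanZ// mul0r.
split=> //; rewrite step IH2 deriv_He normal_meanZ// IH1.
have -> : (He n.+2).[x] = x * (He n.+1).[x] - n.+1%:R * (He n).[x].
  by rewrite HeS deriv_He; move: (He n.+1) (He n) => p q; rewrite !hornerE.
by rewrite !exprS; ring.
Qed.

End hermite_polynomials.

(** * Integration against the Gauss measure on R^d *)

Section gauss_rV.
Context {R : realType}.
Local Notation leb := (@lebesgue_measure R).
Local Notation phi := (normal_pdf (0:R) 1).
Local Notation gauss d := (gauss_measure R d).

Lemma gauss_densityE d (x : 'rV[R]_d) :
  gauss_density x = \prod_i phi (x ord0 i).
Proof.
rewrite /gauss_density /dot_rV.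
under [RHS]eq_bigr do rewrite normal_pdfE1 ?oner_neq0//.
rewrite big_split/= prodr_const card_ord -expR_sum; congr (_ * _).
  rewrite /normal_peak expr1n mul1r.
  have pi0 : 0 <= (pi *+ 2 : R) by rewrite mulrn_wge0// pi_ge0.
  rewrite (_ : (Num.sqrt _)^-1 = (pi *+ 2) `^ (- 2^-1)); last first.
    by rewrite powRN powR12_sqrt.
  rewrite -(mulr_natl pi 2) -powR_mulrn ?powR_ge0// -powRrM.
  by congr (_ `^ _); rewrite mulNr [_^-1 * _]mulrC.
congr expR; rewrite -sumrN mulr_suml; apply: eq_bigr => i _.
by rewrite subr0 expr1n expr2.
Qed.

Lemma integral_gauss d (f : 'rV[R]_d -> R) : measurable_fun setT f ->
  (\int[gauss d]_x (f x)%:E =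
   \int[lebesgue_rV R d]_x (f x * gauss_density x)%:E)%E.
Proof.
move=> mf; apply: integral_density => //.
- exact: gauss_density_ge0.
- exact: measurable_gauss_density.
Qed.

Lemma integrable_gauss d (f : 'rV[R]_d -> R) : measurable_fun setT f ->
  (gauss d).-integrable setT (EFin \o f) <->
  (lebesgue_rV R d).-integrable setT (fun x => (f x * gauss_density x)%:E).
Proof.
move=> mf; apply: integrable_density => //.
- exact: gauss_density_ge0.
- exact: measurable_gauss_density.
Qed.

Lemma measurable_prod_coord d (g : 'I_d -> R -> R) :
  (forall i, measurable_fun setT (g i)) ->
  measurable_fun setT (fun x : 'rV[R]_d => \prod_i g i (x ord0 i)).
Proof.
move=> mg; apply: measurable_prod => i _; apply: measurableT_comp => //.
exact: measurable_coord.
Qed.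

Lemma integral_gauss_prod d (g : 'I_d -> R -> R) :
  (forall i, measurable_fun setT (g i)) ->
  (forall i, leb.-integrable setT (fun t => (g i t * phi t)%:E)) ->
  (gauss d).-integrable setT (fun x => (\prod_i g i (x ord0 i))%:E) /\
  (\int[gauss d]_x (\prod_i g i (x ord0 i))%:E =
    (\prod_i \int[leb]_t (g i t * phi t)%R)%:E)%E.
Proof.
move=> mg ig; have [I1 I2] := integral_prod_coord ig.
have E (x : 'rV[R]_d) : \prod_i (g i (x ord0 i)) * gauss_density x =
    \prod_i (g i (x ord0 i) * phi (x ord0 i)).
  by rewrite gauss_densityE big_split.
have mp := measurable_prod_coord mg.
split; first by apply/(integrable_gauss mp); under eq_fun do rewrite E.
by rewrite integral_gauss//; under eq_integral do rewrite E.
Qed.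

Lemma gauss_setT d : gauss d setT = 1%E.
Proof.
have ip i : leb.-integrable setT (fun t => ((fun (_ : 'I_d) (_ : R) => 1 : R) i t * phi t)%:E).
  by under eq_fun do rewrite mul1r; exact: integrable_normal_pdf.
have [_] := @integral_gauss_prod d (fun _ _ => 1) (fun i => measurable_cst _) ip.
under eq_integral do rewrite big1//.
rewrite integral_cst// mul1e => ->; rewrite big1// => i _.
rewrite /Rintegral; under eq_integral do rewrite mul1r.
by rewrite integral_normal_pdf.
Qed.

HB.instance Definition _ d :=
  @Measure_isProbability.Build _ _ R (gauss_measure R d) (gauss_setT d).

(** The exponent a of the squares decides: a < 1/2 gives integrable and a < 1/4 gives
    square integrable functions, whatever b is. *)
Definition weight d (a b : R) (x : 'rV[R]_d) : R :=
  \prod_i expR (b * `|x ord0 i| + a * x ord0 i ^+ 2).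

Definition subgaussian d (a : R) (F : 'rV[R]_d -> R) : Prop :=
  measurable_fun setT F /\
  exists C b : R, [/\ 0 <= C, 0 <= b & forall x, `|F x| <= C * weight a b x].

Lemma weight_ge0 d a b (x : 'rV[R]_d) : 0 <= weight a b x.
Proof. by apply: prodr_ge0 => i _; exact: expR_ge0. Qed.

Lemma weightM d a b a' b' (x : 'rV[R]_d) :
  weight a b x * weight a' b' x = weight (a + a') (b + b') x.
Proof.
rewrite /weight -big_split/=; apply: eq_bigr => i _; rewrite -expRD.
by congr expR; ring.
Qed.

Lemma subgaussianM d a a' (F G : 'rV[R]_d -> R) :
  subgaussian a F -> subgaussian a' G -> subgaussian (a + a') (F \* G).
Proof.
move=> [mF [C [b [C0 b0 h]]]] [mG [C' [b' [C'0 b'0 h']]]].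
split; first exact: measurable_funM.
exists (C * C'), (b + b'); split; rewrite ?mulr_ge0 ?addr_ge0// => x.
by rewrite normrM -weightM mulrACA ler_pM.
Qed.

Lemma bounded_subgaussian d (F : 'rV[R]_d -> R) (C : R) :
  measurable_fun setT F -> (forall x, `|F x| <= C) -> subgaussian 0 F.
Proof.
move=> mF FC; split => //; exists `|C|, 0; split => // x.
rewrite /weight big1 ?mulr1; first exact: (le_trans (FC x) (ler_norm _)).
by move=> i _; rewrite !mul0r addr0 expR0.
Qed.

Lemma integrable_weight d (a b : R) : a < 2^-1 ->
  (gauss d).-integrable setT (EFin \o weight a b).
Proof.
move=> a2; pose g (i : 'I_d) t := expR (b * `|t| + a * t ^+ 2).
have mg i : measurable_fun setT (g i).
  apply: measurableT_comp => //; apply: measurable_funD.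
    by apply: measurable_funM => //; exact: measurableT_comp.
  by apply: measurable_funM => //; exact: measurable_funX.
have [] // := integral_gauss_prod mg.
by move=> i; apply: integrable_exp_normal; rewrite ?oner_neq0// expr1n.
Qed.

Lemma integrable_subgaussian d a (F : 'rV[R]_d -> R) : a < 2^-1 ->
  subgaussian a F -> (gauss d).-integrable setT (EFin \o F).
Proof.
move=> a2 [mF [C [b [C0 b0 h]]]].
apply: (le_integrable measurableT _ _
  (integrableZl measurableT C (integrable_weight d b a2))).
  exact/measurable_EFinP.
move=> x _ /=; rewrite lee_fin normrM ger0_norm//.
by rewrite (ger0_norm (weight_ge0 _ _ _)).
Qed.

Definition tpoly d (p : 'I_d -> {poly R}) (x : 'rV[R]_d) : R :=
  \prod_i (p i).[x ord0 i].

Lemma measurable_horner (p : {poly R}) : measurable_fun setT (horner p).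
Proof. by apply: continuous_measurable_fun; exact: continuous_horner. Qed.

Lemma subgaussian_tpoly d (p : 'I_d -> {poly R}) : subgaussian 0 (tpoly p).
Proof.
split.
  by apply: (@measurable_prod_coord d (fun i => horner (p i))) => i; exact: measurable_horner.
have /choice[C hC] : forall i, exists C : R, 0 <= C /\
    forall t, `|(p i).[t]| <= C * expR (1 * `|t|).
  by move=> i; have [C C0 h] := poly_growth (p i) ltr01; exists C.
exists (\prod_i C i), 1; split => //.
  by apply: prodr_ge0 => i _; have [] := hC i.
move=> x; rewrite /tpoly normr_prod /weight -big_split/=.
apply: ler_prod => i _; rewrite normr_ge0/= mul0r addr0.
by have [_] := hC i; apply.
Qed.

Lemma integral_gauss_tpoly d (p : 'I_d -> {poly R}) :
  (\int[gauss d]_x (tpoly p x)%:E = (\prod_i normal_mean 0 1 (p i))%:E)%E.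
Proof.
have [] // := @integral_gauss_prod d (fun i => horner (p i)) => i.
  exact: measurable_horner.
by apply: integrable_poly_normal; exact: oner_neq0.
Qed.

Lemma tpolyM d (p q : 'I_d -> {poly R}) x :
  tpoly p x * tpoly q x = tpoly (fun i => p i * q i) x.
Proof.
by rewrite /tpoly -big_split/=; apply: eq_bigr => i _; rewrite hornerM.
Qed.

Definition tHe d (k : {ffun 'I_d -> nat}) : 'rV[R]_d -> R :=
  tpoly (fun i => He (k i)).

Definition mfact d (k : {ffun 'I_d -> nat}) : nat := \prod_i (k i)`!.

Lemma mfact_gt0 d (k : {ffun 'I_d -> nat}) : (0 < mfact k)%N.
Proof. by apply: prodn_gt0 => i; exact: fact_gt0. Qed.

Lemma mhermiteE d (k : {ffun 'I_d -> nat}) (x : 'rV[R]_d) :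
  mhermite k x = (Num.sqrt (mfact k)%:R)^-1 * tHe k x.
Proof.
rewrite /mhermite; under eq_bigr do rewrite hermiteE.
rewrite big_split/= mulrC prodfV; congr (_^-1 * _).
apply: (big_ind2 (fun (a : R) (b : nat) => a = Num.sqrt b%:R)) => //.
  by rewrite sqrtr1.
by move=> a b c e -> ->; rewrite natrM sqrtrM.
Qed.

Lemma integral_tHe_tHe d (j k : {ffun 'I_d -> nat}) :
  (\int[gauss d]_x (tHe j x * tHe k x)%:E = ((j == k)%:R * (mfact k)%:R)%:E)%E.
Proof.
under eq_integral do rewrite tpolyM.
rewrite integral_gauss_tpoly; congr EFin.
under eq_bigr do rewrite normal_mean_HeHe.
have [->|jk] := eqVneq j k.
  under eq_bigr do rewrite eqxx mul1r.
  by rewrite mul1r /mfact -natr_prod.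
have [i ji] : exists i, j i != k i.
  apply/existsP; rewrite -[X in is_true X]negbK negb_exists; apply: contra jk => /forallP h.
  by apply/eqP/ffunP => i; apply/eqP; rewrite -[_ == _]negbK; exact: h.
by rewrite mul0r (bigD1 i)//= (negbTE ji) !mul0r.
Qed.

Lemma subgaussian_mhermite d (k : {ffun 'I_d -> nat}) :
  subgaussian 0 (mhermite k : 'rV[R]_d -> R).
Proof.
rewrite (_ : mhermite k = cst (Num.sqrt (mfact k)%:R)^-1 \* tHe k); last first.
  by apply/funext => x; rewrite mhermiteE.
rewrite -[X in subgaussian X](addr0 0); apply: subgaussianM; last exact: subgaussian_tpoly.
by apply: (@bounded_subgaussian _ _ `|(Num.sqrt (mfact k)%:R)^-1|).
Qed.

Lemma measurable_mhermite d (k : {ffun 'I_d -> nat}) :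
  measurable_fun setT (mhermite k : 'rV[R]_d -> R).
Proof. by case: (subgaussian_mhermite k). Qed.

Lemma integral_mhermite_mhermite d (j k : {ffun 'I_d -> nat}) :
  \int[gauss d]_x (mhermite j x * mhermite k x) = (j == k)%:R.
Proof.
have sg : subgaussian 0 (tHe j \* tHe k : 'rV[R]_d -> R).
  by rewrite -[X in subgaussian X](addr0 0); apply: subgaussianM; exact: subgaussian_tpoly.
have sg2 : (0:R) < 2^-1 by rewrite invr_gt0.
under eq_Rintegral.
  move=> x _; rewrite !mhermiteE mulrACA; over.
rewrite RintegralZl//; last exact: (integrable_subgaussian sg2 sg).
rewrite /Rintegral integral_tHe_tHe/=.
have [->|_] := eqVneq j k; last by rewrite mul0r mulr0.
rewrite mul1r -invfM -expr2 sqr_sqrtr// mulVf//.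
by rewrite pnatr_eq0 -lt0n mfact_gt0.
Qed.

Lemma Lfun2_subgaussian d a (F : 'rV[R]_d -> R) : a < 4^-1 ->
  subgaussian a F -> F \in Lfun (gauss d) 2%:E.
Proof.
move=> a4 sF; have := subgaussianM sF sF.
have a2 : a + a < 2^-1 by lra.
move=> /(integrable_subgaussian a2)/integrableP[mF iF].
have [mf _] := sF; rewrite inE; apply/andP; split; rewrite inE//=.
rewrite /finite_norm unlock; apply: poweR_lty.
apply: le_lt_trans iF; apply: ge0_le_integral => //.
- by move=> x _; exact: poweR_ge0.
- apply/measurable_EFinP; apply: (@measurableT_comp _ _ _ _ _ _ (@powR R ^~ 2)) => //.
  exact: measurableT_comp.
- exact: measurableT_comp.
- move=> x _ /=; rewrite lee_fin powR_mulrn//.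
  by rewrite normrM expr2.
Qed.

End gauss_rV.
Arguments tpoly {R d}.

(** * The Hilbert space L2 of the Gauss measure and the Hermite coefficients *)

Section inner_product.
Context {R : realType} {d : nat}.
Local Notation gauss := (gauss_measure R d).
Implicit Types (f g h : L2 R d) (F G : 'rV[R]_d -> R).

Lemma ae_eq_Rintegral F G : F = G %[ae gauss] ->
  measurable_fun setT F -> measurable_fun setT G ->
  \int[gauss]_x F x = \int[gauss]_x G x.
Proof.
move=> FG mF mG; rewrite /Rintegral; congr fine.
apply: ae_eq_integral => //; try exact/measurable_EFinP.
by apply: filterS FG => x /= + _ => ->.
Qed.

Lemma Lspace_funD f g :
  Lspace_fun (f + g) = Lspace_fun f \+ Lspace_fun g %[ae gauss].
Proof. exact: (LclassK (lee1n 2) (LfunD f g)). Qed.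

Lemma Lspace_funZ (a : R) f :
  Lspace_fun (a *: f) = a \*: Lspace_fun f %[ae gauss].
Proof. exact: (LclassK (lee1n 2) (LfunZ a f)). Qed.

Lemma L2_Lfun f : Lspace_fun f \in Lfun gauss 2%:E.
Proof. exact: Lspace_Lfun. Qed.

Lemma measurable_L2 f : measurable_fun setT (Lspace_fun f).
Proof. exact: measurable_Lspace_fun. Qed.

Lemma Lfun2_measurable F : F \in Lfun gauss 2%:E -> measurable_fun setT F.
Proof. by rewrite inE => /andP[]; rewrite inE. Qed.

Lemma integrable_mul_Lfun2 F G : F \in Lfun gauss 2%:E -> G \in Lfun gauss 2%:E ->
  gauss.-integrable setT (fun x => (F x * G x)%:E).
Proof. by move=> hF hG; exact/Lfun1_integrable/Lfun2_mul_Lfun1. Qed.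

Definition ip f g : R := \int[gauss]_x (Lspace_fun f x * Lspace_fun g x).

Lemma ipC f g : ip f g = ip g f.
Proof. by apply: eq_Rintegral => x _; rewrite mulrC. Qed.

Lemma ipDl f g h : ip (f + g) h = ip f h + ip g h.
Proof.
rewrite /ip -RintegralD//; try exact: integrable_mul_Lfun2 (L2_Lfun _) (L2_Lfun _).
apply: ae_eq_Rintegral.
- by apply: filterS (Lspace_funD f g) => x /= + _ => ->//; rewrite mulrDl.
- by apply: measurable_funM; exact: measurable_L2.
- by apply: measurable_funD; apply: measurable_funM; exact: measurable_L2.
Qed.

Lemma ipZl (a : R) f g : ip (a *: f) g = a * ip f g.
Proof.
rewrite /ip -RintegralZl//; last exact: integrable_mul_Lfun2 (L2_Lfun _) (L2_Lfun _).
apply: ae_eq_Rintegral.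
- by apply: filterS (Lspace_funZ a f) => x /= + _ => ->//=; rewrite mulrA.
- by apply: measurable_funM; exact: measurable_L2.
- by apply: measurable_funM => //; apply: measurable_funM; exact: measurable_L2.
Qed.

Lemma ipNl f g : ip (- f) g = - ip f g.
Proof. by rewrite -scaleN1r ipZl mulN1r. Qed.

Lemma ipBl f g h : ip (f - g) h = ip f h - ip g h.
Proof. by rewrite ipDl ipNl. Qed.

Lemma ipBr f g h : ip h (f - g) = ip h f - ip h g.
Proof. by rewrite ipC ipBl !(ipC h). Qed.

Lemma ipZr (a : R) f g : ip f (a *: g) = a * ip f g.
Proof. by rewrite ipC ipZl ipC. Qed.

Lemma ip0l f : ip 0 f = 0.
Proof. by rewrite -(scale0r (0 : L2 R d)) ipZl mul0r. Qed.

Lemma ip_suml (I : Type) (r : seq I) (P : pred I) (F : I -> L2 R d) g :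
  ip (\sum_(i <- r | P i) F i) g = \sum_(i <- r | P i) ip (F i) g.
Proof.
by elim/big_rec2: _ => [|i x y _ <-]; rewrite ?ip0l// ipDl.
Qed.

Lemma ip_sumr (I : Type) (r : seq I) (P : pred I) (F : I -> L2 R d) g :
  ip g (\sum_(i <- r | P i) F i) = \sum_(i <- r | P i) ip g (F i).
Proof. by rewrite ipC ip_suml; apply: eq_bigr => i _; rewrite ipC. Qed.

Lemma sqr_normE f : `|f| ^+ 2 = ip f f.
Proof.
have h := Lspace_normE f.
apply: EFin_inj; rewrite /ip /Rintegral fineK; last first.
  by apply: integrable_fin_num => //; exact: integrable_mul_Lfun2 (L2_Lfun _) (L2_Lfun _).
have -> : (`|f| ^+ 2)%:E = (`|f|%:E `^ 2)%E by rewrite poweR_EFin powR_mulrn.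
rewrite [X in (X `^ _)%E]h.
rewrite (@powR_Lnorm _ _ _ gauss _ 2); last by rewrite pnatr_eq0.
apply: eq_integral => x _; rewrite /= powR_mulrn// -normrX ger0_norm ?sqr_ge0//.
Qed.

Lemma ip_ge0 f : 0 <= ip f f.
Proof. by rewrite -sqr_normE sqr_ge0. Qed.

(** Total, with value 0 for functions that are not square integrable, so that the
    basis elements need no proof argument. *)
Definition toL2 F : L2 R d := xget 0 [set g | Lspace_fun g = F %[ae gauss]].

Lemma toL2E F : F \in Lfun gauss 2%:E -> Lspace_fun (toL2 F) = F %[ae gauss].
Proof.
move=> hF; have h := LclassK (lee1n 2) hF.
rewrite /toL2; case: xgetP => [g _ //|/(_ (Lclass (lee1n 2) hF))].
by move/(_ h).
Qed.

Lemma ip_toL2 f F : F \in Lfun gauss 2%:E ->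
  ip f (toL2 F) = \int[gauss]_x (Lspace_fun f x * F x).
Proof.
move=> hF; apply: ae_eq_Rintegral.
- by apply: filterS (toL2E hF) => x /= + _ => ->.
- by apply: measurable_funM; exact: measurable_L2.
- by apply: measurable_funM; [exact: measurable_L2|exact: Lfun2_measurable].
Qed.

End inner_product.

Section hermite_basis.
Context {R : realType} {d : nat}.
Local Notation gauss := (gauss_measure R d).
Local Notation mindex := {ffun 'I_d -> nat}.
Implicit Types (f g h : L2 R d) (k j : mindex) (K : seq mindex).

Lemma Lfun2_mhermite k : (mhermite k : 'rV[R]_d -> R) \in Lfun gauss 2%:E.
Proof.
by apply: (Lfun2_subgaussian (a := 0)); rewrite ?invr_gt0//; exact: subgaussian_mhermite.
Qed.

Definition hbasis k : L2 R d := toL2 (mhermite k).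

Lemma hermite_coefE f k : hermite_coef f k = ip f (hbasis k).
Proof. by rewrite ip_toL2//; exact: Lfun2_mhermite. Qed.

Lemma hbasisE k : Lspace_fun (hbasis k) = mhermite k %[ae gauss].
Proof. exact: toL2E (Lfun2_mhermite k). Qed.

Lemma ip_hbasis j k : ip (hbasis j) (hbasis k) = (j == k)%:R.
Proof.
rewrite ip_toL2; last exact: Lfun2_mhermite.
rewrite -integral_mhermite_mhermite; apply: ae_eq_Rintegral.
- by apply: filterS (hbasisE j) => x /= + _ => ->.
- by apply: measurable_funM; [exact: measurable_L2|exact: measurable_mhermite].
- by apply: measurable_funM; exact: measurable_mhermite.
Qed.

Definition hcomb K (c : mindex -> R) : L2 R d := \sum_(k <- K) c k *: hbasis k.

Lemma hermite_coef_hcomb K c k : uniq K ->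
  hermite_coef (hcomb K c) k = if k \in K then c k else 0.
Proof.
move=> uK; rewrite hermite_coefE ip_suml.
under eq_bigr do rewrite ipZl ip_hbasis.
have [kK|kK] := boolP (k \in K).
  rewrite (bigD1_seq k)//= eqxx mulr1 big1 ?addr0// => i /negbTE ->.
  by rewrite mulr0.
rewrite big_seq big1// => i iK; case: eqP => [ik|_]; last by rewrite mulr0.
by move: kK; rewrite -ik iK.
Qed.

Lemma ip_hcomb K c f :
  ip f (hcomb K c) = \sum_(k <- K) c k * hermite_coef f k.
Proof.
by rewrite ip_sumr; apply: eq_bigr => k _; rewrite ipZr hermite_coefE.
Qed.

Lemma sqr_norm_hcomb K c : uniq K ->
  `|hcomb K c| ^+ 2 = \sum_(k <- K) c k ^+ 2.
Proof.
move=> uK; rewrite sqr_normE ip_hcomb; apply: eq_big_seq => k kK.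
by rewrite hermite_coef_hcomb// kK expr2.
Qed.

Definition hproj K f : L2 R d := hcomb K (hermite_coef f).

(** Pythagoras: [hproj K f] is the orthogonal projection, hence the best
    approximation of [f] by combinations of the [hbasis k], k in K. *)
Lemma hproj_best K f c : uniq K -> `|f - hcomb K c| ^+ 2 =
  `|f - hproj K f| ^+ 2 + \sum_(k <- K) (hermite_coef f k - c k) ^+ 2.
Proof.
move=> uK; rewrite !sqr_normE !ipBl !ipBr.
have E (x y z : R) : x - y - (y - z) = x - 2 * y + z by ring.
rewrite (ipC (hcomb K c) f) (ipC (hproj K f) f) !E !ip_hcomb.
rewrite -!addrA; congr (_ + _).
rewrite !mulr_sumr -?sumrN -!big_split/=; apply: eq_big_seq => k kK.
by rewrite !hermite_coef_hcomb// kK; ring.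
Qed.

Lemma pythagoras_hproj K f : uniq K ->
  `|f| ^+ 2 = `|f - hproj K f| ^+ 2 + \sum_(k <- K) hermite_coef f k ^+ 2.
Proof.
move=> uK; have := hproj_best f (fun=> 0) uK.
rewrite {1}/hcomb big1 => [|i _]; last by rewrite scale0r.
by rewrite subr0 => ->; under eq_bigr do rewrite subr0.
Qed.

Lemma bessel K f : uniq K ->
  \sum_(k <- K) hermite_coef f k ^+ 2 <= `|f| ^+ 2.
Proof. by move=> uK; rewrite (pythagoras_hproj f uK) lerDr sqr_ge0. Qed.

End hermite_basis.

(** * Density of the polynomials in L2 of the Gauss measure *)

Section threshold.
Context {R : realType}.

(** For y < 1 this says n y^n <= 1 + y + ... + y^(n-1). *)
Lemma mul_exprn_le (y : R) n : 0 <= y <= 1 -> n%:R * y ^+ n * (1 - y) <= 1 - y ^+ n.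
Proof.
move=> /andP[y0 y1]; elim: n => [|n IH]; first by rewrite !mul0r expr0 subrr.
have := ler_wpM2l y0 IH.
have : 0 <= (1 - y ^+ n.+1) * (1 - y).
  by rewrite mulr_ge0 ?subr_ge0// exprn_ile1.
rewrite -natr1 exprS; set z := y ^+ n; set m : R := n%:R => h1 h2.
move: h2; rewrite -subr_ge0 => h2; rewrite -subr_ge0.
apply: (le_trans (addr_ge0 h1 h2)); rewrite le_eqVlt; apply/orP; left; apply/eqP.
by ring.
Qed.

Lemma cvg_mul_exprn (z : R) : 0 <= z < 1 -> n%:R * z ^+ n @[n --> \oo] --> (0 : R).
Proof.
move=> /andP[z0 z1]; pose y := Num.sqrt z.
have y1 : y < 1 by rewrite -sqrtr1 ltr_sqrt.
have y0 : 0 <= y by exact: sqrtr_ge0.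
apply: (@squeeze_cvgr _ _ _ _ (cst 0) (geometric (1 - y)^-1 y)).
- near=> n; rewrite mulr_ge0 ?exprn_ge0//=.
  rewrite -(sqr_sqrtr z0) -/y -exprM mulnC exprM expr2 mulrA ler_wpM2r ?exprn_ge0//.
  rewrite -div1r ler_pdivlMr ?subr_gt0//.
  apply: le_trans (mul_exprn_le _ _) _; first by rewrite y0 ltW.
  by rewrite lerBlDr lerDl exprn_ge0.
- exact: cvg_cst.
- by apply: cvg_geometric; rewrite ger0_norm.
Unshelve. all: by end_near. Qed.

Lemma bernoulli_ineq (x : R) n : 0 <= x <= 1 -> 1 - n%:R * x <= (1 - x) ^+ n.
Proof.
move=> /andP[x0 x1]; elim: n => [|n IH]; first by rewrite mul0r subr0.
rewrite exprS; apply: le_trans (ler_wpM2l _ IH); last by rewrite subr_ge0.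
rewrite -natr1 -subr_ge0 (_ : _ - _ = n%:R * x ^+ 2); first by rewrite mulr_ge0 ?sqr_ge0.
by ring.
Qed.

(** These polynomials occur in the elementary proof of the Stone-Weierstrass
    theorem. For u < 1/2 Bernoulli's inequality bounds the value below by
    1 - n (2u)^n; for u >= 1/2 it is at most exp (- n (2u)^n). *)
Lemma cvg_threshold (u : R) : 0 <= u <= 1 ->
  (1 - u ^+ n) ^+ (n * 2 ^ n) @[n --> \oo] --> ((u < 2^-1)%R%:R : R).
Proof.
move=> /andP[u0 u1].
have un01 n : 0 <= u ^+ n <= 1 by rewrite exprn_ge0//= exprn_ile1.
have E n : (n * 2 ^ n)%:R * u ^+ n = n%:R * (2 * u) ^+ n.
  by rewrite natrM natrX exprMn mulrA.
have [u2|u2] := ltP u 2^-1.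
- apply: (@squeeze_cvgr _ _ _ _ (fun n => 1 - n%:R * (2 * u) ^+ n) (cst 1)).
  + near=> n; apply/andP; split; last first.
      by apply: exprn_ile1; rewrite ?lerBlDr ?lerDl ?subr_ge0; case/andP: (un01 n).
    by rewrite -E; exact: bernoulli_ineq.
  + rewrite -[X in _ --> X]subr0; apply: cvgB; first exact: cvg_cst.
    apply: cvg_mul_exprn; rewrite mulr_ge0//=.
    by rewrite -(@ltr_pM2l _ 2^-1)// mulrA mulVf// mul1r mulr1.
  + exact: cvg_cst.
- apply: (@squeeze_cvgr _ _ _ _ (cst 0) (fun n => expR (- n%:R))).
  + near=> n; rewrite exprn_ge0/= ?subr_ge0; last by case/andP: (un01 n).
    apply: (@le_trans _ _ (expR (- (u ^+ n)) ^+ (n * 2 ^ n))).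
      rewrite lerXn2r ?nnegrE ?expR_ge0 ?subr_ge0//; first by case/andP: (un01 n).
      exact: expR_ge1Dx.
    rewrite -expRM_natl ler_expR mulrN E lerN2 ler_peMr//.
    apply: exprn_ege1.
    by rewrite -(@ler_pM2l _ 2^-1)// mulrA mulVf// mul1r mulr1.
  + exact: cvg_cst.
  + exact: cvgn_expR.
Unshelve. all: by end_near. Qed.

Lemma series_exp_le (u : R) n : `|series (exp_coeff u) n| <= expR `|u|.
Proof.
rewrite (le_trans (ler_norm_sum _ _ _))//.
apply: (@le_trans _ _ (series (exp_coeff `|u|) n)).
  rewrite /series/=; apply: ler_sum => i _.
  by rewrite !exp_coeffE normrM normfV normr_nat normrX.
apply: nondecreasing_cvgn_le; last exact: is_cvg_series_exp_coeff.
apply: nondecreasing_series => i _ _.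
by rewrite exp_coeffE mulr_ge0// exprn_ge0.
Qed.

End threshold.

Section density_of_polynomials.
Context {R : realType} {d : nat}.
Local Notation gauss := (gauss_measure R d).
Local Notation fn := ('rV[R]_d -> R).
Implicit Types (F G g h : fn) (p : 'I_d -> {poly R}).

Definition sqnorm F : \bar R := (\int[gauss]_x (F x ^+ 2)%:E)%E.
Arguments sqnorm F%_ring_scope.

Lemma sqnormD F G : measurable_fun setT F -> measurable_fun setT G ->
  (sqnorm (F \+ G) <= 2%:E * sqnorm F + 2%:E * sqnorm G)%E.
Proof.
move=> mF mG; rewrite /sqnorm.
have m2 (H : fn) : measurable_fun setT H -> measurable_fun setT (fun x => (H x ^+ 2)%:E).
  by move=> mH; apply/measurable_EFinP; exact: measurable_funX.
rewrite -!ge0_integralZl//; last 4 first.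
- exact: m2.
- by move=> x _; rewrite lee_fin sqr_ge0.
- exact: m2.
- by move=> x _; rewrite lee_fin sqr_ge0.
rewrite -ge0_integralD//; last 4 first.
- by move=> x _; rewrite mule_ge0// lee_fin sqr_ge0.
- by apply: emeasurable_funM => //; exact: m2.
- by move=> x _; rewrite mule_ge0// lee_fin sqr_ge0.
- by apply: emeasurable_funM => //; exact: m2.
apply: ge0_le_integral => //.
- by move=> x _; rewrite lee_fin sqr_ge0.
- by apply: m2; exact: measurable_funD.
- by apply: emeasurable_funD; apply: emeasurable_funM => //; exact: m2.
move=> x _; rewrite -!EFinM -EFinD lee_fin /= -subr_ge0.
rewrite (_ : _ - _ = (F x - G x) ^+ 2); first exact: sqr_ge0.
by ring.
Qed.

Definition polysum (s : seq (R * ('I_d -> {poly R}))) : fn :=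
  fun x => \sum_(q <- s) q.1 * tpoly q.2 x.

Lemma measurable_polysum s : measurable_fun setT (polysum s).
Proof. by apply: measurable_sum => q; apply: measurable_funM => //; have [] := subgaussian_tpoly q.2. Qed.

(** Closure in mean square, for functions rather than classes, because the
    pointwise limits below are limits of functions. *)
Definition papprox F := measurable_fun setT F /\
  forall e : R, 0 < e -> exists s, (sqnorm (F \- polysum s) <= e%:E)%E.

Lemma papprox_polysum s : papprox (polysum s).
Proof.
split; first exact: measurable_polysum.
move=> e e0; exists s; rewrite /sqnorm.
under eq_integral do rewrite /= subrr expr0n.
by rewrite integral0 lee_fin ltW.
Qed.

Lemma papproxD F G : papprox F -> papprox G -> papprox (F \+ G).
Proof.
move=> [mF hF] [mG hG]; split; first exact: measurable_funD.
move=> e e0; have e4 : 0 < e / 4 by rewrite divr_gt0.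
have [s hs] := hF _ e4; have [r hr] := hG _ e4.
exists (s ++ r).
have -> : (F \+ G) \- polysum (s ++ r) = (F \- polysum s) \+ (G \- polysum r).
  by apply/funext => x /=; rewrite /polysum big_cat/=; ring.
rewrite (le_trans (sqnormD _ _))//; try by apply: measurable_funB => //; exact: measurable_polysum.
rewrite (@le_trans _ _ (2%:E * (e / 4)%:E + 2%:E * (e / 4)%:E)%E)//.
  by rewrite leeD// lee_wpmul2l.
by rewrite -!EFinM -EFinD lee_fin; lra.
Qed.

Lemma papproxZ (c : R) F : papprox F -> papprox (fun x => c * F x).
Proof.
move=> [mF hF]; split; first exact: measurable_funM.
move=> e e0; have c0 : 0 < c ^+ 2 + 1 by rewrite ltr_wpDl// sqr_ge0.
have [s hs] := hF _ (divr_gt0 e0 c0).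
exists [seq (c * q.1, q.2) | q <- s].
have -> : sqnorm ((fun x => c * F x) \- polysum [seq (c * q.1, q.2) | q <- s]) =
    ((c ^+ 2)%:E * sqnorm (F \- polysum s))%E.
  rewrite /sqnorm -ge0_integralZl//; last 3 first.
  - by apply/measurable_EFinP; apply: measurable_funX; apply: measurable_funB => //;
      exact: measurable_polysum.
  - by move=> x _; rewrite lee_fin sqr_ge0.
  - by rewrite lee_fin sqr_ge0.
  apply: eq_integral => x _ /=; rewrite -EFinM -exprMn mulrBr /polysum big_map mulr_sumr.
  by congr ((_ - _) ^+ _)%:E; apply: eq_bigr => q _; rewrite mulrA.
rewrite (le_trans (lee_wpmul2l _ hs)) ?lee_fin ?sqr_ge0//.
by rewrite mulrA ler_pdivrMr// [leLHS]mulrC ler_pM2l// lerDl.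
Qed.

Lemma papprox_sum (I : Type) (r : seq I) (c : I -> R) (H : I -> fn) :
  (forall i, papprox (H i)) -> papprox (fun x => \sum_(i <- r) c i * H i x).
Proof.
move=> hH; elim: r => [|i r IH].
  by under eq_fun do rewrite big_nil; have := papprox_polysum [::];
    rewrite /polysum; under eq_fun do rewrite big_nil.
by under eq_fun do rewrite big_cons; apply: papproxD => //; exact: papproxZ.
Qed.

(** Dominated convergence makes the closure stable under pointwise limits. *)
Lemma papprox_lim (H : nat -> fn) F G : (forall n, papprox (H n)) ->
  measurable_fun setT F -> (forall x, H n x @[n --> \oo] --> F x) ->
  (forall n x, `|H n x - F x| <= G x) ->
  gauss.-integrable setT (fun x => (G x ^+ 2)%:E) -> papprox F.
Proof.
move=> aH mF HF HG iG; split => // e e0.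
have mHF n : measurable_fun setT (H n \- F) by apply: measurable_funB => //; case: (aH n).
have cvg0 : (sqnorm (H n \- F)%R @[n --> \oo] --> 0%E).
  have [] := @dominated_convergence _ _ _ gauss setT measurableT
    (fun n x => ((H n x - F x) ^+ 2)%:E) (cst 0%E) (fun x => (G x ^+ 2)%:E).
  - by move=> n; apply/measurable_EFinP; apply: measurable_funX; exact: mHF.
  - exact: measurable_cst.
  - apply: aeW => x _.
    have hc : H n x - F x @[n --> \oo] --> F x - F x.
      by apply: cvgB; [exact: HF|exact: cvg_cst].
    suff h : (H n x - F x) ^+ 2 @[n --> \oo] --> (0:R).
      by apply: cvg_EFin => //; near=> n.
    rewrite (_ : (0:R) = (F x - F x) * (F x - F x)); last by rewrite subrr mulr0.
    by under eq_fun do rewrite expr2; exact: (cvgM hc hc).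
  - exact: iG.
  - apply: aeW => x n _ /=; rewrite lee_fin normrX lerXn2r ?nnegrE//.
    exact: le_trans (HG n x).
  by move=> _ _; rewrite integral0.
have e4 : 0 < e / 4 by rewrite divr_gt0.
have [fn0 fc0] := (fine_cvgP _ _).1 cvg0.
near \oo => n.
have Hn : (sqnorm (H n \- F)%R <= (e / 4)%:E)%E.
  rewrite -[leLHS]fineK; last by near: n; exact: fn0.
  by rewrite lee_fin ltW//; near: n; exact: (cvgr_lt _ fc0).
have [mHn /(_ _ e4)[s hs]] := aH n; exists s.
have -> : F \- polysum s = (F \- H n) \+ (H n \- polysum s).
  by apply/funext => x /=; ring.
rewrite (le_trans (sqnormD _ _))//; try by apply: measurable_funB => //; exact: measurable_polysum.
have -> : sqnorm (F \- H n) = sqnorm (H n \- F).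
  by apply: eq_integral => x _ /=; rewrite -sqrrN opprB.
rewrite (@le_trans _ _ (2%:E * (e / 4)%:E + 2%:E * (e / 4)%:E)%E)//.
  by rewrite leeD// lee_wpmul2l.
by rewrite -!EFinM -EFinD lee_fin; lra.
Unshelve. all: by end_near. Qed.

Lemma integrable_sqr_subgaussian a F : a < 4^-1 -> subgaussian a F ->
  gauss.-integrable setT (fun x => (F x ^+ 2)%:E).
Proof.
move=> a4 sF; have a2 : a + a < 2^-1 by lra.
exact: (integrable_subgaussian a2 (subgaussianM sF sF)).
Qed.

Definition bounded_fn F := exists C : R, forall x, `|F x| <= C.

Definition good g := [/\ measurable_fun setT g, bounded_fn g &
  forall p, papprox (g \* tpoly p)].

(** Products of multipliers are multipliers, whereas a product of approximable
    functions has no reason to be approximable. *)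
Definition multiplier h := [/\ measurable_fun setT h, bounded_fn h &
  forall g, good g -> good (h \* g)].

Lemma bounded_fnM F G : bounded_fn F -> bounded_fn G -> bounded_fn (F \* G).
Proof.
move=> [C hC] [D hD]; exists (C * D) => x; rewrite normrM ler_pM//.
Qed.

Lemma good1 : good (cst 1).
Proof.
split; [exact: measurable_cst|by exists 1 => x; rewrite normr1|move=> p].
rewrite (_ : _ \* _ = polysum [:: (1, p)]); first exact: papprox_polysum.
by apply/funext => x; rewrite /polysum big_seq1.
Qed.

Lemma multiplier_cst (c : R) : multiplier (cst c).
Proof.
split; [exact: measurable_cst|by exists `|c| |move=> g [mg bg ag]].
split; [exact: measurable_funM|by apply: bounded_fnM => //; exists `|c| |move=> p].
rewrite (_ : _ \* _ = fun x => c * (g \* tpoly p) x); first exact: papproxZ.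
by apply/funext => x /=; rewrite mulrA.
Qed.

Lemma multiplierD h h' : multiplier h -> multiplier h' -> multiplier (h \+ h').
Proof.
move=> [mh [C hC] gh] [mh' [D hD] gh'].
have b : bounded_fn (h \+ h').
  by exists (C + D) => x; rewrite (le_trans (ler_normD _ _))// lerD.
split; [exact: measurable_funD|exact: b|move=> g gg].
have [_ _ a1] := gh _ gg; have [_ _ a2] := gh' _ gg; have [mg bg _] := gg.
split; [by apply: measurable_funM => //; exact: measurable_funD|exact: bounded_fnM|].
move=> p; rewrite (_ : _ \* _ = (h \* g \* tpoly p) \+ (h' \* g \* tpoly p)).
  exact: papproxD.
by apply/funext => x /=; ring.
Qed.

Lemma multiplierM h h' : multiplier h -> multiplier h' -> multiplier (h \* h').
Proof.
move=> [mh bh gh] [mh' bh' gh'].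
split; [exact: measurable_funM|exact: bounded_fnM|move=> g gg].
rewrite (_ : _ \* g = h \* (h' \* g)); first by apply: gh; exact: gh'.
by apply/funext => x /=; rewrite mulrA.
Qed.

Lemma multiplierX h n : multiplier h -> multiplier (fun x => h x ^+ n).
Proof.
move=> mh; elim: n => [|n IH]; first exact: multiplier_cst.
by under eq_fun do rewrite exprS; exact: multiplierM.
Qed.

Lemma multiplier_onem h : multiplier h -> multiplier (fun x => 1 - h x).
Proof.
move=> mh; rewrite (_ : (fun x => _) = cst 1 \+ (cst (-1) \* h)).
  by apply: multiplierD; [|apply: multiplierM => //]; exact: multiplier_cst.
by apply/funext => x /=; rewrite mulN1r.
Qed.

(** Dominated convergence: the products with a polynomial are dominated by a multiple
    of its absolute value, which is square integrable. *)
Lemma multiplier_lim (H : nat -> fn) h C : (forall n, multiplier (H n)) ->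
  (forall n x, `|H n x| <= C) -> (forall x, `|h x| <= C) ->
  (forall x, H n x @[n --> \oo] --> h x) -> multiplier h.
Proof.
move=> mH HC hC Hh.
have mh : measurable_fun setT h.
  apply: (measurable_fun_cvg (h := H)) => [n|x _]; last exact: Hh.
  by case: (mH n).
have bh : bounded_fn h by exists C.
split => // g gg; have [mg bg _] := gg.
split; [exact: measurable_funM|exact: bounded_fnM|move=> p].
have [D hD] := bg; have D0 : 0 <= D by apply: le_trans (hD 0).
have C0 : 0 <= C by apply: le_trans (hC 0).
apply: (@papprox_lim (fun n => H n \* g \* tpoly p) _
  (fun x => C *+ 2 * D * `|tpoly p x|)) => [n||x|n x|].
- by have [_ _ /(_ _ gg)[_ _]] := mH n.
- apply: measurable_funM; first exact: measurable_funM.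
  by have [] := subgaussian_tpoly p.
- by apply: cvgM; [apply: cvgM; [exact: Hh|exact: cvg_cst]|exact: cvg_cst].
- rewrite /= -!mulrBl !normrM ler_wpM2r// ler_pM// mulr2n.
  by rewrite (le_trans (ler_normB _ _))// lerD.
- under eq_fun do rewrite exprMn real_normK ?num_real// EFinM.
  apply: integrableZl => //.
  by apply: (integrable_sqr_subgaussian (a := 0)); rewrite ?invr_gt0//; exact: subgaussian_tpoly.
Qed.

(** The constant 8 makes exp ((x_i - c)^2 / 8), which dominates the partial sums of
    the power series of the bell, square integrable for the Gauss measure. *)
Definition bell (i : 'I_d) (c : R) : fn :=
  fun x => expR (- ((x ord0 i - c) ^+ 2 / 8)).

Lemma bell_le1 i c x : bell i c x <= 1.
Proof. by rewrite expR_le1 oppr_le0 divr_ge0// sqr_ge0. Qed.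

Lemma measurable_bell i c : measurable_fun setT (bell i c).
Proof.
apply: measurableT_comp => //; apply: measurableT_comp => //.
apply: measurable_funM => //; apply: measurable_funX.
by apply: measurable_funB => //; exact: measurable_coord.
Qed.

Lemma subgaussian_bellV i c :
  subgaussian 8^-1 (fun x : 'rV[R]_d => expR ((x ord0 i - c) ^+ 2 / 8)).
Proof.
split.
  apply: measurableT_comp => //.
  apply: measurable_funM => //; apply: measurable_funX.
  by apply: measurable_funB => //; exact: measurable_coord.
exists (expR (c ^+ 2 / 8)), (`|c| / 4); split; rewrite ?expR_ge0 ?divr_ge0// => x.
rewrite ger0_norm ?expR_ge0// /weight (bigD1 i)//= mulrA -expRD -[leLHS]mulr1.
rewrite ler_pM ?expR_ge0// ?ler_expR.
  have : - (x ord0 i * c) <= `|c| * `|x ord0 i| by rewrite -normrM mulrC -normrN ler_norm.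
  move=> h; rewrite -subr_ge0 (_ : _ - _ = (`|c| * `|x ord0 i| + x ord0 i * c) / 4).
    by rewrite divr_ge0// -lerBlDr sub0r.
  by move: `|c| `|x ord0 i| (x ord0 i) {h} => y z t; field.
apply: (big_ind (fun z : R => 1 <= z)) => // [y z|j _]; first exact: mulr_ege1.
by rewrite -[leLHS]expR0 ler_expR addr_ge0// mulr_ge0// ?divr_ge0// ?invr_ge0// sqr_ge0.
Qed.

Lemma multiplier_bell i c : multiplier (bell i c).
Proof.
have bb : bounded_fn (bell i c).
  by exists 1 => x; rewrite ger0_norm ?expR_ge0// bell_le1.
split => [||g gg]; [exact: measurable_bell|exact: bb|have [mg bg ag] := gg].
split; [by apply: measurable_funM => //; exact: measurable_bell|exact: bounded_fnM|move=> p].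
have [D hD] := bg; have D0 : 0 <= D by apply: le_trans (hD 0).
pose u (x : 'rV[R]_d) := (x ord0 i - c) ^+ 2 / 8.
have u0 x : 0 <= u x by rewrite divr_ge0// sqr_ge0.
apply: (@papprox_lim (fun n => (fun x => series (exp_coeff (- u x)) n) \* g \* tpoly p) _
  (fun x => 2 * D * (expR (u x) * `|tpoly p x|))) => [n||x|n x|].
- pose q j := fun i' => if i' == i then p i * ((('X - c%:P) ^+ 2) ^+ j) else p i'.
  have -> : (fun x => series (exp_coeff (- u x)) n) \* g \* tpoly p =
     fun x => \sum_(j <- index_iota 0 n) ((- 8^-1) ^+ j / j`!%:R) * (g \* tpoly (q j)) x.
    apply/funext => x /=; rewrite /series/= !mulr_suml; apply: eq_bigr => j _.
    have -> : tpoly (q j) x = tpoly p x * ((x ord0 i - c) ^+ 2) ^+ j.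
      rewrite /tpoly (bigD1 i)//= [in RHS](bigD1 i)//= /q eqxx hornerM !horner_exp hornerXsubC.
      rewrite mulrAC; congr (_ * _ * _); apply: eq_bigr => j' /negbTE ->//.
    rewrite exp_coeffE /u -mulrN exprMn; ring.
  by apply: papprox_sum => j; exact: ag.
- apply: measurable_funM; first by apply: measurable_funM => //; exact: measurable_bell.
  by have [] := subgaussian_tpoly p.
- apply: cvgM; last exact: cvg_cst.
  apply: cvgM; last exact: cvg_cst.
  exact: is_cvg_series_exp_coeff.
- rewrite /= -!mulrBl !normrM (_ : 2 * D * _ = (2 * expR (u x)) * D * `|tpoly p x|); last by ring.
  rewrite ler_wpM2r// ler_pM// mulr_natl mulr2n (le_trans (ler_normB _ _))// lerD//.
    by rewrite (le_trans (series_exp_le _ _))// normrN ger0_norm.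
  by rewrite ger0_norm ?expR_ge0// ler_expR -/(u x) (le_trans _ (u0 x))// oppr_le0.
- under eq_fun do rewrite exprMn EFinM.
  apply: integrableZl => //.
  under eq_fun do rewrite exprMn real_normK ?num_real// -exprMn.
  apply: (integrable_sqr_subgaussian (a := 8^-1 + 0)); first lra.
  by apply: subgaussianM; [exact: subgaussian_bellV|exact: subgaussian_tpoly].
Qed.

(** By the stability properties of the multipliers these sets form a
    sigma-algebra. *)
Definition mult_set : set (set 'rV[R]_d) :=
  [set A | measurable A /\ multiplier (\1_A)].

(** The threshold polynomials of a bell converge to the indicator function. *)
Lemma mult_set_bell i c : mult_set [set x | bell i c x < 2^-1].
Proof.
split.
  have := measurable_bell i c.
  move=> /(_ measurableT _ (measurable_itv `]-oo, 2^-1[)); rewrite setTI.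
  by congr (measurable _); apply/seteqP; split => x /=; rewrite in_itv.
apply: (@multiplier_lim (fun n x => (1 - bell i c x ^+ n) ^+ (n * 2 ^ n)) _ 1).
- by move=> n; apply/multiplierX/multiplier_onem/multiplierX/multiplier_bell.
- move=> n x; rewrite normrX exprn_ile1// ger0_norm ?lerBlDr ?lerDl ?subr_ge0.
  + by rewrite exprn_ge0// expR_ge0.
  + by rewrite exprn_ile1 ?expR_ge0 ?bell_le1.
- by move=> x; rewrite indicE; case: (_ \in _); rewrite ?normr1 ?normr0.
- move=> x; rewrite indicE; have := @cvg_threshold _ (bell i c x).
  rewrite expR_ge0 bell_le1 => /(_ isT).
  have -> // : (x \in [set x0 | bell i c x0 < 2^-1]) = (bell i c x < 2^-1).
  by apply/idP/idP => [/set_mem//|h]; exact: mem_set.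
Qed.

Lemma mult_setC A : mult_set A -> mult_set (~` A).
Proof.
move=> [mA hA]; split; first exact: measurableC.
have := multiplier_onem hA; congr multiplier; apply/funext => x.
by rewrite !indicE in_setC; case: (_ \in _); rewrite ?subrr ?subr0.
Qed.

(** The indicator of a finite union is 1 - (1 - 1_F0) ... (1 - 1_Fn). *)
Lemma mult_set_bigcup (F : nat -> set 'rV[R]_d) : (forall n, mult_set (F n)) ->
  mult_set (\bigcup_n F n).
Proof.
move=> mF; split; first by apply: bigcupT_measurable => n; case: (mF n).
apply: (@multiplier_lim
  (fun n x => 1 - \prod_(0 <= i < n) (1 - \1_(F i) x)) _ 1).
- move=> n; apply: multiplier_onem; elim: n => [|n IH].
    by under eq_fun do rewrite big_nil; exact: multiplier_cst.
  under eq_fun do rewrite big_nat_recr//=.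
  by apply: multiplierM => //; apply: multiplier_onem; case: (mF n).
- move=> n x; have : 0 <= \prod_(0 <= i < n) (1 - \1_(F i) x : R) <= 1.
    apply: (big_ind (fun z : R => 0 <= z <= 1)); first by rewrite ler01 lexx.
      by move=> y z /andP[y0 y1] /andP[z0 z1]; rewrite mulr_ge0// mulr_ile1.
    by move=> i _; rewrite indicE; case: (_ \in _); rewrite ?subrr ?subr0 ?lexx ?ler01.
  by move=> /andP[h0 h1]; rewrite ger0_norm ?subr_ge0// lerBlDr lerDl.
- by move=> x; rewrite indicE; case: (_ \in _); rewrite ?normr1 ?normr0.
- move=> x; rewrite indicE; apply: cvg_near_cst.
  have [[k _ Fk]|nF] := pselect ((\bigcup_n F n) x).
    exists k.+1 => // n /= kn; rewrite mem_set; last by exists k.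
    rewrite big_mkord (bigD1 (Ordinal kn))//=.
    by rewrite indicE mem_set// subrr mul0r subr0.
  apply: nearW => n; rewrite memNset// big1 ?subrr// => i _.
  by rewrite indicE memNset ?subr0// => Fi; apply: nF; exists i.
Qed.

(** The half-space is the union of the slabs of width 2r on which a suitably centred
    bell is at least 1/2. *)
Lemma mult_set_ray i (b : R) : mult_set [set x | b <= x ord0 i].
Proof.
pose r : R := Num.sqrt (8 * ln 2).
have ln20 : 0 < ln (2:R) by rewrite ln_gt0// ltr1n.
have r0 : 0 < r by rewrite sqrtr_gt0 mulr_gt0.
have bellP c x : ~ (bell i c x < 2^-1) <-> `|x ord0 i - c| <= r.
  have -> : `|x ord0 i - c| <= r = (2^-1 <= bell i c x).
    rewrite -[ (`|_| <= r) ](@ler_pXn2r _ 2) ?nnegrE ?(ltW r0)// real_normK ?num_real//.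
    rewrite sqr_sqrtr ?mulr_ge0 ?(ltW ln20)// /bell expRN lef_pV2 ?posrE ?expR_gt0//.
    have e2 : expR (ln 2) = 2 :> R by rewrite lnK// posrE.
    by rewrite -[X in _ = (_ <= X)]e2 ler_expR ler_pdivrMr// [_ * 8]mulrC.
  by rewrite leNgt; split => /negP.
rewrite [X in mult_set X](_ : _ =
    \bigcup_j ~` [set x | bell i (b + (j.*2.+1)%:R * r) x < 2^-1]).
  by apply: mult_set_bigcup => j; apply: mult_setC; exact: mult_set_bell.
apply/seteqP; split => x /=.
  move=> bx; pose z := (x ord0 i - b) / (2 * r).
  have z0 : 0 <= z by rewrite divr_ge0 ?subr_ge0// mulr_ge0// ltW.
  exists (Num.truncn z) => //=; apply/bellP.
  have /andP[h1 h2] := truncn_itv z0.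
  have zE : x ord0 i = b + z * (2 * r).
    by rewrite /z divfK ?subrKC// gt_eqF// mulr_gt0.
  move: h1 h2; rewrite zE -[X in _ -> _ < X -> _]natr1 -(natr1 _.*2) -muln2 natrM.
  set m : R := (Num.truncn z)%:R => h1 h2; rewrite ler_norml; apply/andP; split.
    rewrite -subr_ge0 (_ : _ - _ = (z - m) * (2 * r)); last by ring.
    by rewrite mulr_ge0 ?subr_ge0// mulr_ge0// ltW.
  rewrite -subr_ge0 (_ : _ - _ = (m + 1 - z) * (2 * r)); last by ring.
  by rewrite mulr_ge0 ?subr_ge0 ?(ltW h2)// mulr_ge0// ltW.
move=> [j _ /bellP]; rewrite ler_norml => /andP[+ _].
rewrite -natr1 lerBrDr; apply: le_trans.
rewrite -subr_ge0 (_ : _ - b = j.*2%:R * r); last by ring.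
by rewrite mulr_ge0// ltW.
Qed.

(** The half-spaces generate the sigma-algebra. *)
Lemma mult_set_measurable A : measurable A -> mult_set A.
Proof.
have sig : sigma_algebra setT mult_set.
  split.
  - split => //; have := multiplier_cst 0; congr multiplier.
    by apply/funext => x; rewrite indic0.
  - by move=> B mB; rewrite setTD; exact: mult_setC.
  - exact: mult_set_bigcup.
have coordP i (B : set R) : measurable B -> mult_set ((fun x : 'rV[R]_d => x ord0 i) @^-1` B).
  rewrite [measurable]RGenCInfty.measurableE.
  suff : <<s @RGenCInfty.G R >> `<=`
     [set B | mult_set ((fun x : 'rV[R]_d => x ord0 i) @^-1` B)] by apply.
  apply: smallest_sub.
    split => /=; first by rewrite preimage_set0; case: sig.
    - by move=> C mC; rewrite setTD preimage_setC; exact: mult_setC.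
    - by move=> F mF; rewrite preimage_bigcup; exact: mult_set_bigcup.
  move=> _ [b ->] /=; have := mult_set_ray i b; congr mult_set.
  by apply/seteqP; split => x /=; rewrite in_itv/= andbT.
suff : @measurable _ 'rV[R]_d `<=` mult_set by apply.
apply: smallest_sub => // B; rewrite -bigcup_seq/= => -[i _ [C mC <-]].
by rewrite setTI; exact: coordP.
Qed.

Lemma papprox_indic A : measurable A -> papprox (\1_A).
Proof.
move=> /mult_set_measurable[_ [_ _ /(_ _ good1)[_ _ /(_ (fun=> 1))]]].
congr papprox; apply/funext => x /=.
by rewrite /tpoly big1 ?mulr1// => i _; rewrite hornerC.
Qed.

(** Nonnegative functions are dominated limits of simple functions, and
    F = (F + |F|) - |F|. *)
Lemma papprox_Lfun2 F : F \in Lfun gauss 2%:E -> papprox F.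
Proof.
have nn (f : {nnsfun 'rV[R]_d >-> R}) : papprox f.
  have -> : (f : fn) = fun x => \sum_(y <- finmap.enum_fset (fset_set (range f))) y * (\1_(f @^-1` [set y])) x.
    apply/funext => x; rewrite fimfunE -fsbig_finite//.
  by apply: papprox_sum => y; apply: papprox_indic.
have ge0 G : (forall x, 0 <= G x) -> G \in Lfun gauss 2%:E -> papprox G.
  move=> G0 hG; have mG : measurable_fun setT (EFin \o G).
    by apply/measurable_EFinP; exact: Lfun2_measurable.
  pose G_ := nnsfun_approx measurableT mG.
  have leG n x : G_ n x <= G x.
    rewrite /G_ nnsfun_approxE -lee_fin.
    by apply: (@le_approx _ _ _ setT (EFin \o G)) => // y _; rewrite lee_fin.
  apply: (@papprox_lim (fun n => G_ n) _ G) => //.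
  - exact: Lfun2_measurable.
  - move=> x; have h : (G_ n x)%:E @[n --> \oo] --> (G x)%:E.
      by apply: (@cvg_nnsfun_approx _ _ _ _ measurableT _ mG) => // y _; rewrite lee_fin.
    by have /fine_cvgP[_] := h.
  - move=> n x; rewrite ler0_norm ?subr_le0// opprB lerBlDr lerDl//.
  - exact: Lfun2_integrable_sqr.
move=> hF; have mF := Lfun2_measurable hF.
have nF : (fun x => `|F x|) \in Lfun gauss 2%:E.
  move: hF; rewrite inE => /andP[_ /set_mem/= hf].
  rewrite inE; apply/andP; split; apply: mem_set => /=; first exact: measurableT_comp.
  move: hf; rewrite /finite_norm; congr (_ < _)%E.
  by rewrite -[in LHS]Lnorm_abse; congr Lnorm; apply/funext.
have pn : papprox (fun x => `|F x|) by apply: ge0.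
have ps : papprox (F \+ (fun x => `|F x|)).
  apply: ge0 => [x /=|]; last by rewrite rpredD ?lee1n.
  by rewrite addrC -lerBlDr sub0r -normrN ler_norm.
rewrite (_ : F = (F \+ (fun x => `|F x|)) \+ (fun x => -1 * `|F x|)).
  by apply: papproxD => //; exact: papproxZ.
by apply/funext => x /=; ring.
Qed.

End density_of_polynomials.

Section multi_indices.
Context {d : nat}.
Local Notation mindex := {ffun 'I_d -> nat}.
Implicit Types (k : mindex).

(** Every coordinate is at most m, so that the enumeration of a finite type of
    functions is available. *)
Definition midx (m : nat) : seq mindex :=
  [seq [ffun i => nat_of_ord (j i)] |
     j : {ffun 'I_d -> 'I_m.+1} <- enum [pred j : {ffun 'I_d -> 'I_m.+1} | (\sum_i j i <= m)%N]].

Lemma midx_uniq m : uniq (midx m).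
Proof.
rewrite map_inj_uniq ?enum_uniq// => k k' /ffunP kk'; apply/ffunP => i.
by apply/val_inj; have := kk' i; rewrite !ffunE.
Qed.

Lemma leq_mabs k i : (k i <= mabs k)%N.
Proof. by rewrite /mabs (bigD1 i)//= leq_addr. Qed.

Lemma mem_midx k m : (k \in midx m) = (mabs k <= m)%N.
Proof.
apply/mapP/idP => [[k' + ->]|km].
  rewrite mem_enum inE; apply: leq_trans; rewrite /mabs.
  by apply: leq_sum => i _; rewrite ffunE.
have h i : (k i < m.+1)%N by rewrite ltnS (leq_trans (leq_mabs k i)).
exists [ffun i => Ordinal (h i)]; last by apply/ffunP => i; rewrite !ffunE.
by rewrite mem_enum inE; under eq_bigr do rewrite ffunE.
Qed.

(** These multi-indices are the partial ordered partitions of m into d parts. *)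
Lemma size_midx m : size (midx m) = 'C(m + d, d).
Proof.
rewrite size_map -cardE addnC -card_partial_ord_partitions.
rewrite -(card_imset _ (can_inj (@finfun_of_tupleK 'I_m.+1 d))).
apply: eq_card => k; rewrite [LHS]inE; apply/idP/imsetP => [km|[t + ->]].
  exists (tuple_of_finfun k); last by rewrite tuple_of_finfunK.
  by rewrite inE big_tuple; under eq_bigr do rewrite tnth_map tnth_ord_tuple.
rewrite inE big_tuple; apply: leq_trans.
by under eq_bigr do rewrite ffunE.
Qed.

End multi_indices.
Arguments midx : clear implicits.

Section parseval.
Context {R : realType} {d : nat}.
Local Notation gauss := (gauss_measure R d).
Local Notation mindex := {ffun 'I_d -> nat}.
Implicit Types (f g : L2 R d) (k : mindex).

Lemma Lspace_fun_hcomb K (c : mindex -> R) : Lspace_fun (hcomb K c) =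
  (fun x => \sum_(k <- K) c k * mhermite k x) %[ae gauss].
Proof.
elim: K => [|k K IH].
  rewrite /hcomb big_nil.
  have := LclassK (lee1n 2) (Lfun0 gauss (lee1n 2)).
  by apply: filterS => x /= + _ => ->//; rewrite big_nil.
have := Lspace_funD (c k *: hbasis k) (hcomb K c).
have -> : hcomb (k :: K) c = c k *: hbasis k + hcomb K c by rewrite /hcomb big_cons.
move=> h.
have := Lspace_funZ (c k) (hbasis k) => h1; have h2 := @hbasisE R d k.
near=> x => _; rewrite (near h x)//= (near h1 x)//= (near h2 x)//= (near IH x)//.
by rewrite big_cons.
Unshelve. all: by end_near. Qed.

Definition hfun m (c : mindex -> R) (x : 'rV[R]_d) : R :=
  \sum_(k <- midx d m) c k * mhermite k x.

(** Every m' beyond some m is allowed, so that several polynomials can be expanded with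
    the same range of indices. *)
Lemma tpoly_hfun (p : 'I_d -> {poly R}) : exists m, forall m', (m <= m')%N ->
  exists c, tpoly p = hfun m' c.
Proof.
pose n := \max_i size (p i).
have /choice[c hc] : forall i, exists c : nat -> R, p i = \sum_(k < n) c k *: He k.
  by move=> i; apply: poly_sum_He; exact: (leq_bigmax i).
exists (\sum_(i < d) n)%N => m' mm'.
pose nk (k : {ffun 'I_d -> 'I_n}) : mindex := [ffun i => nat_of_ord (k i)].
pose C (k : mindex) := (\prod_i c i (k i)) * Num.sqrt (mfact k)%:R.
exists (fun k => \sum_(j : {ffun 'I_d -> 'I_n} | nk j == k) C k).
apply/funext => x; rewrite /tpoly /hfun.
under eq_bigr do rewrite hc horner_sum.
rewrite bigA_distr_bigA/=.
under [RHS]eq_bigr do rewrite mulr_suml big_mkcond/=.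
rewrite exchange_big/=; apply: eq_bigr => j _.
have jm : nk j \in midx d m'.
  rewrite mem_midx (leq_trans _ mm')//; apply: leq_sum => i _.
  by rewrite ffunE ltnW// ltn_ord.
rewrite (bigD1_seq (nk j) jm (midx_uniq m'))/= eqxx [X in _ = _ + X]big1 ?addr0; last first.
  by move=> k; rewrite eq_sym => /negbTE ->.
rewrite /C mhermiteE mulrA mulfK; last first.
  by rewrite gt_eqF// sqrtr_gt0 ltr0n mfact_gt0.
rewrite -big_split/=; apply: eq_bigr => i _.
by rewrite hornerZ !ffunE.
Qed.

Lemma polysum_hfun (s : seq (R * ('I_d -> {poly R}))) : exists m, forall m', (m <= m')%N ->
  exists c, polysum s = hfun m' c.
Proof.
elim: s => [|[a p] s [m IH]].
  exists 0%N => m' _; exists (fun=> 0); apply/funext => x.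
  by rewrite /polysum big_nil /hfun big1// => k _; rewrite mul0r.
have [n hn] := tpoly_hfun p; exists (maxn m n) => m'.
rewrite geq_max => /andP[/IH[c hc] /hn[c' hc']].
exists (fun k => a * c' k + c k); apply/funext => x.
rewrite /polysum big_cons -/(polysum s x) hc /= hc' /hfun mulr_sumr -big_split/=.
by apply: eq_bigr => k _; rewrite mulrDl mulrA.
Qed.

(** Completeness: the projection is a better approximation than the polynomial
    provided by density. *)
Lemma hproj_cvg f (e : R) : 0 < e ->
  exists m, `|f - hproj (midx d m) f| ^+ 2 <= e.
Proof.
move=> e0; have [_ /(_ _ e0)[s hs]] := papprox_Lfun2 (L2_Lfun f).
have [m /(_ _ (leqnn m))[c hc]] := polysum_hfun s; exists m.
have le1 : `|f - hproj (midx d m) f| ^+ 2 <= `|f - hcomb (midx d m) c| ^+ 2.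
  by rewrite (hproj_best f c (midx_uniq m)) lerDl sumr_ge0// => k _; exact: sqr_ge0.
apply: (le_trans le1); rewrite -lee_fin; apply: le_trans hs.
rewrite sqr_normE /ip /Rintegral fineK; last first.
  by apply: integrable_fin_num => //; exact: integrable_mul_Lfun2 (L2_Lfun _) (L2_Lfun _).
rewrite le_eqVlt; apply/orP; left; apply/eqP; apply: ae_eq_integral => //.
- by apply/measurable_EFinP; apply: measurable_funM; exact: measurable_L2.
- apply/measurable_EFinP; apply: measurable_funX; apply: measurable_funB.
    exact: measurable_L2.
  exact: measurable_polysum.
have h1 := Lspace_funD f (- hcomb (midx d m) c).
have h2 := Lspace_funZ (-1) (hcomb (midx d m) c); rewrite scaleN1r in h2.
have h3 := Lspace_fun_hcomb (midx d m) c.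
near=> x => _; rewrite (near h1 x)//= (near h2 x)//= (near h3 x)//= hc -/(hfun m c x).
by rewrite -expr2 /GRing.scale/= mulN1r.
Unshelve. all: by end_near. Qed.

Lemma parseval_approx f (e : R) : 0 < e ->
  exists m, `|f| ^+ 2 <= \sum_(k <- midx d m) hermite_coef f k ^+ 2 + e.
Proof.
move=> /(hproj_cvg f)[m hm]; exists m.
by rewrite (pythagoras_hproj f (midx_uniq m)) addrC lerD2l.
Qed.

Lemma hermite_coefB f g k : hermite_coef (f - g) k = hermite_coef f k - hermite_coef g k.
Proof. by rewrite !hermite_coefE ipBl. Qed.

Lemma hermite_coef_inj f g :
  (forall k, hermite_coef f k = hermite_coef g k) -> f = g.
Proof.
move=> fg; apply/eqP; rewrite -subr_eq0 -normr_eq0 -sqrf_eq0 eq_le sqr_ge0 andbT.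
apply/ler_addgt0Pr => e e0; have [m hm] := parseval_approx (f - g) e0.
apply: (le_trans hm); rewrite big1 ?add0r// => k _.
by rewrite hermite_coefB fg subrr expr0n.
Qed.

Lemma parseval_le f (C : R) :
  (forall m, \sum_(k <- midx d m) hermite_coef f k ^+ 2 <= C) -> `|f| ^+ 2 <= C.
Proof.
move=> h; apply/ler_addgt0Pr => e e0; have [m hm] := parseval_approx f e0.
by apply: (le_trans hm); rewrite lerD2r.
Qed.

End parseval.

(** * Widths of sets described by Hermite coefficients *)

Section widths_general.
Context {R : realType} {Y : normedModType R}.

Lemma kolmogorov_le_linear n (F : set Y) :
  (kolmogorov_width n F <= linear_width n F)%E.
Proof.
apply: le_ereal_inf_tmp => _ [A dA <-]; apply: ge_ereal_inf.
exists (ereal_sup [set ereal_inf [set (`|f - g|)%:E | g in range A] | f in F]).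
  by exists (range A).
apply: ge_ereal_sup => _ [f Ff <-]; apply: le_ereal_sup_tmp.
exists (`|f - A f|)%:E; first by exists f.
by apply: ereal_inf_lbound; exists (A f).
Qed.

End widths_general.

Section hermite_widths.
Context {R : realType} {d : nat}.
Local Notation mindex := {ffun 'I_d -> nat}.
Local Notation L := (L2 R d).
Implicit Types (f g : L) (k : mindex) (K : seq mindex).

Lemma hproj_linear K : linear (hproj K : L -> L).
Proof.
move=> a f g; rewrite /hproj /hcomb scaler_sumr -big_split/=.
apply: eq_bigr => k _; rewrite !hermite_coefE ipDl ipZl scalerDl scalerA.
by [].
Qed.

HB.instance Definition _ K :=
  GRing.isLinear.Build R L L *:%R (hproj K : L -> L) (hproj_linear K).

Lemma dim_le_hproj n K : uniq K -> (size K <= n)%N -> dim_le n (range (hproj K : L -> L)).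
Proof.
move=> uK Kn; pose k0 : mindex := [ffun=> 0%N].
exists (fun i => if (i < size K)%N then hbasis (nth k0 K i) else 0).
have E (c : nat -> R) : \sum_(k <- K) c (index k K) *: hbasis k =
    \sum_(i < n) c i *: (if (i < size K)%N then hbasis (nth k0 K i) else 0) :> L.
  rewrite (big_nth k0) big_mkord (big_ord_widen n (fun i => c (index (nth k0 K i) K) *: (hbasis (nth k0 K i) : L)))//.
  rewrite big_mkcond/=; apply: eq_bigr => i _; case: ifP => iK; last by rewrite scaler0.
  by rewrite index_uniq.
apply/seteqP; split => [_ [f _ <-]|_ [c _ <-]].
  exists (fun i : 'I_n => hermite_coef f (nth k0 K i)) => //.
  rewrite -(E (fun i => hermite_coef f (nth k0 K i))).
  by apply: eq_big_seq => k kK; rewrite nth_index.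
pose c' j : R := if insub j is Some i then c i else 0.
exists (hcomb K (fun k => c' (index k K))) => //.
rewrite (eq_bigr (fun i : 'I_n => c' i *: (if (i < size K)%N then hbasis (nth k0 K i) else 0))).
  rewrite -E; apply: eq_big_seq => k kK.
  by rewrite hermite_coef_hcomb// kK.
by move=> i _; rewrite /c' valK.
Qed.

(** The bound of the Hermite norm of order s by C ([hermite_norm_le]), expressed by
    finite sums, to which Bessel's inequality and Parseval's identity apply. *)
Definition hbound (s C : R) f := forall m,
  \sum_(k <- midx d m) (1 + (mabs k)%:R) `^ s * hermite_coef f k ^+ 2 <= C ^+ 2.

Lemma hbound_ge0_sum s C f K : hbound s C f -> uniq K ->
  \sum_(k <- K) (1 + (mabs k)%:R) `^ s * hermite_coef f k ^+ 2 <= C ^+ 2.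
Proof.
move=> hf uK; pose m := (\sum_(k <- K) mabs k)%N.
have Km k : k \in K -> k \in midx d m.
  by move=> kK; rewrite mem_midx /m (big_rem k)//= leq_addr.
apply: le_trans (hf m); rewrite [leRHS](bigID (mem K))/=.
rewrite -[X in _ <= X + _]big_filter (perm_big [seq k <- midx d m | k \in K]).
  by rewrite lerDl sumr_ge0// => k _; rewrite mulr_ge0 ?powR_ge0 ?sqr_ge0.
apply: uniq_perm => //; first by rewrite filter_uniq ?midx_uniq.
by move=> k; rewrite mem_filter; case: (boolP (k \in K)) => //= /Km ->.
Qed.

Lemma hermite_norm_le (s C : R) f : 0 <= C ->
  (hermite_norm s f <= C%:E)%E <-> hbound s C f.
Proof.
move=> C0; pose a k := (1 + (mabs k)%:R : R) `^ s * `|hermite_coef f k| ^+ 2.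
have a0 k : 0 <= a k by rewrite mulr_ge0 ?powR_ge0 ?sqr_ge0.
have aE k : a k = (1 + (mabs k)%:R) `^ s * hermite_coef f k ^+ 2.
  by rewrite /a real_normK// num_real.
have e0 : (0 <= \esum_(k in [set: mindex]) (a k)%:E)%E.
  by apply: esum_ge0 => k _; rewrite lee_fin.
have -> : (hermite_norm s f <= C%:E)%E =
    (\esum_(k in [set: mindex]) (a k)%:E <= (C ^+ 2)%:E)%E.
  rewrite /hermite_norm -/(a _); apply/idP/idP => h.
    have := @gt0_ler_poweR R 2 (ler0n _ _) _ _ _ _ h.
    rewrite !in_itv/= !leey poweR_ge0 lee_fin C0 => /(_ isT isT).
    by rewrite -poweRrM mulVf// poweRe1// ?poweR_EFin powR_mulrn.
  have := @gt0_ler_poweR R 2^-1 _ _ _ _ _ h.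
  rewrite invr_ge0 ler0n !in_itv/= !leey e0 lee_fin sqr_ge0 => /(_ isT isT isT).
  by rewrite ?poweR_EFin -powR_mulrn// -powRrM mulfV// powRr1.
split=> [h m|h].
  under eq_bigr do rewrite -aE.
  rewrite -lee_fin -sumEFin; apply: le_trans h.
  apply: esum_ge; exists [set` midx d m].
    by split => //; exact: finite_seq.
  by rewrite fsbig_seq ?midx_uniq.
apply: ge_ereal_sup => _ [X [finX _] <-].
rewrite fsbig_finite//= sumEFin lee_fin.
under eq_bigr do rewrite aE.
by apply: (hbound_ge0_sum h); exact: finmap.fset_uniq.
Qed.

(** The remainder only involves |k| > m, where the weight is at least (2 + m)^s. *)
Lemma hbound_tail (s C : R) f m : 0 <= s -> 0 <= C -> hbound s C f ->
  `|f - hproj (midx d m) f| <= C * (2 + m%:R) `^ (- (s / 2)).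
Proof.
move=> s0 C0 hf; have m0 : 0 < 2 + m%:R :> R by rewrite ltr_wpDr.
rewrite -(@ler_pXn2r _ 2)// ?nnegrE ?mulr_ge0 ?powR_ge0//.
rewrite exprMn -[X in _ * X]powR_mulrn ?powR_ge0// -powRrM mulNr divfK// powRN.
apply: parseval_le => M; rewrite ler_pdivlMr ?powR_gt0// mulr_suml.
apply: le_trans (hf M); apply: ler_sum => k _.
rewrite hermite_coefB hermite_coef_hcomb ?midx_uniq// mem_midx.
case: ltnP => km; last first.
  by rewrite subrr expr0n mul0r mulr_ge0 ?powR_ge0 ?sqr_ge0.
rewrite subr0 mulrC ler_wpM2r ?sqr_ge0// ge0_ler_powR// ?nnegrE ?(ltW m0) ?addr_ge0//.
by rewrite -[2]/(1 + 1) -addrA lerD2l nat1r ler_nat.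
Qed.

Lemma linear_width_le (s C : R) n m (F : set L) : 0 <= s -> 0 <= C ->
  (size (midx d m) <= n)%N -> (forall f, F f -> hbound s C f) ->
  (linear_width n F <= (C * (2 + m%:R) `^ (- (s / 2)))%:E)%E.
Proof.
move=> s0 C0 mn FC; apply: ge_ereal_inf; eexists.
  exists (hproj (midx d m) : {linear L -> L}); last reflexivity.
  by rewrite /=; exact: dim_le_hproj (midx_uniq m) mn.
apply: ge_ereal_sup => _ [f Ff <-]; rewrite lee_fin.
by apply: hbound_tail => //; exact: FC.
Qed.

(** Orthogonality to n vectors is a system of n linear equations in the more than n
    coefficients c. *)
Lemma orthogonal_hcomb n K (e : 'I_n -> L) : uniq K -> (n < size K)%N ->
  exists2 c : mindex -> R, 0 < \sum_(k <- K) c k ^+ 2 &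
    forall j, ip (hcomb K c) (e j) = 0.
Proof.
move=> uK nK; pose N := size K.
pose G : 'M[R]_(N, n) := \matrix_(i, j) ip (hbasis (tnth (in_tuple K) i)) (e j).
have /rowV0Pn[v /sub_kermxP vG v0] : kermx G != 0.
  rewrite kermx_eq0 /row_free; apply/eqP => rG.
  by have := rank_leq_col G; rewrite rG leqNgt nK.
pose c k : R := if insub (index k K) is Some i then v ord0 i else 0.
have cE (i : 'I_N) : c (tnth (in_tuple K) i) = v ord0 i.
  by rewrite /c (tnth_nth [ffun=> 0%N])/= index_uniq// valK.
exists c.
  rewrite big_tnth; under eq_bigr do rewrite cE.
  have [i vi] := rV0Pn _ v0.
  rewrite (bigD1 i)//= ltr_wpDr ?sumr_ge0//; first by move=> j _; exact: sqr_ge0.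
  by rewrite exprn_even_gt0.
move=> j; rewrite ip_suml big_tnth.
have /matrixP/(_ ord0 j) := vG; rewrite !mxE => vGj; rewrite -[RHS]vGj.
by apply: eq_bigr => i _; rewrite ipZl cE mxE.
Qed.

(** An element orthogonal to a subspace has its norm as distance to it; scaled to norm
    B, the element of [orthogonal_hcomb] belongs to F. *)
Lemma kolmogorov_width_ge n K (F : set L) (B : R) : 0 <= B -> uniq K ->
  (n < size K)%N ->
  (forall c, \sum_(k <- K) c k ^+ 2 = B ^+ 2 -> F (hcomb K c)) ->
  (B%:E <= kolmogorov_width n F)%E.
Proof.
move=> B0 uK nK FK; apply: le_ereal_inf_tmp => _ [V [e ->] <-].
have [c c0 ce] := orthogonal_hcomb e uK nK.
set S := \sum_(k <- K) c k ^+ 2 in c0.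
pose a := B / Num.sqrt S; pose c' k := a * c k.
have sS : Num.sqrt S ^+ 2 = S by rewrite sqr_sqrtr// ltW.
have c'S : \sum_(k <- K) c' k ^+ 2 = B ^+ 2.
  under eq_bigr do rewrite exprMn.
  by rewrite -mulr_sumr -/S /a exprMn exprVn sS divfK// gt_eqF.
have c'c : hcomb K c' = a *: hcomb K c.
  by rewrite /hcomb scaler_sumr; apply: eq_bigr => k _; rewrite scalerA.
apply: le_ereal_sup_tmp; eexists; first by exists (hcomb K c'); [exact: FK|reflexivity].
apply: le_ereal_inf_tmp => _ [_ [b _ <-] <-]; rewrite lee_fin.
rewrite -(@ler_pXn2r _ 2)// ?nnegrE//.
rewrite sqr_normE ipBl !ipBr -(sqr_normE (hcomb K c')) sqr_norm_hcomb// c'S.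
have o : ip (hcomb K c') (\sum_(i < n) b i *: e i) = 0.
  by rewrite ip_sumr big1// => i _; rewrite ipZr c'c ipZl ce !mulr0.
by rewrite o (ipC _ (hcomb K c')) o subr0 sub0r opprK lerDl ip_ge0.
Qed.

Lemma hbound_hcomb (s C : R) m c :
  \sum_(k <- midx d m) (1 + (mabs k)%:R) `^ s * c k ^+ 2 <= C ^+ 2 ->
  hbound s C (hcomb (midx d m) c : L).
Proof.
move=> h M; apply: le_trans h.
have E k : hermite_coef (hcomb (midx d m) c : L) k = if (mabs k <= m)%N then c k else 0.
  by rewrite hermite_coef_hcomb ?midx_uniq// mem_midx.
under eq_bigr do rewrite E.
rewrite (bigID (fun k => (mabs k <= m)%N))/= [X in _ + X <= _]big1 ?addr0; last first.
  by move=> k /negbTE ->; rewrite expr0n mulr0.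
rewrite (eq_bigr (fun k => (1 + (mabs k)%:R) `^ s * c k ^+ 2)); last by move=> k ->.
rewrite [leRHS](bigID (fun k => (mabs k <= M)%N))/= -big_filter -[X in _ <= X + _]big_filter.
rewrite (perm_big [seq k <- midx d m | (mabs k <= M)%N]).
  by rewrite lerDl sumr_ge0// => k _; rewrite mulr_ge0 ?powR_ge0 ?sqr_ge0.
apply: uniq_perm; rewrite ?filter_uniq ?midx_uniq// => k.
by rewrite !mem_filter !mem_midx andbC.
Qed.

Lemma kolmogorov_hbound_ge (s C : R) n m (F : set L) : 0 <= s -> 0 <= C ->
  (n < size (midx d m))%N ->
  (forall c, hbound s C (hcomb (midx d m) c : L) -> F (hcomb (midx d m) c)) ->
  ((C * (1 + m%:R) `^ (- (s / 2)))%:E <= kolmogorov_width n F)%E.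
Proof.
move=> s0 C0 nm FC; apply: (kolmogorov_width_ge _ (midx_uniq m)) => //.
  by rewrite mulr_ge0 ?powR_ge0.
move=> c cS; apply: FC; apply: hbound_hcomb.
apply: (@le_trans _ _ (\sum_(k <- midx d m) (1 + m%:R) `^ s * c k ^+ 2)).
  rewrite big_seq [leRHS]big_seq; apply: ler_sum => k; rewrite mem_midx => km.
  rewrite ler_wpM2r ?sqr_ge0// ge0_ler_powR// ?nnegrE ?addr_ge0//.
  by rewrite lerD2l ler_nat.
rewrite -mulr_sumr cS exprMn -[X in _ * (_ * X)]powR_mulrn ?powR_ge0// -powRrM.
rewrite mulNr divfK// mulrCA -powRD ?subrr ?powRr0 ?mulr1//.
by apply/implyP => _; rewrite gt_eqF// ltr_wpDr.
Qed.

End hermite_widths.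

(** * Counting multi-indices and the asymptotics of the widths *)

Section asymptotics.
Context {R : realType}.

Lemma ffact_le_exp n m : (n ^_ m <= n ^ m)%N.
Proof.
have -> : (n ^ m = \prod_(i < m) n)%N by rewrite prod_nat_const card_ord.
by rewrite ffact_prod; apply: leq_prod => i _; exact: leq_subr.
Qed.

Lemma exp_le_ffact m d : (m.+1 ^ d <= (m + d) ^_ d)%N.
Proof.
have -> : (m.+1 ^ d = \prod_(i < d) m.+1)%N by rewrite prod_nat_const card_ord.
rewrite ffact_prod; apply: leq_prod => i _.
by have := ltn_ord i; lia.
Qed.

(** M n is the least degree for which there are more than n multi-indices. The
    bounds for M n come from (m+1)^d <= (m+d) ... (m+1) <= (m+d)^d. *)
Lemma shell d : (0 < d)%N -> exists M : nat -> nat, forall n, (0 < n)%N ->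
  [/\ (0 < M n)%N, (size (midx d (M n).-1) <= n < size (midx d (M n)))%N,
      (M n ^ d <= n * d`!)%N & (n * d`! < (M n + d) ^ d)%N].
Proof.
move=> d0; suff : forall n, exists M, (0 < n)%N ->
    [/\ (0 < M)%N, (size (midx d M.-1) <= n < size (midx d M))%N,
      (M ^ d <= n * d`!)%N & (n * d`! < (M + d) ^ d)%N].
  by move=> /choice[M hM]; exists M.
move=> n; have [->|n0] := posnP n; first by exists 0%N.
have ex : exists m, (n < 'C(m + d, d))%N.
  exists n; rewrite -bin_sub ?leq_addl// addnK.
  rewrite (leq_trans _ (leq_bin2l n (_ : n.+1 <= n + d)%N))//; first by rewrite binSn.
  by rewrite -addn1 leq_add2l.
case: (ex_minnP ex) => -[|m] hm mmin; first by move: hm; rewrite add0n binn ltnNge n0.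
have mn : ('C(m + d, d) <= n)%N by rewrite leqNgt; apply/negP => /mmin; rewrite ltnn.
exists m.+1 => _; rewrite !size_midx/= mn hm; split => //.
  rewrite (leq_trans (exp_le_ffact m d))// -bin_ffact leq_mul2r mn orbT//.
rewrite (leq_trans _ (ffact_le_exp _ _))// -bin_ffact ltn_mul2r hm fact_gt0//.
Qed.

(** x n stands for (n d!)^(1/d), which differs from M n by at most d. *)
Lemma fin_ratio_cvg1 d (M : nat -> nat) (x : nat -> R) :
  (forall n, (0 < n)%N -> (n < (M n + d) ^ d)%N) ->
  (forall n, (0 < n)%N -> (M n)%:R <= x n <= (M n + d)%:R) ->
  x n / (1 + (M n)%:R) @[n --> \oo] --> (1 : R).
Proof.
move=> nM xM; apply/cvgrPdist_le => e e0.
pose A := (Num.truncn (d.+1%:R / e)).+1.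
exists ((A + d) ^ d).+1 => // n /= An.
have n0 : (0 < n)%N by apply: leq_trans An.
have AM : (A <= M n)%N.
  rewrite leqNgt; apply/negP => MA.
  have := nM _ n0; rewrite ltnNge => /negP; apply.
  rewrite (leq_trans _ (ltnW An))//; case: (posnP d) => [->//|d0].
  by rewrite leq_exp2r// leq_add2r ltnW.
have M0 : 0 < 1 + (M n)%:R :> R by rewrite ltr_wpDr.
have /andP[x1 x2] := xM _ n0.
rewrite -[X in `|X - _|](divff (lt0r_neq0 M0)) -mulrBl normrM normfV (gtr0_norm M0).
rewrite ler_pdivrMr//.
have h : `|1 + (M n)%:R - x n| <= d.+1%:R.
  by rewrite ler_norml; move: x1 x2; rewrite natrD -[d.+1%:R]natr1 => x1 x2; apply/andP; split; lra.
apply: (le_trans h); rewrite mulrC -ler_pdivrMr//.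
rewrite (le_trans (ltW (truncnS_gt _)))// -/A.
by rewrite (@le_trans _ _ (M n)%:R) ?ler_nat// lerDr.
Qed.

Lemma cvg_powR_at1 (u : nat -> R) (r : R) : 0 <= r ->
  u n @[n --> \oo] --> (1:R) -> u n `^ r @[n --> \oo] --> (1:R).
Proof.
move=> r0 u1; have [->|rn0] := eqVneq r 0.
  by under eq_fun do rewrite powRr0; exact: cvg_cst.
have h : (fun n => expR (r * ln (u n))) @ \oo --> expR (r * ln 1).
  apply: (@cvg_comp _ _ _ (fun n => r * ln (u n)) expR); last exact: continuous_expR.
  apply: cvgM; first exact: cvg_cst.
  by apply: (@cvg_comp _ _ _ u (@ln R)) u1 _; apply: continuous_ln.
move: h; rewrite ln1 mulr0 expR0; apply: cvg_trans; apply: near_eq_cvg.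
near=> n; have un : 0 < u n by near: n; exact: (cvgr_gt _ u1 _ ltr01).
by rewrite /powR gt_eqF.
Unshelve. all: by end_near. Qed.

(** The truncation at degree M n - 1 has rank at most n, and there are more than n
    multi-indices of degree at most M n; hence the widths of F lie between c w n and
    C w n. For the ball of H^s itself c = C = 1, and they are equal to w n. *)
Lemma widths_of_comparison (d : nat) (s : R) (F : set (L2 R d))
    (width : nat -> set (L2 R d) -> \bar R) (c C : R) :
  (0 < d)%N -> 0 < s -> 0 < c -> 0 < C ->
  (width = linear_width \/ width = kolmogorov_width) ->
  (forall f, F f -> hbound s C f) ->
  (forall m a, hbound s c (hcomb (midx d m) a) -> F (hcomb (midx d m) a)) ->
  [/\ asymp_equiv (fun n => width n F) (fun n => width n (hermite_ball d s)),
      asymp_equiv (fun n => width n (hermite_ball d s))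
                  (fun n => (n%:R `^ (- (s / (2 * d%:R))))%:E) &
      (width n (hermite_ball d s) / (n%:R `^ (- (s / (2 * d%:R))))%:E)%E
        @[n --> \oo] -->
      ((1 / (d`!%:R `^ (d%:R^-1))) `^ (s / 2))%:E].
Proof.
move=> d0 s0 c0 C0 widthE FC cF.
have [M hM] := shell d0.
pose w n : R := (1 + (M n)%:R) `^ (- (s / 2)).
have w0 n : 0 < w n by rewrite powR_gt0// ltr_wpDr.
have bounds G a b : 0 <= a -> 0 <= b -> (forall f, G f -> hbound s b f) ->
    (forall m e, hbound s a (hcomb (midx d m) e) -> G (hcomb (midx d m) e)) ->
    forall n, (0 < n)%N -> ((a * w n)%:E <= width n G <= (b * w n)%:E)%E.
  move=> a0 b0 Gb aG n n0; have [M0 /andP[h1 h2] _ _] := hM _ n0.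
  have U : (linear_width n G <= (b * w n)%:E)%E.
    have := linear_width_le (ltW s0) b0 h1 Gb.
    by rewrite (_ : 2 + _ = 1 + (M n)%:R)// -{2}(prednK M0) -natr1; lra.
  have Lw : ((a * w n)%:E <= kolmogorov_width n G)%E.
    by apply: kolmogorov_hbound_ge (ltW s0) a0 h2 _ => e; exact: aG.
  case: widthE => ->; rewrite ?U ?Lw ?andbT/=.
    exact: le_trans Lw (kolmogorov_le_linear _ _).
  exact: le_trans (kolmogorov_le_linear _ _) U.
have ballP f : hermite_ball d s f <-> hbound s 1 f.
  rewrite /hermite_ball/= -hermite_norm_le//; split=> [[]//|h]; split=> //.
  by rewrite /hermite_space/= (le_lt_trans h)// ltry.
have hE n : (0 < n)%N -> width n (hermite_ball d s) = (w n)%:E.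
  move=> n0; have := @bounds (hermite_ball d s) 1 1 ler01 ler01.
  move=> /(_ (fun f => (ballP f).1) (fun m e => (ballP _).2) n n0).
  by rewrite !mul1r => /andP[h1 h2]; apply/eqP; rewrite eq_le h1 h2.
pose x n : R := (n * d`!)%:R `^ d%:R^-1.
have dR : d%:R != 0 :> R by rewrite pnatr_eq0 -lt0n.
have xd n : x n ^+ d = (n * d`!)%:R.
  by rewrite -powR_mulrn ?powR_ge0// -powRrM mulVf// powRr1.
have xM n : (0 < n)%N -> (M n)%:R <= x n <= (M n + d)%:R.
  move=> n0; have [_ _ h3 h4] := hM _ n0.
  apply/andP; split; rewrite -(@ler_pXn2r _ d)// ?nnegrE ?powR_ge0// xd -natrX ler_nat//.
  exact: ltnW.
pose ff : R := d`!%:R `^ d%:R^-1.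
have ff0 : 0 < ff by rewrite powR_gt0// ltr0n fact_gt0.
(* the quotient of the limit statement, with the limit already factored out *)
have rho n : (0 < n)%N -> w n / n%:R `^ (- (s / (2 * d%:R))) =
    (1 / ff) `^ (s / 2) * (x n / (1 + (M n)%:R)) `^ (s / 2).
  move=> n0; have n0R : 0 < n%:R :> R by rewrite ltr0n.
  have M1 : 0 < 1 + (M n)%:R :> R by rewrite ltr_wpDr.
  rewrite -powRM ?divr_ge0 ?powR_ge0 ?(ltW M1) ?ler01 ?(ltW ff0)//.
  have -> : 1 / ff * (x n / (1 + (M n)%:R)) = n%:R `^ d%:R^-1 / (1 + (M n)%:R).
    rewrite /x natrM powRM// -/ff; set y := n%:R `^ _; set z := 1 + _.
    by field; rewrite !lt0r_neq0.
  rewrite powRM ?powR_ge0 ?invr_ge0 ?(ltW M1)// -powRrM mulrC; congr (_ * _).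
    rewrite -powRN opprK; congr (_ `^ _).
    by field.
  by rewrite /w -[(1 + _)^-1]powR_inv1 ?(ltW M1)// -powRrM mulN1r.
(* crude bounds for every n, while the convergence is only asymptotic *)
have xr n : (0 < n)%N -> 2^-1 <= x n / (1 + (M n)%:R) <= d%:R.
  move=> n0; have [M0 _ _ _] := hM _ n0; have /andP[x1 x2] := xM _ n0.
  have M1 : 0 < 1 + (M n)%:R :> R by rewrite ltr_wpDr.
  have M1' : 1 <= (M n)%:R :> R by rewrite ler1n.
  have d1 : 1 <= d%:R :> R by rewrite ler1n.
  rewrite ler_pdivlMr// ler_pdivrMr//; apply/andP; split; first lra.
  move: x2; rewrite natrD => x2; apply: (le_trans x2).
  rewrite mulrDr mulr1 addrC lerD2l ler_peMl//.
split.
- exists c, C; split => // n n0.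
  have /andP[h1 h2] := bounds F c C (ltW c0) (ltW C0) FC cF n n0.
  by rewrite hE// -!EFinM.
- exists ((1 / ff) `^ (s / 2) * 2^-1 `^ (s / 2)), ((1 / ff) `^ (s / 2) * d%:R `^ (s / 2)).
  have f0 : 0 < (1 / ff) `^ (s / 2) by rewrite powR_gt0// divr_gt0.
  have s2 : 0 <= s / 2 by rewrite divr_ge0// ltW.
  split; [by rewrite mulr_gt0// powR_gt0|by rewrite mulr_gt0// powR_gt0// ltr0n|].
  move=> n n0; rewrite hE// -!EFinM !lee_fin.
  have n0R : 0 < n%:R `^ (- (s / (2 * d%:R))) :> R by rewrite powR_gt0// ltr0n.
  have /andP[r1 r2] := xr _ n0.
  split.
    rewrite -ler_pdivlMr// rho// ler_wpM2l ?(ltW f0)// ge0_ler_powR// nnegrE//.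
    by rewrite (le_trans _ r1).
  rewrite -ler_pdivrMr// rho// ler_wpM2l ?(ltW f0)// ge0_ler_powR// nnegrE//.
  by rewrite (le_trans _ r1).
- apply: (@cvg_trans _ (((1 / ff) `^ (s / 2) * (x n / (1 + (M n)%:R)) `^ (s / 2))%:E @[n --> \oo])).
    apply: near_eq_cvg; exists 1%N => // n /= n0.
    have n0R : n%:R `^ (- (s / (2 * d%:R))) != 0 :> R.
      by rewrite gt_eqF// powR_gt0// ltr0n.
    by rewrite -rho// hE// inver (negbTE n0R) -EFinM.
  apply: cvg_EFin; first by near=> n.
  rewrite -[X in _ --> X]mulr1; apply: cvgM; first exact: cvg_cst.
  apply: cvg_powR_at1; first by rewrite divr_ge0// ltW.
  apply: (@fin_ratio_cvg1 d) => // n n0.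
  have [_ _ _ h4] := hM _ n0; apply: leq_ltn_trans h4.
  by rewrite leq_pmulr// fact_gt0.
Unshelve. all: by end_near. Qed.

End asymptotics.

(** * Smooth cut-offs *)

Section derivative_sequences.
Context {R : realType}.
Implicit Types (A B v : nat -> R -> R) (t : R).

(** All derivatives of v 0 as an explicit sequence: smoothness of products and
    tensor products then needs no further differentiability argument. *)
Definition dseq v := forall j t, is_derive t (1:R) (v j) (v j.+1 t).

(** The j-th derivative of [A l * B m], in the form produced by applying the
    product rule j times. *)
Fixpoint leib A B (j l m : nat) t : R :=
  if j is j'.+1 then leib A B j' l.+1 m t + leib A B j' l m.+1 t
  else A l t * B m t.

Lemma dseq_leib A B l m : dseq A -> dseq B -> dseq (fun j => leib A B j l m).
Proof.
move=> dA dB j; elim: j l m => [|j IH] l m t /=.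
  have := dA l t; have := dB m t => ? ?.
  by apply: is_derive_eq; rewrite /GRing.scale/=; ring.
have := IH l.+1 m t; have := IH l m.+1 t => /= ? ?.
exact: is_deriveD.
Qed.

Lemma leib_eq0 A B j l m t : (forall i, A i t = 0) -> leib A B j l m t = 0.
Proof.
by move=> A0; elim: j l m => [|j IH] l m /=; rewrite ?A0 ?mul0r// !IH addr0.
Qed.

Lemma leib_eq0r A B j l m t : (forall i, B i t = 0) -> leib A B j l m t = 0.
Proof.
by move=> A0; elim: j l m => [|j IH] l m /=; rewrite ?A0 ?mulr0// !IH addr0.
Qed.

Lemma dseq_continuous v j : dseq v -> continuous (v j).
Proof.
move=> dv x; apply: differentiable_continuous; apply/derivable1_diffP.
by case: (dv j x).
Qed.

Lemma dseq_scale v (a b c : R) : dseq v ->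
  dseq (fun j t => c * a ^+ j * v j (a * t + b)).
Proof.
move=> dv j t.
have := dv j (a * t + b) => d1.
have d2 : is_derive t (1:R) (fun t : R => a * t + b) a.
  by apply: is_derive_eq; rewrite /GRing.scale/= mulr1 addr0.
have d3 : is_derive t (1:R) (v j \o (fun t : R => a * t + b)) (v j.+1 (a * t + b) * a).
  exact: is_derive1_comp.
have := is_deriveZ (c * a ^+ j) d3.
by congr is_derive; rewrite /GRing.scale/= exprS; ring.
Qed.

Lemma is_derive0_quadratic (f : R -> R) (C : R) : f 0 = 0 ->
  (forall t, `|f t| <= C * t ^+ 2) -> is_derive (0:R) (1:R) f 0.
Proof.
move=> f0 fC; apply/is_derive1_caratheodory.
have C0 : 0 <= C by have := fC 1; rewrite expr1n mulr1; exact: le_trans.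
exists (fun z => f z / z); split; last by rewrite f0 mul0r.
  move=> z; rewrite f0 !subr0; have [->|z0] := eqVneq z 0.
    by rewrite f0 mulr0.
  by rewrite divfK.
apply/cvgrPdist_le => e e0; rewrite invr0 mulr0.
have C1 : 0 < C + 1 by rewrite ltr_wpDl.
exists (e / (C + 1)) => /=; first by rewrite divr_gt0.
move=> z /=; rewrite !sub0r !normrN => ze.
have [->|z0] := eqVneq z 0; first by rewrite invr0 mulr0 normr0 ltW.
rewrite normrM normfV ler_pdivrMr ?normr_gt0//.
apply: (le_trans (fC z)); rewrite -[z ^+ 2]real_normK ?num_real// expr2 mulrA.
rewrite ler_wpM2r//; apply: (@le_trans _ _ ((C + 1) * `|z|)).
  by rewrite ler_wpM2r// lerDl.
by rewrite mulrC -ler_pdivlMr// ltW.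
Qed.

End derivative_sequences.

Section bump.
Context {R : realType}.

(** With an arbitrary polynomial p, the class is closed under differentiation. *)
Definition flat (p : {poly R}) (t : R) : R :=
  if 0 < t then p.[t^-1] * expR (- t^-1) else 0.

(** Quadratic decay at 0 gives the derivative 0 there. *)
Lemma flat_quadratic p : exists C : R, forall t, `|flat p t| <= C * t ^+ 2.
Proof.
have [C C0 h] := poly_growth (p * 'X^2) ltr01.
exists C => t; rewrite /flat; case: ifPn => t0; last first.
  by rewrite normr0 mulr_ge0// sqr_ge0.
have := h t^-1; rewrite mul1r hornerM hornerXn (gtr0_norm (_ : 0 < t^-1)) ?invr_gt0//.
have -> : `|p.[t^-1] * t^-1 ^+ 2| = `|p.[t^-1]| * t^-1 ^+ 2.
  by rewrite normrM (ger0_norm (sqr_ge0 _)).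
rewrite normrM (ger0_norm (expR_ge0 _)).
rewrite -(@ler_pM2r _ (t ^+ 2 * expR (- t^-1))) ?mulr_gt0 ?exprn_gt0 ?expR_gt0//.
have e0 := expR_gt0 t^-1; rewrite expRN.
have -> : `|p.[t^-1]| * t^-1 ^+ 2 * (t ^+ 2 * (expR t^-1)^-1) = `|p.[t^-1]| / expR t^-1.
  by rewrite exprVn; field; rewrite !lt0r_neq0.
by have -> : C * expR t^-1 * (t ^+ 2 * (expR t^-1)^-1) = C * t ^+ 2
  by field; rewrite !lt0r_neq0.
Qed.

Definition flat_diff (p : {poly R}) : {poly R} := 'X^2 * (p - p^`()).

Lemma is_derive_flat p t : is_derive t (1:R) (flat p) (flat (flat_diff p) t).
Proof.
have [t0|t0|->] := ltgtP t 0.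
- rewrite {2}/flat ltNge ltW//=.
  apply: (@near_eq_is_derive _ _ _ (cst (0:R))).
  near=> s; rewrite /flat ltNge ltW//.
  by near: s; exact: lt_nbhsl.
- rewrite {2}/flat t0.
  have tn0 : t != 0 by rewrite gt_eqF.
  have d1 : is_derive t (1:R) (fun t : R => t^-1) (- t ^- 2).
    apply: is_derive_eq; first exact: (@is_deriveV _ id t).
    by rewrite /GRing.scale/= mulr1.
  have d2 : is_derive t (1:R) (fun t : R => p.[t^-1]) (p^`().[t^-1] * (- t ^- 2)).
    exact: (@is_derive1_comp _ (horner p) (fun t : R => t^-1)).
  have d3 : is_derive t (1:R) (fun t : R => - t^-1) (t ^- 2).
    by apply: is_derive_eq; rewrite opprK.
  have d4 : is_derive t (1:R) (fun t : R => expR (- t^-1)) (expR (- t^-1) * t ^- 2).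
    exact: (@is_derive1_comp _ expR (fun t : R => - t^-1)).
  have d5 : is_derive t (1:R) (fun t : R => p.[t^-1] * expR (- t^-1))
      ((flat_diff p).[t^-1] * expR (- t^-1)).
    apply: is_derive_eq.
    rewrite /GRing.scale/= hornerM hornerXn hornerD hornerN.
    by rewrite exprVn; ring.
  apply: (near_eq_is_derive _ d5); near=> s; rewrite /flat ifT//.
  by near: s; exact: lt_nbhsr.
- have [C hC] := flat_quadratic p.
  have f0 q : flat q 0 = 0 by rewrite /flat ltxx.
  by rewrite f0; exact: (is_derive0_quadratic (f0 p) hC).
Unshelve. all: by end_near. Qed.

Definition flat_seq (j : nat) : R -> R := flat (iter j flat_diff 1).

Lemma dseq_flat : dseq flat_seq.
Proof. by move=> j t; rewrite /flat_seq iterS; exact: is_derive_flat. Qed.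

(** Derivatives of e^2 exp (-1/(1+t)) exp (-1/(1-t)), extended by 0 outside of
    ]-1, 1[; the factor e^2 normalizes the value at 0 to 1. *)
Definition bump (j : nat) : R -> R :=
  leib (fun j t => expR 2 * 1 ^+ j * flat_seq j (1 * t + 1))
       (fun j t => 1 * (- 1) ^+ j * flat_seq j (- 1 * t + 1)) j 0 0.

Lemma dseq_bump : dseq bump.
Proof. by apply: dseq_leib; apply: dseq_scale; exact: dseq_flat. Qed.

Lemma bump0 : bump 0 0 = 1.
Proof.
rewrite /bump/= !mulr0 !add0r /flat_seq/= /flat ltr01 invr1 hornerC !expr0 !mul1r mulr1.
by rewrite -mulrA -!expRD -[X in _ = X]expR0; congr expR; ring.
Qed.

Lemma bump_eq0 j t : 1 <= `|t| -> bump j t = 0.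
Proof.
rewrite ler_normr => /orP[t1|t1].
- apply: leib_eq0r => i; rewrite /flat_seq /flat ifF ?mulr0//.
  by apply/negbTE; rewrite -leNgt mulN1r; lra.
- apply: leib_eq0 => i; rewrite /flat_seq /flat ifF ?mulr0//.
  by apply/negbTE; rewrite -leNgt mul1r; lra.
Qed.

Lemma bump_bounded j : exists2 C : R, 0 <= C & forall t, `|bump j t| <= C.
Proof.
have cb : {within `[(-1 : R), 1], continuous (fun t => `|bump j t|)}.
  apply: continuous_subspaceT => t; apply: cvg_norm.
  exact: (@dseq_continuous _ bump j dseq_bump t).
have h11 : (-1:R) <= 1 by lra.
have [c _ hc] := EVT_max h11 cb.
exists `|bump j c| => // t; have [t1|t1] := leP 1 `|t|.
  by rewrite bump_eq0// normr0.
by apply: hc; rewrite in_itv/= -ler_norml ltW.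
Qed.

End bump.

Section cut_hermite.
Context {R : realType}.
Local Notation phi := (normal_pdf (0:R) 1).
Implicit Types (r t : R) (k : nat).

Definition scaled_bump r (j : nat) t : R := 1 * r^-1 ^+ j * bump j (r^-1 * t + 0).

Definition He_phi k (j : nat) t : R := (-1) ^+ j * (He (k + j)).[t] * phi t.

(** Derivatives of bump (t / r) He_k (t) phi (t). *)
Definition cut_He r k (j : nat) : R -> R := leib (scaled_bump r) (He_phi k) j 0 0.

Lemma dseq_He_phi k : dseq (He_phi k).
Proof.
move=> j t; rewrite /He_phi.
have := is_derive_normal_pdf 0 (oner_neq0 R) t; rewrite subr0 expr1n divr1 => ?.
apply: is_derive_eq; rewrite /GRing.scale/= addnS HeS hornerD hornerN hornerM hornerX.
by rewrite exprS; ring.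
Qed.

Lemma dseq_cut_He r k : dseq (cut_He r k).
Proof.
apply: dseq_leib; last exact: dseq_He_phi.
by apply: dseq_scale; exact: dseq_bump.
Qed.

Lemma cut_He_eq0 r k j t : 0 < r -> r <= `|t| -> cut_He r k j t = 0.
Proof.
move=> r0 rt; apply: leib_eq0 => i; rewrite /scaled_bump bump_eq0 ?mulr0//.
by rewrite addr0 normrM normfV (gtr0_norm r0) mulrC ler_pdivlMr// mul1r.
Qed.

(** Differentiating the cut-off produces powers of 1/r <= 1, so the bound is uniform
    in r. *)
Lemma cut_He_bounded k j : exists2 C : R, 0 <= C & forall r, 1 <= r ->
  forall t, `|cut_He r k j t| <= C * (expR `|t| * phi t).
Proof.
suff H l m : exists2 C : R, 0 <= C & forall r, 1 <= r ->
  forall t, `|leib (scaled_bump r) (He_phi k) j l m t| <= C * (expR `|t| * phi t) by exact: H.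
elim: j l m => [|j IH] l m.
  have [C C0 hC] := @bump_bounded R l; have [D D0 hD] := poly_growth (He (k + m)) (ltr01 : (0:R) < 1).
  exists (C * D) => [|r r1 t]; first by rewrite mulr_ge0.
  rewrite /= /scaled_bump /He_phi !normrM normr1 mul1r -mulrA mulrA.
  rewrite (ger0_norm (normal_pdf_ge0 _ _ _)) mulrA [leRHS]mulrA ler_wpM2r ?normal_pdf_ge0//.
  rewrite -[leRHS]mulrA ler_pM ?mulr_ge0//.
    rewrite -[leRHS]mul1r ler_pM// ger0_norm ?exprn_ge0 ?invr_ge0 ?(le_trans ler01)//.
    by rewrite exprn_ile1 ?invr_ge0 ?invf_le1 ?(le_trans ler01)// (lt_le_trans ltr01).
  by rewrite normrX normrN normr1 expr1n mul1r (le_trans (hD t))// mul1r.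
have [C C0 hC] := IH l.+1 m; have [D D0 hD] := IH l m.+1.
exists (C + D) => [|r r1 t]; first by rewrite addr_ge0.
by rewrite mulrDl /= (le_trans (ler_normD _ _))// lerD// ?hC ?hD.
Qed.

(** Only the term in which the cut-off is never differentiated survives. *)
Lemma cut_He_cvg k j t :
  cut_He n.+1%:R k j t @[n --> \oo] --> (-1) ^+ j * (He (k + j)).[t] * phi t.
Proof.
suff H l m : leib (scaled_bump n.+1%:R) (He_phi k) j l m t @[n --> \oo] -->
   (if l is 0 then He_phi k (m + j) t else 0).
  by have := H 0%N 0%N; rewrite add0n.
elim: j l m => [|j IH] l m.
  rewrite /= addn0 (_ : (if l is 0 then _ else _) = (l == 0)%:R * He_phi k m t); last first.
    by case: l => [|l]; rewrite ?mul1r ?mul0r.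
  have h1 : (n.+1%:R : R)^-1 @[n --> \oo] --> (0 : R) by exact: cvg_harmonic.
  have h3 : (n.+1%:R : R)^-1 * t + 0 @[n --> \oo] --> (0 : R).
    rewrite -[X in _ --> X](addr0 (0:R)); apply: cvgD; last exact: cvg_cst.
    by rewrite -[X in _ --> X](mul0r t); apply: cvgM => //; exact: cvg_cst.
  have h2 : bump l ((n.+1%:R : R)^-1 * t + 0) @[n --> \oo] --> bump l (0 : R).
    exact: (cvg_comp _ _ h3 (@dseq_continuous _ bump l dseq_bump 0)).
  have hX i : (n.+1%:R : R)^-1 ^+ i @[n --> \oo] --> (0 ^+ i : R).
    elim: i => [|i IHi]; first by under eq_fun do rewrite expr0; rewrite expr0; exact: cvg_cst.
    by under eq_fun do rewrite exprS; rewrite exprS; apply: cvgM.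
  have g : scaled_bump n.+1%:R l t @[n --> \oo] --> ((l == 0)%:R : R).
    have -> : ((l == 0)%:R : R) = 0 ^+ l * bump l 0.
      by case: (l) => [|l']; rewrite ?bump0 ?expr0 ?mul1r// exprS !mul0r.
    by rewrite /scaled_bump; under eq_fun do rewrite mul1r; apply: cvgM; [exact: hX|exact: h2].
  by apply: cvgM; [exact: g|exact: cvg_cst].
rewrite /= addnS -addSn -[X in _ --> X]add0r.
by apply: cvgD; [exact: (IH l.+1 m)|exact: (IH l m.+1)].
Qed.

End cut_hermite.

(** * Weak derivatives and Hermite coefficients *)

Section tensor_functions.
Context {R : realType} {d : nat}.
Implicit Types (w : 'I_d -> nat -> R -> R) (c : 'I_d -> nat).

(** The factors carry all their derivatives, and c selects one in each coordinate. *)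
Definition tens w c (x : 'rV[R]_d) : R := \prod_i w i (c i) (x ord0 i).

Lemma is_derive_tens w c i x : (forall i, dseq (w i)) ->
  is_derive x (delta_mx ord0 i) (tens w c) (tens w (fun j => c j + (j == i))%N x).
Proof.
move=> dw; pose P := \prod_(j | j != i) w j (c j) (x ord0 j).
have E (h : R) : tens w c (h *: delta_mx ord0 i + x) = w i (c i) (h + x ord0 i) * P.
  rewrite /tens (bigD1 i)//= !mxE !eqxx mulr1; congr (_ * _).
  by apply: eq_bigr => j ji; rewrite !mxE (negbTE ji) mulr0 add0r.
have E0 : tens w c x = w i (c i) (x ord0 i) * P.
  by have := E 0; rewrite scale0r !add0r.
have -> : tens w (fun j => c j + (j == i))%N x = w i (c i).+1 (x ord0 i) * P.
  rewrite /tens (bigD1 i)//= eqxx addn1; congr (_ * _).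
  by apply: eq_bigr => j /negbTE ->; rewrite addn0.
have [ex1 val1] := dw i (c i) (x ord0 i).
have C : (fun h : R => h^-1 *: ((tens w c \o shift x) (h *: delta_mx ord0 i) - tens w c x))
    @ 0^' --> w i (c i).+1 (x ord0 i) * P.
  rewrite (_ : (fun h => _) = (fun h : R => (h^-1 *: ((w i (c i) \o shift (x ord0 i)) (h *: 1)
     - w i (c i) (x ord0 i))) * P)); last first.
    apply/funext => h /=; rewrite E E0 /GRing.scale/= mulr1.
    by rewrite -mulrA mulrBl.
  by apply: cvgM; [rewrite -val1; exact: ex1|exact: cvg_cst].
by apply: DeriveDef; [apply/cvg_ex; eexists; exact: C|apply/cvg_lim].
Qed.

Lemma continuous_tens w c : (forall i, dseq (w i)) -> continuous (tens w c).
Proof.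
move=> dw; suff H r (x : 'rV[R]_d) : (fun y : 'rV[R]_d => \prod_(i <- r) w i (c i) (y ord0 i)) @ x -->
  \prod_(i <- r) w i (c i) (x ord0 i) by move=> x; exact: H.
elim: r => [|i r IH].
  rewrite big_nil (_ : (fun y : 'rV[R]_d => _) = fun=> (1:R)).
    exact: (@cvg_cst R 1 _ (nbhs x) _).
  by apply/funext => y; rewrite big_nil.
have h1 : (fun y : 'rV[R]_d => w i (c i) (y ord0 i)) @ x --> w i (c i) (x ord0 i).
  have h2 : (fun y : 'rV[R]_d => y ord0 i) @ x --> x ord0 i by exact: coord_continuous.
  exact: (cvg_comp _ _ h2 (@dseq_continuous R (w i) (c i) (dw i) (x ord0 i))).
rewrite big_cons (_ : (fun y : 'rV[R]_d => _) = fun y : 'rV[R]_d =>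
   w i (c i) (y ord0 i) * \prod_(i <- r) w i (c i) (y ord0 i)); first exact: (cvgM h1 IH).
by apply/funext => y; rewrite big_cons.
Qed.

Lemma partial_tens w c i : (forall i, dseq (w i)) ->
  partial i (tens w c) = tens w (fun j => c j + (j == i))%N.
Proof.
by move=> dw; apply/funext => x; apply: derive_val; exact: is_derive_tens.
Qed.

Lemma foldr_partial_tens w c s : (forall i, dseq (w i)) ->
  exists c', foldr (@partial R d) (tens w c) s = tens w c'.
Proof.
move=> dw; elim: s => [|i s [c' IH]]; first by exists c.
by rewrite /= IH partial_tens//; eexists.
Qed.

Lemma mpartial_tens w (a : {ffun 'I_d -> nat}) : (forall i, dseq (w i)) ->
  mpartial a (tens w (fun=> 0%N)) = tens w a.
Proof.
move=> dw; have it n i c : iter n (@partial R d i) (tens w c) =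
    tens w (fun j => c j + n * (j == i))%N.
  elim: n => [|n IH]; first by congr tens; apply/funext => j; rewrite mul0n addn0.
  rewrite iterS IH partial_tens//; congr tens; apply/funext => j.
  by move: (nat_of_bool _) => b; rewrite mulSn; lia.
rewrite /mpartial; have h s : uniq s ->
    foldr (fun i => iter (a i) (@partial R d i)) (tens w (fun=> 0%N)) s =
    tens w (fun j => a j * (j \in s))%N.
  elim: s => [|i s IH] /=; first by move=> _; congr tens; apply/funext => j; rewrite muln0.
  move=> /andP[ins us]; rewrite IH// it; congr tens; apply/funext => j.
  rewrite in_cons; have [->|_] := eqVneq j i; last by rewrite muln0 addn0.
  by rewrite (negbTE ins) muln0.
by rewrite h ?enum_uniq//; congr tens; apply/funext => j; rewrite mem_enum muln1.
Qed.

Lemma test_function_tens w c (r : R) : (forall i, dseq (w i)) ->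
  (forall i j t, r <= `|t| -> w i j t = 0) -> test_function (tens w c).
Proof.
move=> dw w0; split.
  move=> s; have [c' ->] := foldr_partial_tens c s dw.
  split; first exact: continuous_tens.
  by move=> i x; have [] := is_derive_tens c' i x dw.
exists [set x : 'rV[R]_d | forall i, `[(- r), r]%classic (x ord0 i)].
  by apply: (@rV_compact _ _ (fun=> `[(- r), r]%classic)) => _; exact: segment_compact.
move=> x nx; have [i xi] : exists i, r <= `|x ord0 i|.
  apply/not_existsP => h; apply: nx => i /=; rewrite in_itv/= -ler_norml ltW//.
  by rewrite ltNge; apply/negP; exact: h.
by rewrite /tens (bigD1 i)//= w0// mul0r.
Qed.

End tensor_functions.

Section weak_derivatives.
Context {R : realType} {d : nat}.
Local Notation phi := (normal_pdf (0:R) 1).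
Local Notation gauss := (gauss_measure R d).
Local Notation mindex := {ffun 'I_d -> nat}.
Implicit Types (f g : L2 R d) (k a : mindex).

Definition madd k a : mindex := [ffun i => (k i + a i)%N].

Definition cut_tens n k : 'I_d -> nat -> R -> R := fun i => cut_He n.+1%:R (k i).

Lemma dseq_cut_tens n k i : dseq (cut_tens n k i).
Proof. exact: dseq_cut_He. Qed.

Lemma cut_tens_test n k c : test_function (tens (cut_tens n k) c).
Proof.
apply: (@test_function_tens _ _ _ _ n.+1%:R) => [i|i j t nt].
  exact: dseq_cut_tens.
exact: cut_He_eq0.
Qed.

Lemma measurable_cut_tens n k c : measurable_fun setT (tens (cut_tens n k) c).
Proof.
apply: (@measurable_prod_coord _ _ (fun i => cut_tens n k i (c i))) => i.
by apply: continuous_measurable_fun; apply: dseq_continuous; exact: dseq_cut_tens.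
Qed.

Lemma cut_tens_cvg k a x : tens (cut_tens n k) a x @[n --> \oo] -->
  (-1) ^+ mabs a * (tHe (madd k a) x * gauss_density x).
Proof.
rewrite /mabs /tHe gauss_densityE expr_sum /tpoly -!big_split/= /tens.
elim: (index_enum _) => [|i r IH].
  by under eq_fun do rewrite big_nil; rewrite big_nil; exact: cvg_cst.
under eq_fun do rewrite big_cons; rewrite big_cons; apply: cvgM; last exact: IH.
by rewrite ffunE mulrA; exact: cut_He_cvg.
Qed.

Lemma cut_tens_bounded k c : exists2 C : R, 0 <= C & forall n x,
  `|tens (cut_tens n k) c x| <= C * (weight 0 1 x * gauss_density x).
Proof.
have /choice[C hC] : forall i, exists C : R, 0 <= C /\ forall r, 1 <= r ->
    forall t, `|cut_He r (k i) (c i) t| <= C * (expR `|t| * phi t).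
  by move=> i; have [C C0 h] := @cut_He_bounded R (k i) (c i); exists C.
exists (\prod_i C i); first by apply: prodr_ge0 => i _; case: (hC i).
move=> n x; rewrite /tens normr_prod gauss_densityE /weight -!big_split/=.
apply: ler_prod => i _; rewrite normr_ge0/= mul1r mul0r addr0.
by have [_ h] := hC i; apply: h; rewrite ler1n.
Qed.

(** Removing the cut-off by dominated convergence. *)
Lemma integral_cut_tens_cvg (F : 'rV[R]_d -> R) k a : F \in Lfun gauss 2%:E ->
  \int[lebesgue_rV R d]_x (F x * tens (cut_tens n k) a x) @[n --> \oo] -->
  (-1) ^+ mabs a * \int[gauss]_x (F x * tHe (madd k a) x).
Proof.
move=> hF; have mF := Lfun2_measurable hF.
have [C C0 hC] := cut_tens_bounded k a.
have sw : subgaussian 0 (weight 0 (1:R) : 'rV[R]_d -> R).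
  split.
    apply: (@measurable_prod_coord _ _ (fun _ t => expR (1 * `|t| + 0 * t ^+ 2))) => i.
    apply: measurableT_comp => //; apply: measurable_funD.
      by apply: measurable_funM => //; exact: measurableT_comp.
    by apply: measurable_funM => //; exact: measurable_funX.
  exists 1, 1; split => // x; rewrite mul1r ger0_norm//; exact: weight_ge0.
have [mt _] := subgaussian_tpoly (fun i => He ((madd k a) i) : {poly R}).
have wL2 : (weight 0 1 : 'rV[R]_d -> R) \in Lfun gauss 2%:E.
  by apply: (Lfun2_subgaussian (a := 0)); rewrite ?invr_gt0.
have tL2 : (tHe (madd k a) : 'rV[R]_d -> R) \in Lfun gauss 2%:E.
  by apply: (Lfun2_subgaussian (a := 0)); rewrite ?invr_gt0//; exact: subgaussian_tpoly.
have mw : measurable_fun setT (weight 0 1 : 'rV[R]_d -> R) by case: sw.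
have ig : (lebesgue_rV R d).-integrable setT
    (fun x => (`|F x| * weight 0 1 x * gauss_density x)%:E).
  apply/integrable_gauss.
    by apply: measurable_funM => //; exact: measurableT_comp.
  have := integrable_norm (integrable_mul_Lfun2 hF wL2).
  apply: eq_integrable => // x _ /=; rewrite normrM (ger0_norm (weight_ge0 _ _ _)).
  by [].
have E : (-1) ^+ mabs a * \int[gauss]_x (F x * tHe (madd k a) x) =
   \int[lebesgue_rV R d]_x (F x * ((-1) ^+ mabs a * (tHe (madd k a) x * gauss_density x))).
  have mm : measurable_fun setT (fun x => F x * tHe (madd k a) x).
    exact: measurable_funM.
  rewrite /Rintegral integral_gauss//.
  have i1 := (integrable_gauss mm).1 (integrable_mul_Lfun2 hF tL2).
  have := RintegralZl ((-1) ^+ mabs a) measurableT i1.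
  rewrite /Rintegral => <-; congr fine; apply: eq_integral => x _.
  by congr EFin; ring.
rewrite E.
have [] := @dominated_convergence _ _ _ (lebesgue_rV R d) setT measurableT
  (fun n x => (F x * tens (cut_tens n k) a x)%:E)
  (fun x => (F x * ((-1) ^+ mabs a * (tHe (madd k a) x * gauss_density x)))%:E)
  (fun x => (C * (`|F x| * weight 0 1 x * gauss_density x))%:E).
- by move=> n; apply/measurable_EFinP; apply: measurable_funM => //; exact: measurable_cut_tens.
- apply/measurable_EFinP; apply: measurable_funM => //; apply: measurable_funM => //.
  by apply: measurable_funM => //; exact: measurable_gauss_density.
- apply: aeW => x _; apply: cvg_EFin; first by near=> n.
  by apply: cvgM; [exact: cvg_cst|exact: cut_tens_cvg].
- under eq_fun do rewrite EFinM; exact: integrableZl.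
- apply: aeW => x n _ /=; rewrite lee_fin normrM.
  apply: (le_trans (ler_wpM2l (normr_ge0 _) (hC n x))).
  by rewrite le_eqVlt; apply/orP; left; apply/eqP; ring.
move=> i2 _ h; rewrite /Rintegral; apply: fine_cvg; rewrite fineK//.
exact: integrable_fin_num.
Unshelve. all: by end_near. Qed.

(** Differentiating shifts the Hermite coefficients: test the weak derivative
    against cut-offs of the function He_k times the Gaussian density. *)
Lemma weak_derivative_tHe a f g k : is_weak_derivative a f g ->
  \int[gauss]_x (Lspace_fun g x * tHe k x) =
  \int[gauss]_x (Lspace_fun f x * tHe (madd k a) x).
Proof.
move=> fg; have cf := integral_cut_tens_cvg (k := k) (a := a) (L2_Lfun f).
have cg := integral_cut_tens_cvg (k := k) (a := [ffun=> 0%N]) (L2_Lfun g).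
have sg : (-1 : R) ^+ mabs a != 0 by rewrite expf_neq0// oppr_eq0 oner_eq0.
apply: (mulfI sg).
have k0 : madd k [ffun=> 0%N] = k by apply/ffunP => i; rewrite !ffunE addn0.
have m0 : mabs ([ffun=> 0%N] : mindex) = 0%N.
  by rewrite /mabs big1// => i _; rewrite ffunE.
rewrite k0 m0 expr0 mul1r in cg.
have cg' : (-1 : R) ^+ mabs a * \int[lebesgue_rV R d]_x
    (Lspace_fun g x * tens (cut_tens n k) [ffun=> 0%N] x) @[n --> \oo] -->
    (-1 : R) ^+ mabs a * \int[gauss]_x (Lspace_fun g x * tHe k x).
  by apply: cvgM; [exact: cvg_cst|exact: cg].
rewrite -(cvg_lim (@Rhausdorff R) cg') -(cvg_lim (@Rhausdorff R) cf).
congr (lim (_ @ \oo)); apply/funext => n; apply/esym.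
have := fg _ (cut_tens_test n k (fun=> 0%N)).
rewrite mpartial_tens; last exact: dseq_cut_tens.
move=> ->; congr (_ * _); apply: eq_Rintegral => x _; congr (_ * tens _ _ _).
by apply/funext => i; rewrite ffunE.
Qed.

Lemma hermite_coef_tHe f k : hermite_coef f k =
  (Num.sqrt (mfact k)%:R)^-1 * \int[gauss]_x (Lspace_fun f x * tHe k x).
Proof.
rewrite /hermite_coef -RintegralZl//; last first.
  apply: integrable_mul_Lfun2 (L2_Lfun f) _.
  by apply: (Lfun2_subgaussian (a := 0)); rewrite ?invr_gt0//; exact: subgaussian_tpoly.
by apply: eq_Rintegral => x _; rewrite mhermiteE mulrCA.
Qed.

(** The normalizations of H_k and H_(k+a) turn [weak_derivative_tHe] into this
    factor. *)
Lemma hermite_coef_weak_derivative a f g k : is_weak_derivative a f g ->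
  hermite_coef g k =
  Num.sqrt ((mfact (madd k a))%:R / (mfact k)%:R) * hermite_coef f (madd k a).
Proof.
move=> fg; rewrite !hermite_coef_tHe (weak_derivative_tHe k fg) sqrtrM//.
rewrite sqrtrV// mulrA; congr (_ * _); rewrite mulrAC divff ?mul1r//.
by rewrite gt_eqF// sqrtr_gt0 ltr0n mfact_gt0.
Qed.

(** The coefficients determine the class. *)
Lemma weak_derivative_unique a f g g' :
  is_weak_derivative a f g -> is_weak_derivative a f g' -> g = g'.
Proof.
move=> fg fg'; apply: hermite_coef_inj => k.
by rewrite (hermite_coef_weak_derivative k fg) (hermite_coef_weak_derivative k fg').
Qed.

Lemma weak_derivativeE a f g : is_weak_derivative a f g -> weak_derivative a f = g.
Proof.
move=> fg; rewrite /weak_derivative; case: xgetP => [h -> fh|/(_ g)//].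
exact: weak_derivative_unique fh fg.
Qed.

End weak_derivatives.

(** * Polynomials have weak derivatives *)

Section continuous_compact_support.
Context {R : realType}.
Local Notation leb := (@lebesgue_measure R).

Lemma measurable_invr : measurable_fun setT (fun t : R => t^-1).
Proof.
rewrite (_ : (fun t => _) = fun t : R => t * (t ^+ 2) `^ (-1)).
  apply: measurable_funM => //; apply: (@measurableT_comp _ _ _ _ _ _ (@powR R ^~ (-1))).
    exact: measurable_powR.
  exact: measurable_funX.
apply/funext => t; rewrite powR_inv1 ?sqr_ge0//.
have [->|t0] := eqVneq t 0; first by rewrite invr0 mul0r.
by field.
Qed.

(** The coordinates generate the sigma-algebra of R^d by definition, so the Borel
    sets of the topology are reached through the countably many points of the
    grids (1/n) Z^d: rounding to the grid is measurable and tends to the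
    identity. *)
Lemma continuous_measurable_rV d (f : 'rV[R]_d -> R) :
  continuous f -> measurable_fun setT f.
Proof.
move=> cf; pose rnd n (x : 'rV[R]_d) : 'rV[int]_d :=
  \row_i Num.floor (n.+1%:R * x ord0 i).
pose grid n (z : 'rV[int]_d) : 'rV[R]_d := \row_i ((z ord0 i)%:~R / n.+1%:R).
apply: (@measurable_fun_cvg _ _ _ _ (fun n x => f (grid n (rnd n x)))) => [n|x _].
  have mr z : measurable [set x | rnd n x = z].
    rewrite (_ : [set x | _] = \bigcap_(i in [set: 'I_d])
      ((fun x : 'rV[R]_d => x ord0 i) @^-1`
        [set t | Num.floor (n.+1%:R * t) = z ord0 i])).
      apply: fin_bigcap_measurable => // i _; rewrite -[X in measurable X]setTI.
      apply: measurable_coord => //; rewrite -[X in measurable X]setTI.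
      have mf : measurable_fun setT (fun t : R => n.+1%:R * t).
        exact: measurable_funM.
      have -> : [set t : R | Num.floor (n.+1%:R * t) = z ord0 i] =
          (fun t : R => n.+1%:R * t) @^-1` `[(z ord0 i)%:~R, ((z ord0 i) + 1)%:~R[%classic.
        apply/seteqP; split => t /=; rewrite in_itv/=.
          by move=> <-; rewrite floor_itv.
        by move=> /andP[h1 h2]; apply/floor_def; rewrite h1 h2.
      by apply: mf => //; exact: measurable_itv.
    apply/seteqP; split => x /=; first by move=> <- i _ /=; rewrite mxE.
    by move=> h; apply/rowP => i; rewrite mxE; exact: h.
  move=> _ B mB; rewrite setTI.
  rewrite (_ : _ @^-1` _ = \bigcup_z
      (if `[< B (f (grid n z)) >] then [set x | rnd n x = z] else set0)).
    apply: countable_bigcupT_measurable => [|z]; first exact: countableP.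
    by case: ifP.
  apply/seteqP; split => x /=.
    by move=> h; exists (rnd n x) => //; rewrite ifT//; exact/asboolP.
  by move=> [z _]; case: ifPn => // /asboolP h /= ->.
apply: (@cvg_comp _ _ _ (fun n => grid n (rnd n x)) f _ (nbhs x)); last exact: cf.
apply/cvgrPdist_le => e e0; near=> n.
rewrite [leLHS]mx_normrE; apply: bigmax_le => [|[i j] _] /=; first exact: ltW.
rewrite (ord1 i) !mxE.
have n0 : (0:R) < n.+1%:R by [].
apply: (@le_trans _ _ (n.+1%:R^-1)).
  have /andP[h1 h2] := floor_itv (n.+1%:R * x ord0 j).
  rewrite ler_norml; apply/andP; split.
    rewrite (@le_trans _ _ 0)// ?oppr_le0 ?invr_ge0//.
    by rewrite subr_ge0 ler_pdivrMr// [leRHS]mulrC; exact: h1.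
  rewrite lerBlDr -[X in X + _]mul1r -mulrDl ler_pdivlMr// [leLHS]mulrC ltW// addrC.
  by move: h2; rewrite intrD.
by rewrite ltW//; near: n; exact: (near_infty_natSinv_lt (PosNum e0)).
Unshelve. all: by end_near. Qed.

Lemma le_coord_norm d (x : 'rV[R]_d) i : `|x ord0 i| <= `|x|.
Proof.
rewrite [leRHS]mx_normrE.
exact: (@le_bigmax _ _ _ _ (fun ij => `|x ij.1 ij.2|) (ord0, i)).
Qed.

Lemma compact_sub_box d (K : set 'rV[R]_d) : compact K ->
  exists N : nat, K `<=` @box_rV R d N.
Proof.
case: d K => [|d] K; first by exists 0%N => x _ [].
move=> /compact_bounded[M [_ hM]].
exists (Num.truncn (`|M| + 1)).+1 => x /(hM (`|M| + 1)) h i.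
rewrite (le_trans (le_coord_norm _ _))// (le_trans (h _))//.
  by rewrite (le_lt_trans (ler_norm _))// ltrDl.
by rewrite ltW// truncnS_gt.
Qed.

Lemma compact_box d N : compact (@box_rV R d N).
Proof.
rewrite (_ : box_rV N = [set x : 'rV[R]_d | forall i, `[(- N%:R), N%:R]%classic (x ord0 i)]).
  move: (N%:R) => r; apply: (@rV_compact R d (fun=> `[(- r), r]%classic)) => _.
  exact: segment_compact.
by apply/seteqP; split => x /= h i; have := h i; rewrite in_itv/= ler_norml.
Qed.

Lemma continuous_box_bounded d (F : 'rV[R]_d -> R) N : continuous F ->
  (forall x, ~ box_rV N x -> F x = 0) -> exists2 C, 0 <= C & forall x, `|F x| <= C.
Proof.
move=> cF F0.
have b0 : @box_rV R d N !=set0 by exists 0 => i; rewrite mxE normr0.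
have cn : {within box_rV N, continuous (fun x => `|F x|)}.
  apply: continuous_subspaceT => x; apply: continuous_comp; first exact: cF.
  exact: norm_continuous.
have [c _ hc] := compact_EVT_max b0 (@compact_box d N) cn.
exists `|F c| => // x; have [bx|/F0 ->] := pselect (box_rV N x).
  by apply: hc; exact: mem_set.
by rewrite normr0.
Qed.

Lemma integrable_box d (F : 'rV[R]_d -> R) N C : measurable_fun setT F ->
  (forall x, `|F x| <= C) -> (forall x, ~ box_rV N x -> F x = 0) ->
  (lebesgue_rV R d).-integrable setT (EFin \o F).
Proof.
move=> mF hC F0.
have mb := @measurable_box_rV R d N.
have iC : (lebesgue_rV R d).-integrable setT
    (fun x => (C * (\1_(@box_rV R d N) x))%:E).
  under eq_fun do rewrite EFinM.
  apply: integrableZl => //; apply/integrableP; split.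
    exact/measurable_EFinP.
  under eq_integral => x _ do rewrite gee0_abs ?lee_fin//.
  by rewrite integral_indic// setIT; exact: lebesgue_box_rV.
apply: (le_integrable measurableT _ _ iC); first exact/measurable_EFinP.
move=> x _ /=; rewrite lee_fin indicE; have [bx|bx] := boolP (x \in _).
  by rewrite mulr1 (le_trans (hC x))// ler_norm.
by rewrite F0 ?normr0//; move: bx => /negP h bx; apply: h; exact: mem_set.
Qed.

Lemma integrable_continuous_box d (F : 'rV[R]_d -> R) N : continuous F ->
  (forall x, ~ box_rV N x -> F x = 0) ->
  (lebesgue_rV R d).-integrable setT (EFin \o F).
Proof.
move=> cF F0; have [C _ hC] := continuous_box_bounded cF F0.
by apply: integrable_box hC F0; exact: continuous_measurable_rV.
Qed.

Lemma continuousM_rV d (F G : 'rV[R]_d -> R) :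
  continuous F -> continuous G -> continuous (fun x => F x * G x).
Proof.
by move=> cF cG x; apply: (@continuousM _ 'rV[R]_d F G x); [exact: cF|exact: cG].
Qed.

Lemma cons_rV_line0 d (x : 'rV[R]_d) (t r : R) :
  cons_rV (x, t) + r *: delta_mx ord0 ord0 = cons_rV (x, t + r).
Proof.
apply/rowP => i; rewrite [LHS]mxE [X in _ + X]mxE [X in _ * X]mxE eqxx/=.
have [j ->|->] := unliftP ord0 i; first by rewrite !cons_rVS mulr0 addr0.
by rewrite !cons_rV0 eqxx mulr1.
Qed.

Lemma cons_rV_lineS d (x : 'rV[R]_d) (t r : R) j :
  cons_rV (x, t) + r *: delta_mx ord0 (lift ord0 j) =
  cons_rV (x + r *: delta_mx ord0 j, t).
Proof.
apply/rowP => i; rewrite [LHS]mxE [X in _ + X]mxE [X in _ * X]mxE eqxx/=.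
have [k ->|->] := unliftP ord0 i; last by rewrite !cons_rV0 eq_liftF mulr0 addr0.
by rewrite !cons_rVS !mxE eqxx/= (inj_eq (@lift_inj _ ord0)).
Qed.

Local Open Scope ereal_scope.

Lemma integral_lebesgue_rVS21 d (f : 'rV[R]_d.+1 -> R) :
  (lebesgue_rV R d.+1).-integrable setT (EFin \o f) ->
  (\forall t \ae leb,
    (lebesgue_rV R d).-integrable setT (fun x => (f (cons_rV (x, t)))%:E)) /\
  \int[lebesgue_rV R d.+1]_x (f x)%:E =
  \int[leb]_t \int[lebesgue_rV R d]_x (f (cons_rV (x, t)))%:E.
Proof.
move=> fi; have fi' := integrable_cons_rV fi.
have mc : measurable_fun setT (@cons_rV R d) by exact: measurable_cons_rV.
have mf : measurable_fun setT (EFin \o f) by case/integrableP: fi.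
split.
  exact: (@ae_integrable2 _ _ _ _ _ (@leb_rV R d) leb _ fi').
have := integral_pushforward (mu := (lebesgue_rV R d \x leb)) mc mf.
rewrite /= /image_measure => -> //.
rewrite preimage_setT.
by have := @integral21_prod_meas1 _ _ _ _ _ (@leb_rV R d) leb _ fi' => <-.
Qed.

(** Induction on d: Fubini splits off the first coordinate, as the inner variable if
    it is the given direction, and as the outer variable otherwise. *)
Lemma integral_lines_eq0 d (i : 'I_d) (F : 'rV[R]_d -> R) :
  (lebesgue_rV R d).-integrable setT (EFin \o F) ->
  (forall x, \int[leb]_r (F (x + r *: delta_mx ord0 i)%R)%:E = 0) ->
  \int[lebesgue_rV R d]_x (F x)%:E = 0.
Proof.
elim: d i F => [[]//|d IH] i F iF F0.
have [j|] := unliftP ord0 i => ij; last first.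
  rewrite integral_lebesgue_rVS//; apply: integral0_eq => x _.
  rewrite -[RHS](F0 (cons_rV (x, 0%R))) ij; apply: eq_integral => t _.
  by rewrite cons_rV_line0 add0r.
have [hD ->] := integral_lebesgue_rVS21 iF.
apply: (@etrans _ _ (\int[leb]_t 0%E)); last exact: integral0.
apply: ae_eq_integral => //.
  exact: (@measurable_fubini_G _ _ _ _ _ (@leb_rV R d) leb _ (integrable_cons_rV iF)).
apply: filterS hD => t iFt _.
apply: (IH j _ iFt) => x; rewrite -[RHS](F0 (cons_rV (x, t))) ij.
by apply: eq_integral => r _; rewrite cons_rV_lineS.
Qed.

End continuous_compact_support.

Section polynomial_weak_derivatives.
Context {R : realType} {d : nat}.
Local Notation leb := (@lebesgue_measure R).
Local Notation gauss := (gauss_measure R d).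
Local Notation mindex := {ffun 'I_d -> nat}.
Local Notation dl i := (delta_mx ord0 i : 'rV[R]_d).
Implicit Types (u v F G : 'rV[R]_d -> R) (i : 'I_d).

(** On every line the integrand is the derivative of a function with compact
    support. *)
Lemma integral_partial_eq0 i F G N : continuous F -> continuous G ->
  (forall x, ~ box_rV N x -> F x = 0) -> (forall x, ~ box_rV N x -> G x = 0) ->
  (forall x, is_derive x (dl i) F (G x)) ->
  (\int[lebesgue_rV R d]_x (G x)%:E = 0)%E.
Proof.
move=> cF cG F0 G0 dF.
have [C C0 hC] := continuous_box_bounded cG G0.
have mG := continuous_measurable_rV cG.
have cline x : continuous (fun r : R => x + r *: dl i).
  by move=> r; apply: cvgD; [exact: cvg_cst|exact: scalel_continuous].
have outside (x : 'rV[R]_d) (r : R) : N%:R + `|x ord0 i| < `|r| -> ~ box_rV N (x + r *: dl i).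
  move=> rN /(_ i); rewrite !mxE !eqxx mulr1 leNgt => /negP; apply.
  rewrite -(ltrD2r `|x ord0 i|) (lt_le_trans rN)//.
  by have := ler_normB (x ord0 i + r) (x ord0 i); rewrite addrAC subrr add0r.
apply: (integral_lines_eq0 (i := i)); first exact: integrable_box mG hC G0.
move=> x; set g := fun r : R => G (x + r *: dl i).
have cg : continuous g by move=> r; apply: continuous_comp; [exact: cline|exact: cG].
pose M : R := N%:R + `|x ord0 i|.
have ig : leb.-integrable setT (EFin \o g).
  have iC : leb.-integrable setT (fun r => (C * (\1_(`[- M, M]%classic) r))%:E).
    under eq_fun do rewrite EFinM.
    apply: integrableZl => //; apply/integrableP; split.
      by apply/measurable_EFinP; apply: measurable_indic; exact: measurable_itv.
    under eq_integral => r _ do rewrite gee0_abs ?lee_fin//.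
    have mI : measurable (`[- M, M]%classic : set (measurableTypeR R)) by exact: measurable_itv.
    have := integral_indic leb measurableT mI; rewrite setIT => ->.
    have := @lebesgue_measure_itv R `[- M, M]; rewrite /= => ->.
    by case: ifP; rewrite ?ltry.
  apply: (le_integrable measurableT _ _ iC).
    by apply/measurable_EFinP; exact: continuous_measurable_fun.
  move=> r _ /=; rewrite lee_fin indicE; have [bx|bx] := boolP (r \in _).
    by rewrite mulr1 (le_trans (hC _))// ler_norm.
  rewrite /g G0 ?normr0//; apply: outside; rewrite ltNge; apply/negP => h.
  by move/negP: bx; apply; apply/mem_set; rewrite /= in_itv/= -ler_norml.
have dg (r : R) : is_derive r (1 : R) (fun r => F (x + r *: dl i)) (g r).
  have [ex val] := dF (x + r *: dl i).
  have C1 : (fun h : R => h^-1 *: (((fun r => F (x + r *: dl i)) \o shift r) (h *: (1 : R))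
      - F (x + r *: dl i))) @ 0^' --> g r.
    rewrite /g -val (_ : (fun h => _) = (fun h : R => h^-1 *: ((F \o shift (x + r *: dl i))
      (h *: dl i) - F (x + r *: dl i)))); first exact: ex.
    apply/funext => h /=; congr (_ *: (F _ - _)).
    by rewrite [h *: 1]mulr1 scalerDl addrCA.
  by apply: DeriveDef; [apply/cvg_ex; eexists; exact: C1|apply/cvg_lim].
have -> : (\int[leb]_r (g r)%:E = (\int[leb]_r g r)%:E)%E.
  by rewrite /Rintegral fineK//; exact: integrable_fin_num ig.
congr EFin; apply: (integral_derivative_eq0 dg cg ig).
- apply: cvg_near_cst; near=> n; apply: F0; apply: outside.
  by rewrite [ltRHS]ger0_norm//; near: n; exact: nbhs_infty_gtr.
- apply: cvg_near_cst; near=> n; apply: F0; apply: outside.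
  by rewrite normrN [ltRHS]ger0_norm//; near: n; exact: nbhs_infty_gtr.
Unshelve. all: by end_near. Qed.

Lemma partial_eq0 u N i : (forall x, ~ box_rV N x -> u x = 0) ->
  forall x, ~ box_rV N x -> partial i u x = 0.
Proof.
move=> u0 x xN; have ob : open (~` @box_rV R d N).
  apply: closed_openC; apply: compact_closed; first exact: norm_hausdorff.
  exact: compact_box.
have nx : \forall y \near x, u y = 0.
  by near=> y; apply: u0; near: y; exact: open_nbhs_nbhs.
rewrite /partial /derive; apply/cvg_lim => //; apply: cvg_near_cst.
have cl : (fun h : R => h *: dl i + x) @ 0 --> x.
  rewrite -[X in _ --> X]add0r -(scale0r (dl i)).
  by apply: cvgD; [exact: scalel_continuous|exact: cvg_cst].
have nh : \forall h \near (0:R), u (h *: dl i + x) = 0 by exact: (cl _ nx).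
have nh' : \forall h \near (0:R)^', u (h *: dl i + x) = 0 by exact: (@nbhs_dnbhs R 0).
by apply: filterS nh' => h /= ->; rewrite u0// subrr scaler0.
Unshelve. all: by end_near. Qed.

Lemma foldr_partial_eq0 u N s : (forall x, ~ box_rV N x -> u x = 0) ->
  forall x, ~ box_rV N x -> foldr (@partial R d) u s x = 0.
Proof. by move=> u0; elim: s => //= i s IH; exact: partial_eq0. Qed.

Lemma Rintegral_box_D F G N : continuous F -> continuous G ->
  (forall x, ~ box_rV N x -> F x = 0) -> (forall x, ~ box_rV N x -> G x = 0) ->
  \int[lebesgue_rV R d]_x (F x + G x) =
  \int[lebesgue_rV R d]_x F x + \int[lebesgue_rV R d]_x G x.
Proof.
by move=> cF cG F0 G0; rewrite RintegralD//; exact: (integrable_continuous_box (N := N)).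
Qed.

Lemma integral_partial_by_parts w c i v N : (forall i, dseq (w i)) ->
  continuous v -> continuous (partial i v) ->
  (forall x, derivable v x (dl i)) -> (forall x, ~ box_rV N x -> v x = 0) ->
  \int[lebesgue_rV R d]_x (tens w c x * partial i v x) =
  - \int[lebesgue_rV R d]_x (tens w (fun j => c j + (j == i))%N x * v x).
Proof.
move=> dw cv cpv dv v0; have pv0 := partial_eq0 i v0.
have ct c' : continuous (tens w c') by exact: continuous_tens.
apply/eqP; rewrite -addr_eq0 -(@Rintegral_box_D _ _ N); first last.
- by move=> x /v0 ->; rewrite mulr0.
- by move=> x /pv0 ->; rewrite mulr0.
- exact: continuousM_rV.
- exact: continuousM_rV.
have dF x : is_derive x (dl i) (fun x => tens w c x * v x)
    (tens w c x * partial i v x + tens w (fun j => c j + (j == i))%N x * v x).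
  have h1 := is_derive_tens c i x dw.
  have h2 : is_derive x (dl i) v (partial i v x) by split => //.
  have := is_deriveM h1 h2; rewrite /GRing.scale/= => h3.
  by rewrite [X in is_derive _ _ _ (_ + X)]mulrC.
apply/eqP; rewrite /Rintegral (integral_partial_eq0 (N := N) _ _ _ _ dF)//.
- exact: continuousM_rV.
- by move=> x; apply: (@continuousD _ _ 'rV[R]_d); exact: continuousM_rV.
- by move=> x /v0 ->; rewrite mulr0.
- by move=> x nx; rewrite v0// pv0// !mulr0 addr0.
Qed.

Lemma integral_foldr_partial w c u s : (forall i, dseq (w i)) -> test_function u ->
  \int[lebesgue_rV R d]_x (tens w c x * foldr (@partial R d) u s x) =
  (-1) ^+ size s *
    \int[lebesgue_rV R d]_x (tens w (fun j => c j + count_mem j s)%N x * u x).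
Proof.
move=> dw [su [K cK u0]]; have [N KN] := compact_sub_box cK.
have u0' x : ~ box_rV N x -> u x = 0 by move=> nx; apply: u0 => /KN.
elim: s c => [|i s IH] c.
  rewrite expr0 mul1r; congr (Rintegral _ _ _); apply/funext => x; congr (tens _ _ _ * _).
  by apply/funext => j; rewrite addn0.
have [[c1 d1] [c2 _]] := (su s, su (i :: s)).
rewrite /= (@integral_partial_by_parts _ _ _ _ N)//; last exact: foldr_partial_eq0.
rewrite IH exprS mulN1r mulNr; congr (- (_ * _)).
apply: eq_Rintegral => x _; congr (tens _ _ _ * _).
by apply/funext => j; rewrite -addnA (eq_sym j).
Qed.

Lemma mpartial_foldr (a : mindex) u : mpartial a u =
  foldr (@partial R d) u (flatten [seq nseq (a i) i | i <- enum 'I_d]).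
Proof.
rewrite /mpartial; elim: (enum _) => //= i s ->; rewrite foldr_cat.
by elim: (a i) => //= n ->.
Qed.

Lemma integral_mpartial w c u (a : mindex) : (forall i, dseq (w i)) -> test_function u ->
  \int[lebesgue_rV R d]_x (tens w c x * mpartial a u x) =
  (-1) ^+ mabs a *
    \int[lebesgue_rV R d]_x (tens w (fun j => c j + a j)%N x * u x).
Proof.
move=> dw tu; rewrite mpartial_foldr integral_foldr_partial//.
have -> : size (flatten [seq nseq (a i) i | i <- enum 'I_d]) = mabs a.
  rewrite size_flatten /shape -map_comp /mabs sumnE big_map big_enum/=.
  by apply: eq_bigr => i _; rewrite size_nseq.
congr (_ * _); apply: eq_Rintegral => x _; congr (tens _ _ _ * _).
apply/funext => j; congr (_ + _)%N.
rewrite count_flatten -map_comp sumnE big_map big_enum/=.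
rewrite (bigD1 j)//= count_nseq/= eqxx mul1n big1 ?addn0// => i /negbTE ij.
by rewrite count_nseq/= ij mul0n.
Qed.

Definition poly_deriv_seq (p : 'I_d -> {poly R}) : 'I_d -> nat -> R -> R :=
  fun i n t => ((p i)^`(n)).[t].

Lemma dseq_poly_deriv p i : dseq (poly_deriv_seq p i).
Proof. by move=> n t; rewrite /poly_deriv_seq derivnS; exact: is_derive_poly. Qed.

(** The Gauss density is positive, so that a Lebesgue integral is the Gauss integral
    of a rescaled integrand and does not depend on the representative either. *)
Lemma ae_eq_Rintegral_lebesgue (F G v : 'rV[R]_d -> R) : F = G %[ae gauss] ->
  measurable_fun setT F -> measurable_fun setT G -> measurable_fun setT v ->
  \int[lebesgue_rV R d]_x (F x * v x) = \int[lebesgue_rV R d]_x (G x * v x).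
Proof.
move=> FG mF mG mv; pose h x := v x / gauss_density x.
have mh : measurable_fun setT h.
  apply: measurable_funM => //; apply: (measurableT_comp measurable_invr).
  exact: measurable_gauss_density.
have E (H : 'rV[R]_d -> R) : measurable_fun setT H ->
    \int[lebesgue_rV R d]_x (H x * v x) = \int[gauss]_x (H x * h x).
  move=> mH; rewrite /Rintegral integral_gauss; last exact: measurable_funM.
  congr fine; apply: eq_integral => x _; rewrite -mulrA divfK//.
  by rewrite mulf_neq0 ?gt_eqF ?expR_gt0// powR_gt0// mulr_gt0// pi_gt0.
rewrite !E//; apply: ae_eq_Rintegral; [|exact: measurable_funM|exact: measurable_funM].
by apply: filterS FG => x /= FGx _; rewrite FGx.
Qed.

Lemma integral_polysum s v N : continuous v -> (forall x, ~ box_rV N x -> v x = 0) ->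
  \int[lebesgue_rV R d]_x (polysum s x * v x) =
  \sum_(q <- s) q.1 * \int[lebesgue_rV R d]_x (tpoly q.2 x * v x).
Proof.
move=> cv v0.
have ct p : continuous (tpoly p : 'rV[R]_d -> R).
  by have := @continuous_tens R d (poly_deriv_seq p) (fun=> 0%N) (dseq_poly_deriv p).
have cs r : continuous (polysum r : 'rV[R]_d -> R).
  elim: r => [|q r IH].
    by rewrite /polysum; under eq_fun do rewrite big_nil; exact: cst_continuous.
  rewrite /polysum; under eq_fun do rewrite big_cons.
  move=> x; apply: (@continuousD R R 'rV[R]_d (fun x => q.1 * tpoly q.2 x)); last exact: IH.
  by apply: (continuousM_rV (F := fun=> q.1)); [exact: cst_continuous|exact: ct].
elim: s => [|q s IH].
  rewrite big_nil; under eq_Rintegral do rewrite /polysum big_nil mul0r.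
  by rewrite /Rintegral integral0.
rewrite big_cons -IH -RintegralZl//; last first.
  have cF := continuousM_rV (ct q.2) cv.
  by apply: (integrable_continuous_box (N := N) cF) => x /v0 ->; rewrite mulr0.
rewrite -(@Rintegral_box_D _ _ N).
- by apply: eq_Rintegral => x _; rewrite /polysum big_cons mulrDl mulrA.
- by apply: (continuousM_rV (F := fun=> q.1)); [exact: cst_continuous|exact: continuousM_rV].
- exact: continuousM_rV.
- by move=> x /v0 ->; rewrite !mulr0.
- by move=> x /v0 ->; rewrite mulr0.
Qed.

(** Integration by parts moves the derivatives from u to each of the products. *)
Lemma polysum_weak_derivative (a : mindex) s (f g : L2 R d) :
  Lspace_fun f = polysum s %[ae gauss] ->
  Lspace_fun g = polysum [seq (q.1, fun i => (q.2 i)^`(a i)) | q <- s] %[ae gauss] ->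
  is_weak_derivative a f g.
Proof.
move=> fs gs u tu; have [su [K cK u0]] := tu; have [N KN] := compact_sub_box cK.
have u0' x : ~ box_rV N x -> u x = 0 by move=> nx; apply: u0 => /KN.
have cu : continuous u by have [] := su [::].
have cmu : continuous (mpartial a u) 
  by rewrite mpartial_foldr; case: (su (flatten [seq nseq (a i) i | i <- enum 'I_d])).
have mu0 x : ~ box_rV N x -> mpartial a u x = 0.
  by rewrite mpartial_foldr; exact: foldr_partial_eq0.
rewrite (ae_eq_Rintegral_lebesgue fs); [|exact: measurable_L2|exact: measurable_polysum
  |exact: continuous_measurable_rV].
rewrite (ae_eq_Rintegral_lebesgue gs); [|exact: measurable_L2|exact: measurable_polysum
  |exact: continuous_measurable_rV].
rewrite !(@integral_polysum _ _ N)// big_map mulr_sumr.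
apply: eq_bigr => q _ /=.
have := @integral_mpartial (poly_deriv_seq q.2) (fun=> 0%N) u a (dseq_poly_deriv q.2) tu.
by rewrite mulrCA => <-.
Qed.

(** The derivative is again a polynomial, hence a finite Hermite expansion; in this
    form its fractional energy is explicit. *)
Lemma hcomb_weak_derivative m (c : mindex -> R) a : exists m' c',
  is_weak_derivative a (hcomb (midx d m) c) (hcomb (midx d m') c').
Proof.
pose s := [seq (c k * (Num.sqrt (mfact k)%:R)^-1, fun i => He (k i) : {poly R}) | k <- midx d m].
have fs : Lspace_fun (hcomb (midx d m) c) = polysum s %[ae gauss].
  apply: filterS (Lspace_fun_hcomb (midx d m) c) => x /= + _ => ->//.
  by rewrite /polysum /s [RHS]big_map; apply: eq_bigr => k _; rewrite mhermiteE/= mulrA.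
have [m' /(_ m' (leqnn _))[c' Ec']] :=
  polysum_hfun [seq (q.1, fun i => (q.2 i)^`(a i)) | q <- s].
exists m', c'; apply: polysum_weak_derivative fs _; rewrite Ec'.
exact: Lspace_fun_hcomb.
Qed.

End polynomial_weak_derivatives.

(** * The integral that produces fractional powers *)

Section fractional_power_integral.
Context {R : realType}.
Local Notation leb := (@lebesgue_measure R).
Variables (th : R).
Hypotheses (th0 : 0 < th) (th1 : th < 1).

Lemma measurable_powR_r (e : R) : measurable_fun setT (fun t : R => t `^ e).
Proof. exact: measurable_powR. Qed.

Lemma powR_antiderivative (e t : R) : e + 1 != 0 -> 0 < t ->
  is_derive t (1 : R) (fun t => (e + 1)^-1 * t `^ (e + 1)) (t `^ e).
Proof.
move=> e0 t0; have h := is_derive1_powR (e + 1) t0.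
have -> : t `^ e = (e + 1)^-1 *: ((e + 1) * t `^ (e + 1 - 1)) :> R.
  by rewrite /GRing.scale/= mulKf// addrK.
exact: is_deriveZ.
Qed.

Lemma powR_antiderivative_continuous (e t : R) : e + 1 != 0 -> 0 < t ->
  {for t, continuous (fun t : R => (e + 1)^-1 * t `^ (e + 1))}.
Proof.
move=> e0 /(powR_antiderivative e0)[h _].
by apply: differentiable_continuous; exact/derivable1_diffP.
Qed.

Lemma continuous_within_powR (i : interval R) (e : R) :
  (forall t, t \in i -> 0 < t) -> {within [set` i], continuous (fun t : R => t `^ e)}.
Proof.
move=> i0; apply: derivable_within_continuous => t /i0 t0.
by have [] := is_derive1_powR e t0.
Qed.

Lemma integral_powR (e a b : R) : 0 < a -> a < b -> e + 1 != 0 ->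
  (\int[leb]_(t in `[a, b]) (t `^ e)%:E)%E =
  ((e + 1)^-1 * (b `^ (e + 1) - a `^ (e + 1)))%:E.
Proof.
move=> a0 ab e0; have d (t : R) (t0 : 0 < t) := powR_antiderivative e0 t0.
have c (t : R) (t0 : 0 < t) := powR_antiderivative_continuous e0 t0.
rewrite (continuous_FTC2 (F := fun t => (e + 1)^-1 * t `^ (e + 1)) ab).
- by rewrite -EFinB mulrBr.
- apply: continuous_within_powR => t; rewrite in_itv/= => /andP[h _].
  exact: lt_le_trans h.
- split.
  + by move=> t; rewrite in_itv/= => /andP[h _]; case: (d t (lt_trans a0 h)).
  + by apply: cvg_at_right_filter; exact: c.
  + by apply: cvg_at_left_filter; apply: c; exact: lt_trans ab.
- move=> t; rewrite in_itv/= => /andP[h _]; rewrite derive1E.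
  by apply: derive_val; exact: d (lt_trans a0 h).
Qed.

(** The singularity at 0 is approached by the intervals [c / (n + 2), c], which are
    never degenerate. *)
Lemma integral_powR_near0 (c : R) : 0 < c ->
  (\int[leb]_(t in `]0%R, c]) (t `^ (- th))%:E <= (c `^ (1 - th) / (1 - th))%:E)%E.
Proof.
move=> c0; have th10 : 0 < 1 - th by rewrite subr_gt0.
pose F n := `[c / n.+2%:R, c]%classic : set R.
have FU : \bigcup_n F n = `]0%R, c]%classic.
  apply/seteqP; split => [t [n _]|t]; rewrite /F/= !in_itv/= => /andP[h1 h2].
    by rewrite h2 andbT (lt_le_trans _ h1)// divr_gt0.
  exists (Num.truncn (c / t)) => //; rewrite /F/= in_itv/= h2 andbT.
  rewrite ler_pdivrMr// mulrC -ler_pdivrMr// ltW// (lt_trans (truncnS_gt _))//.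
  by rewrite ltr_nat.
rewrite -FU; have mF n : measurable (F n) by exact: measurable_itv.
have Fn : {homo F : n m / (n <= m)%N >-> (n <= m)%O}.
  move=> n m nm; apply/subsetPset => t; rewrite /F /= !in_itv/= => /andP[h1 ->].
  rewrite andbT (le_trans _ h1)// ler_pM2l// lef_pV2 ?posrE//.
  by rewrite ler_nat !ltnS.
have mf n : measurable_fun (F n) (fun t : R => (t `^ (- th))%:E).
  by apply/measurable_EFinP; apply: measurable_funTS; exact: measurable_powR_r.
have f0 (n : nat) t : F n t -> (0 <= (t `^ (- th))%:E)%E.
  by rewrite lee_fin powR_ge0.
have h := ge0_nondecreasing_set_cvg_integral Fn mF mf f0 (mu := leb).
rewrite -(cvg_lim _ h)//; apply: lime_le; first by apply/cvg_ex; eexists; exact: h.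
apply: nearW => n; rewrite /F integral_powR ?divr_gt0//.
- rewrite addrC lee_fin mulrC ler_wpM2r ?invr_ge0 ?(ltW th10)//.
  by rewrite lerBlDr lerDl powR_ge0.
- by rewrite ltr_pdivrMr// ltr_pMr// ltr1n.
- by rewrite addrC gt_eqF.
Qed.

Lemma cvg_powR_pinfty (e : R) : e < 0 -> (t : R) `^ e @[t --> +oo] --> (0 : R).
Proof.
move=> e0; apply/cvgrPdist_lt => eps eps0; near=> t.
have t0 : 0 < t by near: t; exact: nbhs_pinfty_gt.
rewrite sub0r normrN ger0_norm ?powR_ge0//.
have -> : eps = (eps `^ e^-1) `^ e.
  by rewrite -powRrM mulVf ?lt_eqF// powRr1// ltW.
rewrite -[e]opprK !(powRN _ (- e)) ltf_pV2 ?posrE ?powR_gt0//.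
rewrite gt0_ltr_powR ?oppr_gt0// ?nnegrE ?powR_ge0 ?(ltW t0)//.
Unshelve. all: by end_near. Qed.

Lemma integral_powR_pinfty (c : R) : 0 < c ->
  (\int[leb]_(t in `[c, +oo[) (t `^ (- th - 1))%:E = (c `^ (- th) / th)%:E)%E.
Proof.
move=> c0; have e0 : - th - 1 + 1 != 0 by rewrite subrK oppr_eq0 gt_eqF.
have d (t : R) (t0 : 0 < t) := powR_antiderivative e0 t0.
rewrite (ge0_continuous_FTC2y (F := fun t => (- th - 1 + 1)^-1 * t `^ (- th - 1 + 1)) (l := 0)).
- by rewrite subrK sub0e invrN mulNr EFinN oppeK mulrC.
- by move=> x _; exact: powR_ge0.
- apply: continuous_within_powR => t; rewrite in_itv/= andbT => h.
  exact: lt_le_trans h.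
- rewrite -(mulr0 (- th - 1 + 1)^-1); apply: cvgM; first exact: cvg_cst.
  by apply: cvg_powR_pinfty; rewrite subrK oppr_lt0.
- by move=> x cx; case: (d x (lt_trans c0 cx)).
- by apply: cvg_at_right_filter; exact: (powR_antiderivative_continuous e0 c0).
- move=> t; rewrite in_itv/= andbT => h; rewrite derive1E.
  by apply: derive_val; exact: d (lt_trans c0 h).
Qed.

Definition frac_integral (k : nat) : \bar R :=
  (\int[leb]_(t in `]0%R, +oo[) (((1 - expR (- t) ^+ k) * t `^ (- th - 1))%:E))%E.

Let fr k (t : R) := (1 - expR (- t) ^+ k) * t `^ (- th - 1).

Let mfr k (D : set R) : measurable_fun D (fun t => (fr k t)%:E).
Proof.
apply/measurable_EFinP; apply: measurable_funTS; apply: measurable_funM; last exact: measurable_powR_r.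
apply: measurable_funB => //; apply: measurable_funX; exact: measurableT_comp.
Qed.

Let fr_ge0 k t : 0 <= t -> 0 <= fr k t.
Proof.
move=> t0; rewrite mulr_ge0 ?powR_ge0// subr_ge0 exprn_ile1 ?expR_ge0//.
by rewrite -expR0 ler_expR oppr_le0.
Qed.

Lemma frac_integral0 : frac_integral 0 = 0%E.
Proof.
by rewrite /frac_integral; apply: integral0_eq => t _; rewrite expr0 subrr mul0r.
Qed.

(** Split at t = 1/k, using 1 - e^(-kt) <= min(kt, 1). *)
Lemma frac_integral_le : exists2 C : R, 0 < C &
  forall k, (frac_integral k <= (C * k%:R `^ th)%:E)%E.
Proof.
have th10 : 0 < 1 - th by rewrite subr_gt0.
exists ((1 - th)^-1 + th^-1) => [|[|k]]; first by rewrite addr_gt0 ?invr_gt0.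
  by rewrite frac_integral0 lee_fin mulr_ge0 ?powR_ge0// addr_ge0 ?invr_ge0// ltW.
set K := k.+1; have K0 : (0 : R) < K%:R by rewrite ltr0n.
pose c : R := K%:R^-1; have c0 : 0 < c by rewrite invr_gt0.
have cth : c `^ (- th) = K%:R `^ th.
  by rewrite /c -powR_inv1 ?ler0n// -powRrM mulN1r opprK.
have -> : frac_integral K = (\int[leb]_(t in `]0%R, +oo[) (fr K t)%:E)%E by [].
have -> : `]0%R, +oo[%classic = `]0%R, c]%classic `|` `]c, +oo[%classic.
  apply/seteqP; split => t /=; rewrite !in_itv/= !andbT.
    by move=> t0; case: (leP t c) => h; [left; rewrite t0|right].
  by move=> [/andP[]//|]; exact: lt_trans.
rewrite ge0_integral_setU//=; last 3 first.
- exact: mfr.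
- by move=> t /= [|]; rewrite in_itv/= ?andbT => h; rewrite lee_fin fr_ge0// ltW//;
    [case/andP: h|exact: lt_trans h].
- apply/disj_setPLR => t /=; rewrite !in_itv/= andbT => /andP[_ tc] ct.
  by move: (lt_le_trans ct tc); rewrite ltxx.
rewrite mulrDl EFinD leeD//.
- apply: (@le_trans _ _ (\int[leb]_(t in `]0%R, c]) (K%:R%:E * (t `^ (- th))%:E))%E).
    apply: ge0_le_integral => //.
    + by move=> t /=; rewrite in_itv/= => /andP[/ltW h _]; rewrite lee_fin fr_ge0.
    + exact: mfr.
    + apply: measurable_funeM; apply/measurable_EFinP.
      by apply: measurable_funTS; exact: measurable_powR_r.
    + move=> t /=; rewrite in_itv/= => /andP[t0 _]; rewrite -EFinM lee_fin /fr.
      have -> : t `^ (- th) = t * t `^ (- th - 1).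
        by rewrite -{2}(powRr1 (ltW t0)) -powRD ?(gt_eqF t0) ?implybT//; congr (_ `^ _); ring.
      rewrite mulrA ler_wpM2r ?powR_ge0// lerBlDr -lerBlDl.
      rewrite -expRM_natl (le_trans _ (expR_ge1Dx _))//.
      by rewrite mulrN lerD2l.
  rewrite ge0_integralZl//; last 2 first.
  - apply/measurable_EFinP; apply: measurable_funTS; exact: measurable_powR_r.
  - by move=> t _; rewrite lee_fin powR_ge0.
  rewrite (le_trans (lee_wpmul2l _ (integral_powR_near0 c0)))//.
  rewrite -EFinM lee_fin mulrA [leRHS]mulrC ler_wpM2r ?invr_ge0 ?(ltW th10)//.
  rewrite powRD ?(gt_eqF c0) ?implybT// powRr1 ?(ltW c0)// cth mulrA.
  by rewrite /c divff ?mul1r// gt_eqF.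
- apply: (@le_trans _ _ (\int[leb]_(t in `[c, +oo[) (t `^ (- th - 1))%:E)%E).
    apply: (@le_trans _ _ (\int[leb]_(t in `]c, +oo[) (t `^ (- th - 1))%:E)%E).
      apply: ge0_le_integral => //.
      + move=> t /=; rewrite in_itv/= andbT => h.
        by rewrite lee_fin fr_ge0// ltW// (lt_trans c0).
      + exact: mfr.
      + apply/measurable_EFinP; apply: measurable_funTS; exact: measurable_powR_r.
      + move=> t _; rewrite lee_fin /fr ler_piMl ?powR_ge0// gerBl exprn_ge0// expR_ge0.
    apply: ge0_subset_integral => //.
    + apply/measurable_EFinP; apply: measurable_funTS; exact: measurable_powR_r.
    + by move=> t _; rewrite lee_fin powR_ge0.
    + by move=> t /=; rewrite !in_itv/= !andbT => /ltW.
  by rewrite integral_powR_pinfty// cth mulrC.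
Qed.

(** On [1/k, 2/k] the factor 1 - e^(-kt) is at least 1/2. *)
Lemma frac_integral_ge : exists2 c : R, 0 < c &
  forall k, ((c * k%:R `^ th)%:E <= frac_integral k)%E.
Proof.
exists (2^-1 * 2 `^ (- th - 1)) => [|[|k]]; first by rewrite mulr_gt0 ?invr_gt0// powR_gt0.
  by rewrite frac_integral0 powR0 ?mulr0// gt_eqF.
set K := k.+1; have K0 : (0 : R) < K%:R by rewrite ltr0n.
pose c : R := K%:R^-1; have c0 : 0 < c by rewrite invr_gt0.
have c02 : c < 2 * c by rewrite ltr_pMl// ltr1n.
have -> : frac_integral K = (\int[leb]_(t in `]0%R, +oo[) (fr K t)%:E)%E by [].
apply: (@le_trans _ _ (\int[leb]_(t in `[c, (2 * c)%R]) (fr K t)%:E)%E); last first.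
  apply: ge0_subset_integral => //.
  + exact: mfr.
  + by move=> t /=; rewrite in_itv/= andbT => /ltW h; rewrite lee_fin fr_ge0.
  + move=> t /=; rewrite !in_itv/= andbT => /andP[h _]; exact: lt_le_trans h.
apply: (@le_trans _ _ (\int[leb]_(t in `[c, (2 * c)%R]) (2^-1 * (2 * c) `^ (- th - 1))%:E)%E).
  rewrite integral_cst//= lebesgue_measure_itv/= lte_fin c02 -EFinB -EFinM lee_fin.
  rewrite powRM// ?(ltW c0)// -!mulrA !ler_wpM2l ?invr_ge0 ?powR_ge0//.
  have -> : 2 * c - c = c by ring.
  rewrite -{2}(powRr1 (ltW c0)) -powRD ?(gt_eqF c0) ?implybT// subrK.
  by rewrite /c -powR_inv1 ?ler0n// -powRrM mulN1r opprK.
apply: ge0_le_integral => //.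
- by move=> t _; rewrite lee_fin mulr_ge0 ?powR_ge0.
- exact: mfr.
- move=> t /=; rewrite in_itv/= => /andP[h1 h2]; rewrite lee_fin /fr.
  have t0 : 0 < t by exact: lt_le_trans h1.
  apply: ler_pM; rewrite ?powR_ge0//.
    rewrite lerBrDr -lerBrDl -expRM_natl.
    have h : 1 <= K%:R * t by rewrite -ler_pdivrMl// mulr1.
    rewrite mulrN expRN -[leRHS]invrK lef_pV2 ?posrE ?expR_gt0 ?invr_gt0 ?subr_gt0//; last lra.
    rewrite (le_trans _ (expR_ge1Dx _))//.
    rewrite (_ : (1 - 2^-1)^-1 = 2 :> R); first lra.
    by field; lra.
  rewrite -[- th - 1]opprK !(powRN _ (- (- th - 1))) lef_pV2 ?posrE ?powR_gt0 ?mulr_gt0//.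
  have e0 : 0 <= - (- th - 1) by rewrite opprB opprK addr_ge0// ltW.
  by apply: ge0_ler_powR; rewrite ?nnegrE ?(ltW t0)// mulr_ge0// ltW.
Qed.

End fractional_power_integral.

(** * The Mehler kernel *)

Section mehler_kernel.
Context {R : realType} {d : nat}.
Local Notation leb := (@lebesgue_measure R).
Local Notation gauss := (gauss_measure R d).
Local Notation rV := ('rV[R]_d).
Local Notation mindex := {ffun 'I_d -> nat}.
Implicit Types (x y : rV) (k : mindex).

Lemma dot_rVC x y : dot_rV x y = dot_rV y x.
Proof. by apply: eq_bigr => i _; rewrite mulrC. Qed.

Lemma mehlerC t x y : mehler t x y = mehler t y x.
Proof.
rewrite /mehler (dot_rVC x y); have -> // : forall a b c : R, a - b + c = c - b + a.
by move=> a b c; ring.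
Qed.

Lemma mehler_ge0 t x y : 0 <= mehler t x y.
Proof. by rewrite mulr_ge0 ?powR_ge0 ?expR_ge0. Qed.

Lemma expR_sqr_lt1 (t : R) : 0 < t -> expR (- t) ^+ 2 < 1.
Proof.
by move=> t0; rewrite exprn_ilt1 ?expR_ge0//; rewrite -expR0 ltr_expR oppr_lt0.
Qed.

Lemma mehler_dispersion (t : R) : 0 < t ->
  Num.sqrt (1 - expR (- t) ^+ 2) != 0 /\
  Num.sqrt (1 - expR (- t) ^+ 2) ^+ 2 = 1 - expR (- t) ^+ 2.
Proof.
move=> /expR_sqr_lt1 h; split; first by rewrite gt_eqF// sqrtr_gt0 subr_gt0.
by rewrite sqr_sqrtr// subr_ge0 ltW.
Qed.

(** Completing the square. Given x, the coordinates of y are thus independent normal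
    variables, which reduces Mehler's formula to one variable. *)
Lemma mehler_gauss_density t x y : 0 < t -> mehler t x y * gauss_density y =
  \prod_i normal_pdf (expR (- t) * x ord0 i) (Num.sqrt (1 - expR (- t) ^+ 2)) (y ord0 i).
Proof.
move=> t0; have [s0 s2] := mehler_dispersion t0; have r1 := expR_sqr_lt1 t0.
under [RHS]eq_bigr do rewrite normal_pdfE1//.
rewrite big_split/= prodr_const card_ord -expR_sum /mehler /gauss_density.
have -> : expR (- 2 * t) = expR (- t) ^+ 2.
  by rewrite -expRM_natl; congr expR; ring.
move: (expR (- t)) (Num.sqrt _) s0 s2 r1 => r s s0 s2 r1.
have r10 : 0 <= 1 - r ^+ 2 by rewrite subr_ge0 ltW.
have pi0 : 0 <= 2 * pi :> R by rewrite mulr_ge0// pi_ge0.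
rewrite mulrACA -powRM// -expRD; congr (_ * _).
  rewrite /normal_peak s2.
  have -> : (1 - r ^+ 2) * pi *+ 2 = (1 - r ^+ 2) * (2 * pi).
    by rewrite -mulr_natl; ring.
  move: (mulr_ge0 r10 pi0); move: (_ * (2 * pi)) => U U0.
  rewrite -(powR12_sqrt U0) -powRN -powR_mulrn ?powR_ge0// -powRrM.
  by congr (_ `^ _); rewrite mulNr [_^-1 * _]mulrC.
have u0 : 1 - r ^+ 2 != 0 by rewrite subr_eq0 gt_eqF.
congr expR; rewrite s2 -[in RHS](mulr_natl (1 - r ^+ 2) 2).
rewrite -mulr_suml sumrN.
have -> : \sum_i (y ord0 i - r * x ord0 i) ^+ 2 =
    dot_rV y y - 2 * r * dot_rV x y + r ^+ 2 * dot_rV x x.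
  rewrite /dot_rV !mulr_sumr -sumrB -big_split/=.
  by apply: eq_bigr => i _; ring.
by field.
Qed.

Lemma measurable_dot_rV disp (T : measurableType disp) (f g : T -> rV) :
  measurable_fun setT f -> measurable_fun setT g ->
  measurable_fun setT (fun w => dot_rV (f w) (g w)).
Proof.
move=> mf mg; apply: measurable_sum => i; apply: measurable_funM.
  exact: measurableT_comp (measurable_coord i) mf.
exact: measurableT_comp (measurable_coord i) mg.
Qed.

Lemma measurable_mehler disp (T : measurableType disp) (h : T -> R) (f g : T -> rV) :
  measurable_fun setT h -> measurable_fun setT f -> measurable_fun setT g ->
  measurable_fun setT (fun w => mehler (h w) (f w) (g w)).
Proof.
move=> mh mf mg.
have mc (c : R) : measurable_fun setT (fun w => expR (c * h w)).
  by apply: measurableT_comp => //; exact: measurable_funM.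
have mN : measurable_fun setT (fun w => expR (- h w)).
  by apply: measurableT_comp => //; exact: measurableT_comp.
have m1 : measurable_fun setT (fun w => 1 - expR (- 2 * h w)).
  by apply: measurable_funB => //; exact: mc.
apply: measurable_funM.
  apply: (@measurableT_comp _ _ _ _ _ _ (@powR R ^~ (- (d%:R / 2)))) => //.
apply: measurableT_comp => //; apply: measurableT_comp => //.
apply: measurable_funM; last first.
  by apply: (measurableT_comp measurable_invr); exact: measurable_funM.
apply: measurable_funD.
  apply: measurable_funB.
    by apply: measurable_funM; [exact: mc|exact: measurable_dot_rV].
  by apply: measurable_funM; [exact: measurable_funM|exact: measurable_dot_rV].
by apply: measurable_funM; [exact: mc|exact: measurable_dot_rV].
Qed.

Lemma integral_tpoly_mehler t x (p : 'I_d -> {poly R}) : 0 < t ->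
  gauss.-integrable setT (fun y => (tpoly p y * mehler t x y)%:E) /\
  (\int[gauss]_y (tpoly p y * mehler t x y)%:E = (\prod_i normal_mean
     (expR (- t) * x ord0 i) (Num.sqrt (1 - expR (- t) ^+ 2)) (p i))%:E)%E.
Proof.
move=> t0; have [s0 _] := mehler_dispersion t0.
have mm : measurable_fun setT (fun y => tpoly p y * mehler t x y).
  apply: measurable_funM; first by case: (subgaussian_tpoly p).
  by apply: measurable_mehler => //; exact: measurable_cst.
have := integral_prod_coord (g := fun i u => (p i).[u] *
  normal_pdf (expR (- t) * x ord0 i) (Num.sqrt (1 - expR (- t) ^+ 2)) u).
case=> [i|ig int]; first exact: integrable_poly_normal.
have E y : \prod_i ((p i).[y ord0 i] * normal_pdf (expR (- t) * x ord0 i)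
    (Num.sqrt (1 - expR (- t) ^+ 2)) (y ord0 i)) =
    tpoly p y * mehler t x y * gauss_density y.
  by rewrite big_split/= -mehler_gauss_density// mulrA.
split; first by apply/integrable_gauss => //; under eq_fun do rewrite -E.
by rewrite integral_gauss//; under eq_integral do rewrite -E.
Qed.

Lemma integral_mehler t x : 0 < t -> (\int[gauss]_y (mehler t x y)%:E = 1)%E.
Proof.
move=> t0; have [s0 _] := mehler_dispersion t0.
have [_] := integral_tpoly_mehler x (fun=> 1) t0.
rewrite big1 => [<-|i _]; last exact: normal_mean1.
apply: eq_integral => y _; rewrite /tpoly big1 ?mul1r// => i _.
by rewrite -(hornerC 1 (y ord0 i)).
Qed.

(** Mehler's formula, from [normal_mean_mehler] in each coordinate. *)
Lemma integral_mhermite_mehler t x k : 0 < t ->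
  gauss.-integrable setT (fun y => (mhermite k y * mehler t x y)%:E) /\
  (\int[gauss]_y (mhermite k y * mehler t x y)%:E =
   (expR (- t) ^+ mabs k * mhermite k x)%:E)%E.
Proof.
move=> t0; have [s0 s2] := mehler_dispersion t0.
have [ig int] := integral_tpoly_mehler x (fun i => He (k i) : {poly R}) t0.
have E y : (mhermite k y * mehler t x y)%:E =
    ((Num.sqrt (mfact k)%:R)^-1%:E * (tHe k y * mehler t x y)%:E)%E.
  by rewrite mhermiteE -mulrA EFinM.
split; first by under eq_fun do rewrite E; exact: integrableZl.
under eq_integral do rewrite E.
rewrite integralZl// int -EFinM mhermiteE mulrCA; congr (_ * _)%:E.
rewrite /mabs expr_sum /tHe /tpoly -big_split/=.
by apply: eq_bigr => i _; exact: normal_mean_mehler.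
Qed.

(** A name for the product, to which the structure of a probability measure, hence
    of a sigma-finite one, can be attached. *)
Definition gauss2 : set (rV * rV) -> \bar R := (gauss \x gauss)%E.
HB.instance Definition _ := Measure.on gauss2.

Let gauss2_setT : gauss2 setT = 1%E.
Proof.
rewrite /gauss2 -setXTT product_measure1E//.
by rewrite [X in (X * _)%E]probability_setT [X in (_ * X)%E]probability_setT mule1.
Qed.

HB.instance Definition _ := Measure_isProbability.Build _ _ R gauss2 gauss2_setT.

Variable t : R.
Hypothesis t0 : 0 < t.
Local Notation M := (mehler t).
Local Notation r := (expR (- t)).

Lemma measurable_mehler2 : measurable_fun setT (fun z : rV * rV => M z.1 z.2).
Proof. by apply: measurable_mehler => //; exact: measurable_cst. Qed.

(** Both marginals of the measure with density M_t are the Gauss measure. *)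
Lemma ge0_integral_mehler_fst (u : rV -> R) : measurable_fun setT u ->
  (forall x, 0 <= u x) ->
  (\int[gauss2]_z (u z.1 * M z.1 z.2)%:E = \int[gauss]_x (u x)%:E)%E.
Proof.
move=> mu u0; rewrite (fubini_tonelli1 (m1 := gauss) (m2 := gauss)); last 2 first.
- apply/measurable_EFinP; apply: measurable_funM; last exact: measurable_mehler2.
  exact: measurableT_comp.
- by move=> z; rewrite lee_fin mulr_ge0// mehler_ge0.
apply: eq_integral => x _; rewrite /fubini_F/=.
under eq_integral do rewrite EFinM.
rewrite ge0_integralZl//; last 3 first.
- by apply/measurable_EFinP; apply: measurable_mehler => //; exact: measurable_cst.
- by move=> y _; rewrite lee_fin mehler_ge0.
- by rewrite lee_fin.
by rewrite integral_mehler// mule1.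
Qed.

Lemma ge0_integral_mehler_snd (u : rV -> R) : measurable_fun setT u ->
  (forall x, 0 <= u x) ->
  (\int[gauss2]_z (u z.2 * M z.1 z.2)%:E = \int[gauss]_x (u x)%:E)%E.
Proof.
move=> mu u0; rewrite (fubini_tonelli2 (m1 := gauss) (m2 := gauss)); last 2 first.
- apply/measurable_EFinP; apply: measurable_funM; last exact: measurable_mehler2.
  exact: measurableT_comp.
- by move=> z; rewrite lee_fin mulr_ge0// mehler_ge0.
apply: eq_integral => y _; rewrite /fubini_G/=.
under eq_integral do rewrite EFinM mehlerC.
rewrite ge0_integralZl//; last 3 first.
- by apply/measurable_EFinP; apply: measurable_mehler => //; exact: measurable_cst.
- by move=> x _; rewrite lee_fin mehler_ge0.
- by rewrite lee_fin.
by rewrite integral_mehler// mule1.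
Qed.

Lemma integrable_mehler_sqr (F : rV -> R) : F \in Lfun gauss 2%:E ->
  gauss2.-integrable setT (fun z => (F z.1 ^+ 2 * M z.1 z.2)%:E) /\
  gauss2.-integrable setT (fun z => (F z.2 ^+ 2 * M z.1 z.2)%:E).
Proof.
move=> hF; have mF := Lfun2_measurable hF; have := Lfun2_integrable_sqr hF.
have mF2 : measurable_fun setT (fun x => F x ^+ 2) by exact: measurable_funX.
move=> /integrableP[_].
under eq_integral do rewrite gee0_abs ?lee_fin ?sqr_ge0//.
move=> fin; split; apply/integrableP; split.
- apply/measurable_EFinP; apply: measurable_funM; last exact: measurable_mehler2.
  exact: (measurableT_comp mF2 measurable_fst).
- under eq_integral do rewrite gee0_abs ?lee_fin ?(mulr_ge0 (sqr_ge0 _) (mehler_ge0 _ _ _))//.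
  by rewrite (@ge0_integral_mehler_fst (fun x => F x ^+ 2))// => x; exact: sqr_ge0.
- apply/measurable_EFinP; apply: measurable_funM; last exact: measurable_mehler2.
  exact: (measurableT_comp mF2 measurable_snd).
- under eq_integral do rewrite gee0_abs ?lee_fin ?(mulr_ge0 (sqr_ge0 _) (mehler_ge0 _ _ _))//.
  by rewrite (@ge0_integral_mehler_snd (fun x => F x ^+ 2))// => x; exact: sqr_ge0.
Qed.

Lemma integrable_le_sqr_mehler (h a b : rV * rV -> R) : measurable_fun setT h ->
  (forall z, `|h z| <= a z ^+ 2 + b z ^+ 2) ->
  gauss2.-integrable setT (fun z => (a z ^+ 2 * M z.1 z.2)%:E) ->
  gauss2.-integrable setT (fun z => (b z ^+ 2 * M z.1 z.2)%:E) ->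
  gauss2.-integrable setT (fun z => (h z * M z.1 z.2)%:E).
Proof.
move=> mh hab ia ib; apply: (le_integrable measurableT _ _ (integrableD measurableT ia ib)).
  by apply/measurable_EFinP; apply: measurable_funM => //; exact: measurable_mehler2.
move=> z _ /=; rewrite lee_fin normrM (ger0_norm (mehler_ge0 _ _ _)) -mulrDl normrM.
rewrite (ger0_norm (mehler_ge0 _ _ _)) ler_wpM2r ?mehler_ge0//.
exact: le_trans (ler_norm _).
Qed.

Lemma normrM_le_sqr (a b : R) : `|a * b| <= a ^+ 2 + b ^+ 2.
Proof.
rewrite normrM -(real_normK (num_real a)) -(real_normK (num_real b)).
by have := sqr_ge0 (`|a| - `|b|); have := normr_ge0 a; have := normr_ge0 b; nra.
Qed.

Lemma integrable_mehler_mul (F G : rV -> R) (p q : rV * rV -> rV) :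
  p = fst \/ p = snd -> q = fst \/ q = snd ->
  F \in Lfun gauss 2%:E -> G \in Lfun gauss 2%:E ->
  gauss2.-integrable setT (fun z => (F (p z) * G (q z) * M z.1 z.2)%:E).
Proof.
move=> hp hq hF hG; have mF := Lfun2_measurable hF; have mG := Lfun2_measurable hG.
have mp : measurable_fun setT p by case: hp => ->.
have mq : measurable_fun setT q by case: hq => ->.
apply: (@integrable_le_sqr_mehler _ (F \o p) (G \o q)).
- by apply: measurable_funM; exact: measurableT_comp.
- by move=> z; exact: normrM_le_sqr.
- by have [? ?] := integrable_mehler_sqr hF; case: hp => ->.
- by have [? ?] := integrable_mehler_sqr hG; case: hq => ->.
Qed.

Lemma integral_mehler_diag (F G : rV -> R) :
  F \in Lfun gauss 2%:E -> G \in Lfun gauss 2%:E ->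
  (\int[gauss2]_z (F z.1 * G z.1 * M z.1 z.2)%:E = \int[gauss]_x (F x * G x)%:E)%E /\
  (\int[gauss2]_z (F z.2 * G z.2 * M z.1 z.2)%:E = \int[gauss]_x (F x * G x)%:E)%E.
Proof.
move=> hF hG; have iM x : gauss.-integrable setT (fun y => (M x y)%:E).
  apply/integrableP; split.
    by apply/measurable_EFinP; apply: measurable_mehler => //; exact: measurable_cst.
  by under eq_integral do rewrite gee0_abs ?lee_fin ?mehler_ge0//; rewrite integral_mehler ?ltry.
split.
- have i1 := integrable_mehler_mul (or_introl erefl) (or_introl erefl) hF hG.
  rewrite -(integral12_prod_meas1 (m1 := gauss) (m2 := gauss) i1).
  apply: eq_integral => x _; rewrite /fubini_F/=.
  under eq_integral do rewrite EFinM.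
  by rewrite integralZl// integral_mehler// mule1.
- have i1 := integrable_mehler_mul (or_intror erefl) (or_intror erefl) hF hG.
  rewrite -(integral21_prod_meas1 (m1 := gauss) (m2 := gauss) i1).
  apply: eq_integral => x _; rewrite /fubini_G/=.
  under eq_integral do rewrite EFinM mehlerC.
  by rewrite integralZl// integral_mehler// mule1.
Qed.

Lemma integral_mehler_cross (F : rV -> R) k : F \in Lfun gauss 2%:E ->
  (\int[gauss2]_z (F z.1 * mhermite k z.2 * M z.1 z.2)%:E =
    \int[gauss]_x (r ^+ mabs k * (F x * mhermite k x))%:E)%E /\
  (\int[gauss2]_z (F z.2 * mhermite k z.1 * M z.1 z.2)%:E =
    \int[gauss]_x (r ^+ mabs k * (F x * mhermite k x))%:E)%E.
Proof.
move=> hF; have hk := @Lfun2_mhermite R d k; split.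
- have i1 := integrable_mehler_mul (or_introl erefl) (or_intror erefl) hF hk.
  rewrite -(integral12_prod_meas1 (m1 := gauss) (m2 := gauss) i1).
  apply: eq_integral => x _; rewrite /fubini_F/=.
  under eq_integral do rewrite -mulrA EFinM.
  have [ik E] := integral_mhermite_mehler x k t0.
  by rewrite integralZl// [X in (_ * X)%E]E -EFinM mulrCA.
- have i1 := integrable_mehler_mul (or_intror erefl) (or_introl erefl) hF hk.
  rewrite -(integral21_prod_meas1 (m1 := gauss) (m2 := gauss) i1).
  apply: eq_integral => x _; rewrite /fubini_G/=.
  under eq_integral do rewrite -mulrA EFinM mehlerC.
  have [ik E] := integral_mhermite_mehler x k t0.
  by rewrite integralZl// [X in (_ * X)%E]E -EFinM mulrCA.
Qed.

(** The Dirichlet form of the kernel, polarized. *)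
Definition mehler_form (F G : rV -> R) : R :=
  \int[gauss2]_z ((F z.1 - F z.2) * (G z.1 - G z.2) * M z.1 z.2).

Local Notation I1 := (or_introl erefl).
Local Notation I2 := (or_intror erefl).

Lemma integrable_mehler_form (F G : rV -> R) :
  F \in Lfun gauss 2%:E -> G \in Lfun gauss 2%:E ->
  gauss2.-integrable setT
    (fun z => ((F z.1 - F z.2) * (G z.1 - G z.2) * M z.1 z.2)%:E) /\
  mehler_form F G =
    \int[gauss2]_z (F z.1 * G z.1 * M z.1 z.2) + \int[gauss2]_z (F z.2 * G z.2 * M z.1 z.2)
    - (\int[gauss2]_z (F z.1 * G z.2 * M z.1 z.2) + \int[gauss2]_z (F z.2 * G z.1 * M z.1 z.2)).
Proof.
move=> hF hG; have i11 := integrable_mehler_mul I1 I1 hF hG.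
have i22 := integrable_mehler_mul I2 I2 hF hG.
have i12 := integrable_mehler_mul I1 I2 hF hG.
have i21 := integrable_mehler_mul I2 I1 hF hG.
have id1 := integrableD measurableT i11 i22; have id2 := integrableD measurableT i12 i21.
split.
  have := integrableB measurableT id1 id2.
  apply: eq_integrable => // z _; rewrite /= -!EFinD; congr EFin; ring.
rewrite -!RintegralD// -RintegralB//; apply: eq_Rintegral => z _; ring.
Qed.

Lemma mehler_form_ge0 F : F \in Lfun gauss 2%:E -> 0 <= mehler_form F F.
Proof.
move=> hF; apply: Rintegral_ge0 => z _.
by rewrite mulr_ge0 ?mehler_ge0// -expr2 sqr_ge0.
Qed.

(** (F x - F y)^2 <= 2 (F x)^2 + 2 (F y)^2, and the marginals are Gaussian. *)
Lemma mehler_form_le F : F \in Lfun gauss 2%:E ->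
  mehler_form F F <= 4 * \int[gauss]_x (F x * F x).
Proof.
move=> hF; have [i0 _] := integrable_mehler_form hF hF.
have i11 := integrable_mehler_mul I1 I1 hF hF.
have i22 := integrable_mehler_mul I2 I2 hF hF.
have [E1 E2] := integral_mehler_diag hF hF.
apply: (@le_trans _ _ (\int[gauss2]_z
    (2 * (F z.1 * F z.1 * M z.1 z.2 + F z.2 * F z.2 * M z.1 z.2)))).
  apply: le_Rintegral => //.
    exact: (integrableZl measurableT 2 (integrableD measurableT i11 i22)).
  move=> z _; rewrite -mulrDl mulrA ler_wpM2r ?mehler_ge0//.
  have := sqr_ge0 (F z.1 + F z.2); nra.
rewrite RintegralZl//; last exact: (integrableD measurableT i11 i22).
rewrite RintegralD// /Rintegral E1 E2; lra.
Qed.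

(** Of the four terms of the product, two are integrals over the marginals and two
    are given by Mehler's formula. *)
Lemma mehler_form_mhermite (F : rV -> R) k : F \in Lfun gauss 2%:E ->
  mehler_form F (mhermite k) =
  2 * (1 - r ^+ mabs k) * \int[gauss]_x (F x * mhermite k x).
Proof.
move=> hF; have hk := @Lfun2_mhermite R d k.
have [_ ->] := integrable_mehler_form hF hk.
have [E1 E2] := integral_mehler_diag hF hk.
have [E3 E4] := integral_mehler_cross k hF.
have i1 := integrable_mul_Lfun2 hF hk.
have := RintegralZl (r ^+ mabs k) measurableT i1.
rewrite /Rintegral E1 E2 E3 E4 => ->; ring.
Qed.

Lemma Lfun2_lincomb (c : R) (F G : rV -> R) :
  F \in Lfun gauss 2%:E -> G \in Lfun gauss 2%:E ->
  (fun x => c * F x + G x) \in Lfun gauss 2%:E.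
Proof.
move=> hF hG; have h1 : c \*: F \in Lfun gauss 2%:E by rewrite rpredZ ?lee1n.
by have := rpredD h1 hG; apply; rewrite lee1n.
Qed.

Lemma mehler_form_lincomb (c : R) (F G H : rV -> R) :
  F \in Lfun gauss 2%:E -> G \in Lfun gauss 2%:E -> H \in Lfun gauss 2%:E ->
  mehler_form F (fun x => c * G x + H x) = c * mehler_form F G + mehler_form F H.
Proof.
move=> hF hG hH; have [iG _] := integrable_mehler_form hF hG.
have [iH _] := integrable_mehler_form hF hH.
rewrite /mehler_form -RintegralZl// -RintegralD//; last first.
  exact: (integrableZl measurableT c iG).
by apply: eq_Rintegral => z _; ring.
Qed.

Lemma Lfun2_hsum (K : seq mindex) (c : mindex -> R) :
  (fun x : rV => \sum_(k <- K) c k * mhermite k x) \in Lfun gauss 2%:E.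
Proof.
elim: K => [|k K IH].
  by under eq_fun do rewrite big_nil; exact: (Lfun0 gauss (lee1n 2)).
under eq_fun do rewrite big_cons.
by apply: Lfun2_lincomb => //; exact: Lfun2_mhermite.
Qed.

Lemma mehler_form_hsum (F : rV -> R) (K : seq mindex) (c : mindex -> R) :
  F \in Lfun gauss 2%:E ->
  mehler_form F (fun x => \sum_(k <- K) c k * mhermite k x) =
  \sum_(k <- K) c k * (2 * (1 - r ^+ mabs k) * \int[gauss]_x (F x * mhermite k x)).
Proof.
move=> hF; elim: K => [|k K IH].
  rewrite big_nil /mehler_form; under eq_Rintegral do rewrite !big_nil subrr mulr0 mul0r.
  by rewrite /Rintegral integral0.
rewrite big_cons -IH -mehler_form_mhermite// -mehler_form_lincomb//.
- by congr mehler_form; apply/funext => x; rewrite big_cons.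
- exact: Lfun2_mhermite.
- exact: Lfun2_hsum.
Qed.

(** Completing the square. It serves for finite Hermite expansions P, for which the
    terms in P are explicit because the Hermite polynomials are eigenfunctions. *)
Lemma mehler_form_expand (F P : rV -> R) :
  F \in Lfun gauss 2%:E -> P \in Lfun gauss 2%:E ->
  mehler_form F F = 2 * mehler_form F P - mehler_form P P +
    mehler_form (fun x => (-1) * P x + F x) (fun x => (-1) * P x + F x).
Proof.
move=> hF hP; have hD := Lfun2_lincomb (-1) hP hF.
have [iFF _] := integrable_mehler_form hF hF; have [iFP _] := integrable_mehler_form hF hP.
have [iPP _] := integrable_mehler_form hP hP.
have [iDD _] := integrable_mehler_form hD hD.
have i2 := integrableZl measurableT 2 iFP.
have i3 := integrableB measurableT i2 iPP.
rewrite /mehler_form -RintegralZl// -RintegralB// -RintegralD//.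
by apply: eq_Rintegral => z _; ring.
Qed.

(** The form is nonnegative on the remainder F - P. *)
Lemma mehler_form_ge (f : L2 R d) m :
  \sum_(k <- midx d m) 2 * (1 - r ^+ mabs k) * hermite_coef f k ^+ 2 <=
  mehler_form (Lspace_fun f) (Lspace_fun f).
Proof.
have hF := L2_Lfun f; pose P (x : rV) := \sum_(k <- midx d m) hermite_coef f k * mhermite k x.
have hP : P \in Lfun gauss 2%:E by exact: Lfun2_hsum.
have EP k : k \in midx d m -> \int[gauss]_x (P x * mhermite k x) = hermite_coef f k.
  move=> km; have := hermite_coef_hcomb (hermite_coef f) k (midx_uniq m).
  rewrite km => <-; apply: ae_eq_Rintegral.
  - by apply: filterS (Lspace_fun_hcomb (midx d m) (hermite_coef f)) => x /= + _ => ->.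
  - apply: measurable_funM; first exact: Lfun2_measurable.
    by case: (@subgaussian_mhermite R d k).
  - by apply: measurable_funM; [exact: measurable_L2|case: (@subgaussian_mhermite R d k)].
rewrite (mehler_form_expand hF hP) !mehler_form_hsum//.
rewrite -[leLHS]addr0 lerD// ?mehler_form_ge0//; last exact: Lfun2_lincomb.
rewrite mulr_sumr -sumrB le_eqVlt; apply/orP; left; apply/eqP.
rewrite !big_seq; apply: eq_bigr => k km; rewrite EP// -/(hermite_coef f k); ring.
Qed.

(** The chosen representative differs from the polynomial P by a null function, on
    which the form vanishes by [mehler_form_le]. *)
Lemma mehler_form_hcomb m (c : mindex -> R) :
  mehler_form (Lspace_fun (hcomb (midx d m) c)) (Lspace_fun (hcomb (midx d m) c)) <=
  \sum_(k <- midx d m) 2 * (1 - r ^+ mabs k) * c k ^+ 2.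
Proof.
set f := hcomb _ c; have hF := L2_Lfun f.
pose P (x : rV) := \sum_(k <- midx d m) c k * mhermite k x.
have hP : P \in Lfun gauss 2%:E by exact: Lfun2_hsum.
have mk k : measurable_fun setT (mhermite k : rV -> R) by case: (@subgaussian_mhermite R d k).
have EF k : k \in midx d m -> hermite_coef f k = c k.
  by move=> km; rewrite hermite_coef_hcomb ?km//; exact: midx_uniq.
have EP k : k \in midx d m -> \int[gauss]_x (P x * mhermite k x) = c k.
  move=> km; rewrite -EF//; apply: ae_eq_Rintegral.
  - by apply: filterS (Lspace_fun_hcomb (midx d m) c) => x /= + _ => ->.
  - by apply: measurable_funM => //; exact: Lfun2_measurable.
  - by apply: measurable_funM => //; exact: measurable_L2.
have hD := Lfun2_lincomb (-1) hP hF.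
have D0 : \int[gauss]_x (((-1) * P x + Lspace_fun f x) * ((-1) * P x + Lspace_fun f x)) = 0.
  transitivity (\int[gauss]_x (0 : R)); last by rewrite /Rintegral integral0.
  apply: ae_eq_Rintegral => //.
  - apply: filterS (Lspace_fun_hcomb (midx d m) c) => x /= + _ => ->//.
    by rewrite -/(P x) mulN1r addNr mul0r.
  - by apply: measurable_funM; exact: Lfun2_measurable.
rewrite (mehler_form_expand hF hP) !mehler_form_hsum//.
rewrite -[leRHS]addr0 lerD//; last first.
  by rewrite (le_trans (mehler_form_le hD))// D0 mulr0.
rewrite mulr_sumr -sumrB le_eqVlt; apply/orP; left; apply/eqP.
rewrite !big_seq; apply: eq_bigr => k km; rewrite EP// -/(hermite_coef f k) EF//; ring.
Qed.

End mehler_kernel.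

(** * The fractional energy in Hermite coefficients *)

Section fractional_energy.
Context {R : realType} {d : nat}.
Local Notation leb := (@lebesgue_measure R).
Local Notation gauss := (gauss_measure R d).
Local Notation rV := ('rV[R]_d).
Local Notation mindex := {ffun 'I_d -> nat}.
Implicit Types (F : rV -> R) (f : L2 R d).

Definition fractional_energy (sigma : R) F : \bar R :=
  (\int[gauss]_y \int[gauss]_x ((`|F x - F y| ^+ 2)%:E * mehlerK sigma x y))%E.

Variable th : R.
Hypotheses (th0 : 0 < th) (th1 : th < 1).

Let D : set (measurableTypeR R) := `]0%R, +oo[%classic.

(** The indicator function extends the time integral to the whole line. *)
Let energy_density F (p : (rV * rV) * measurableTypeR R) : R :=
  (F p.1.1 - F p.1.2) ^+ 2 * mehler p.2 p.1.1 p.1.2 * p.2 `^ (- th - 1) * \1_D p.2.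

Let measurable_energy_density F : measurable_fun setT F ->
  measurable_fun setT (energy_density F).
Proof.
move=> mF.
have m1 : measurable_fun setT (fun p : (rV * rV) * measurableTypeR R => p.1.1).
  exact: (measurableT_comp measurable_fst measurable_fst).
have m2 : measurable_fun setT (fun p : (rV * rV) * measurableTypeR R => p.1.2).
  exact: (measurableT_comp measurable_snd measurable_fst).
have mt : measurable_fun setT (fun p : (rV * rV) * measurableTypeR R => p.2).
  exact: measurable_snd.
apply: measurable_funM; last first.
  apply: (@measurableT_comp _ _ _ _ _ _ (\1_D : measurableTypeR R -> R) _ _ _ mt).
  by apply: measurable_indic; exact: measurable_itv.
apply: measurable_funM; last first.
  by apply: (@measurableT_comp _ _ _ _ _ _ (@powR R ^~ (- th - 1)) _ _ _ mt); exact: measurable_powR.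
apply: measurable_funM; last exact: measurable_mehler.
apply: measurable_funX; apply: measurable_funB.
  exact: (measurableT_comp mF m1).
exact: (measurableT_comp mF m2).
Qed.

Let energy_density_ge0 F p : 0 <= energy_density F p.
Proof. rewrite /energy_density indicE; apply: mulr_ge0; last by rewrite ler0n.
by apply: mulr_ge0 (powR_ge0 _ _); apply: mulr_ge0 (mehler_ge0 _ _ _); exact: sqr_ge0. Qed.

(** Tonelli moves the time integral that defines the kernel outside. *)
Lemma fractional_energyE F : F \in Lfun gauss 2%:E ->
  fractional_energy (2 * th) F = (\int[leb]_(t in `]0%R, +oo[)
     (mehler_form t F F * t `^ (- th - 1))%:E)%E.
Proof.
move=> hF; have mF := Lfun2_measurable hF.
have mE := measurable_energy_density mF.
have mEe : measurable_fun setT (EFin \o energy_density F) by exact/measurable_EFinP.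
have mD : measurable D by exact: measurable_itv.
have inner x y : ((`|F x - F y| ^+ 2)%:E * mehlerK (2 * th) x y)%E =
    (\int[leb]_t (energy_density F ((x, y), t))%:E)%E.
  rewrite /mehlerK (_ : - (2 * th / 2) - 1 = - th - 1); last by congr (- _ - _); field.
  rewrite -ge0_integralZl//; last 2 first.
  - apply/measurable_EFinP; apply: measurable_funTS; apply: measurable_funM.
      by apply: measurable_mehler => //; exact: measurable_cst.
    exact: measurable_powR.
  - by move=> t _; rewrite lee_fin mulr_ge0 ?mehler_ge0 ?powR_ge0.
  rewrite integral_mkcond; apply: eq_integral => t _; rewrite patchE.
  rewrite /energy_density/= indicE -/D; case: ifP => tD.
    by rewrite mulr1 -EFinM real_normK ?num_real// !mulrA.
  by rewrite mulr0.
rewrite /fractional_energy; under eq_integral do under eq_integral do rewrite inner.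
have mz : measurable_fun setT (fun z : rV * rV => \int[leb]_t (energy_density F (z, t))%:E)%E.
  apply: (@measurable_fun_fubini_tonelli_F _ _ _ _ _ leb _ mEe) => p.
  by rewrite lee_fin.
transitivity (\int[gauss2]_z \int[leb]_t (energy_density F (z, t))%:E)%E.
  rewrite (fubini_tonelli2 (m1 := gauss) (m2 := gauss)) => [|//|z].
    by apply: eq_integral.
  by apply: integral_ge0 => t _; rewrite lee_fin.
rewrite (@fubini_tonelli _ _ _ _ _ gauss2 leb _ mEe); last by move=> p; rewrite lee_fin.
rewrite [RHS]integral_mkcond; apply: eq_integral => t _; rewrite patchE.
rewrite /energy_density/=; case: ifPn => tD; last first.
  by apply: integral0_eq => z _; rewrite indicE (negbTE tD) mulr0.
have t0 : 0 < t by have := set_mem tD; rewrite /= in_itv/= andbT.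
have [iF _] := integrable_mehler_form t0 hF hF.
rewrite EFinM /mehler_form /Rintegral fineK; last exact: integrable_fin_num iF.
rewrite -integralZr//; apply: eq_integral => z _.
by rewrite -EFinM indicE tD mulr1 expr2.
Qed.

Let measurable_frac m (c : mindex -> R) (E : set R) : measurable_fun E (fun t : R =>
  (\sum_(k <- midx d m) 2 * (1 - expR (- t) ^+ mabs k) * c k ^+ 2 * t `^ (- th - 1))%:E).
Proof.
apply/measurable_EFinP; apply: measurable_funTS; apply: measurable_sum => k.
apply: measurable_funM; last exact: measurable_powR.
apply: measurable_funM => //; apply: measurable_funM => //.
apply: measurable_funB => //; apply: measurable_funX; apply: measurableT_comp => //.
Qed.

Let integral_frac m (c : mindex -> R) : (\int[leb]_(t in `]0%R, +oo[)
  (\sum_(k <- midx d m) 2 * (1 - expR (- t) ^+ mabs k) * c k ^+ 2 * t `^ (- th - 1))%:E =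
  \sum_(k <- midx d m) (2 * c k ^+ 2)%:E * frac_integral th (mabs k))%E.
Proof.
have fr0 (k : nat) (t : R) : 0 < t -> 0 <= (1 - expR (- t) ^+ k) * t `^ (- th - 1).
  move=> t0; rewrite mulr_ge0 ?powR_ge0// subr_ge0 exprn_ile1 ?expR_ge0//.
  by rewrite -expR0 ler_expR oppr_le0 ltW.
have mfr (k : nat) (E : set R) : measurable_fun E
    (fun t : R => ((1 - expR (- t) ^+ k) * t `^ (- th - 1))%:E).
  apply/measurable_EFinP; apply: measurable_funTS; apply: measurable_funM.
    apply: measurable_funB => //; apply: measurable_funX; exact: measurableT_comp.
  exact: measurable_powR.
have E (k : mindex) (t : R) :
    (2 * (1 - expR (- t) ^+ mabs k) * c k ^+ 2 * t `^ (- th - 1))%:E =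
    ((2 * c k ^+ 2)%:E * ((1 - expR (- t) ^+ mabs k) * t `^ (- th - 1))%:E)%E.
  by rewrite -EFinM; congr EFin; ring.
under eq_integral do rewrite -sumEFin.
rewrite ge0_integral_sum//; last 2 first.
- move=> k; apply/measurable_EFinP; apply: measurable_funTS.
  apply: measurable_funM; last exact: measurable_powR.
  apply: measurable_funM => //; apply: measurable_funM => //.
  by apply: measurable_funB => //; apply: measurable_funX; exact: measurableT_comp.
- move=> k t; rewrite /= in_itv/= andbT => t0; rewrite E -EFinM lee_fin mulr_ge0//.
    by rewrite mulr_ge0// sqr_ge0.
  exact: fr0.
apply: eq_bigr => k _; under eq_integral do rewrite E.
rewrite ge0_integralZl//.
- exact: mfr.
- by move=> t; rewrite /= in_itv/= andbT => t0; rewrite lee_fin fr0.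
- by rewrite lee_fin mulr_ge0// sqr_ge0.
Qed.

Let measurable_form F : F \in Lfun gauss 2%:E ->
  measurable_fun (`]0%R, +oo[%classic : set R)
    (fun t : R => (mehler_form t F F * t `^ (- th - 1))%:E).
Proof.
move=> hF; have mF := Lfun2_measurable hF.
have mEe : measurable_fun setT (EFin \o energy_density F).
  by apply/measurable_EFinP; exact: measurable_energy_density.
have mG := @measurable_fun_fubini_tonelli_G _ _ _ _ _ gauss2 _ mEe.
have {}mG := mG (fun p => eq_ind_r is_true (energy_density_ge0 F p) (lee_fin _ _)).
apply: (eq_measurable_fun _ _ (measurable_funTS mG)) => t /=.
rewrite /fubini_G /energy_density/= => tD0; have tD : t \in D by exact: tD0.
have t0 : 0 < t by have := set_mem tD; rewrite /D/= in_itv/= andbT.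
have [iF _] := integrable_mehler_form t0 hF hF.
rewrite EFinM /mehler_form /Rintegral fineK; last exact: integrable_fin_num iF.
rewrite -integralZr//; apply: eq_integral => z _.
by rewrite -EFinM indicE tD mulr1 expr2.
Qed.

(** The bounds of the forms at time t are integrated against t^(-th-1) dt, which
    turns 1 - e^(-t|k|) into |k|^th. *)
Lemma fractional_energy_ge : exists2 c : R, 0 < c & forall f m,
  ((c * \sum_(k <- midx d m) (mabs k)%:R `^ th * hermite_coef f k ^+ 2)%:E <=
   fractional_energy (2 * th) (Lspace_fun f))%E.
Proof.
have [c c0 hc] := frac_integral_ge th0; exists (2 * c) => [|f m].
  by rewrite mulr_gt0.
rewrite fractional_energyE ?L2_Lfun//.
apply: (@le_trans _ _ (\sum_(k <- midx d m) (2 * hermite_coef f k ^+ 2)%:E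
    * frac_integral th (mabs k))%E).
  rewrite mulr_sumr -sumEFin; apply: lee_sum => k _.
  rewrite (_ : 2 * c * _ = 2 * hermite_coef f k ^+ 2 * (c * (mabs k)%:R `^ th)); last by ring.
  by rewrite [leLHS]EFinM lee_wpmul2l// lee_fin mulr_ge0// sqr_ge0.
rewrite -integral_frac; apply: ge0_le_integral => //.
- move=> t; rewrite /= in_itv/= andbT => t0; rewrite lee_fin sumr_ge0// => k _.
  apply: mulr_ge0 (powR_ge0 _ _); apply: mulr_ge0 (sqr_ge0 _); apply: mulr_ge0 => //.
  by rewrite subr_ge0 exprn_ile1 ?expR_ge0// -expR0 ler_expR oppr_le0 ltW.
- exact: measurable_frac.
- exact: measurable_form (L2_Lfun f).
- move=> t; rewrite /= in_itv/= andbT => t0; rewrite lee_fin -mulr_suml.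
  by rewrite ler_wpM2r ?powR_ge0// mehler_form_ge.
Qed.

Lemma fractional_energy_hcomb : exists2 C : R, 0 < C & forall m (c : mindex -> R),
  (fractional_energy (2 * th) (Lspace_fun (hcomb (midx d m) c)) <=
   (C * \sum_(k <- midx d m) (mabs k)%:R `^ th * c k ^+ 2)%:E)%E.
Proof.
have [C C0 hC] := frac_integral_le th0 th1; exists (2 * C) => [|m c].
  by rewrite mulr_gt0.
rewrite fractional_energyE ?L2_Lfun//.
apply: (@le_trans _ _ (\sum_(k <- midx d m) (2 * c k ^+ 2)%:E
    * frac_integral th (mabs k))%E); last first.
  rewrite mulr_sumr -sumEFin; apply: lee_sum => k _.
  rewrite (_ : 2 * C * _ = 2 * c k ^+ 2 * (C * (mabs k)%:R `^ th)); last by ring.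
  by rewrite [leRHS]EFinM lee_wpmul2l// lee_fin mulr_ge0// sqr_ge0.
rewrite -integral_frac; apply: ge0_le_integral => //.
- move=> t; rewrite /= in_itv/= andbT => t0; rewrite lee_fin mulr_ge0 ?powR_ge0//.
  by rewrite mehler_form_ge0// L2_Lfun.
- exact: measurable_form (L2_Lfun _).
- exact: measurable_frac.
- move=> t; rewrite /= in_itv/= andbT => t0; rewrite lee_fin -mulr_suml.
  by rewrite ler_wpM2r ?powR_ge0// mehler_form_hcomb.
Qed.

End fractional_energy.

(** * Comparison of the Sobolev and the Hermite norms *)

Section factorials.
Local Open Scope nat_scope.

Lemma fact_add_le n k a : k + a <= n -> (k + a)`! <= n ^ a * k`!.
Proof.
elim: a => [|a IH] kan; first by rewrite addn0 mul1n.
rewrite addnS factS expnS -mulnA; apply: leq_mul; first by rewrite -addnS.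
by apply: IH; apply: leq_trans kan; rewrite leq_add2l.
Qed.

(** Factor by factor: q <= m (q - l) for l < m <= q. *)
Lemma expn_le_ffact m q : m <= q -> q ^ m <= m ^ m * q ^_ m.
Proof.
have E x : x ^ m = \prod_(l < m) x by rewrite prod_nat_const card_ord.
move=> mq; rewrite ffact_prod (E q) (E m) -big_split/=.
apply: leq_prod => l _; have lm := ltn_ord l.
have [e me] : exists e, m = (l + e).+1 by exists (m - l.+1); lia.
have [b ->] : exists b, q = m + b by exists (q - m); lia.
by move: (nat_of_ord l) me => l' ->; nia.
Qed.

End factorials.

Section multi_index_factorials.
Context {d : nat}.
Local Notation mindex := {ffun 'I_d -> nat}.
Implicit Types (k a j : mindex).
Local Open Scope nat_scope.

Lemma mabs_madd k a : mabs (madd k a) = mabs k + mabs a.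
Proof. by rewrite /mabs -big_split/=; apply: eq_bigr => i _; rewrite ffunE. Qed.

Lemma madd_inj a : injective (madd^~ a).
Proof.
move=> k k' /ffunP h; apply/ffunP => i; have := h i.
by rewrite !ffunE => /addIn.
Qed.

Lemma mfact_madd_le k a : mfact (madd k a) <= mabs (madd k a) ^ mabs a * mfact k.
Proof.
rewrite /mfact [in mabs a]/mabs expn_sum -big_split/=.
apply: leq_prod => i _; rewrite [in X in X`! <= _]ffunE; apply: fact_add_le.
by have := leq_mabs (madd k a) i; rewrite ffunE.
Qed.

(** The multi-index m e_i: it suffices to differentiate m times in a single
    direction, chosen according to the Hermite coefficient that is estimated. *)
Definition mline (m : nat) (i : 'I_d) : mindex := [ffun l => if l == i then m else 0].

Lemma mabs_mline m i : mabs (mline m i) = m.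
Proof.
rewrite /mabs (bigD1 i)//= ffunE eqxx big1 ?addn0// => l /negbTE li.
by rewrite ffunE li.
Qed.

Definition msub j a : mindex := [ffun i => j i - a i].

Lemma msubK j m i : m <= j i -> madd (msub j (mline m i)) (mline m i) = j.
Proof.
move=> mj; apply/ffunP => l; rewrite !ffunE; case: eqP => [->|_]; last by rewrite subn0 addn0.
by rewrite subnK.
Qed.

Lemma mfact_mline k m i : mfact (madd k (mline m i)) = mfact k * (k i + m) ^_ m.
Proof.
rewrite /mfact (bigD1 i)//= [in RHS](bigD1 i)//= !ffunE eqxx.
rewrite (eq_bigr (fun l => (k l)`!)) => [|l /negbTE li]; last by rewrite !ffunE li addn0.
rewrite mulnAC; congr (_ * _).
by rewrite -(ffact_fact (leq_addl (k i) m)) addnK mulnC.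
Qed.

Lemma ex_large_coord j : 0 < d -> exists i, mabs j <= d * j i.
Proof.
move=> d0; have [i _ hi] := @arg_maxnP _ (Ordinal d0) xpredT (fun i => j i) isT.
exists i; have -> : d * j i = \sum_(l < d) j i by rewrite sum_nat_const card_ord.
apply: leq_sum => l _.
exact: hi.
Qed.

End multi_index_factorials.

Section norm_comparison.
Context {R : realType} {d : nat}.
Local Notation mindex := {ffun 'I_d -> nat}.
Implicit Types (f g : L2 R d) (a k : mindex).

Lemma sqr_hermite_coef_weak_derivative a f g k : is_weak_derivative a f g ->
  hermite_coef g k ^+ 2 =
  (mfact (madd k a))%:R / (mfact k)%:R * hermite_coef f (madd k a) ^+ 2.
Proof.
move=> /hermite_coef_weak_derivative ->; by rewrite exprMn sqr_sqrtr.
Qed.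

(** The factor (k + a)! / k! is at most |k + a|^|a|, so that |a| derivatives cost |a|
    orders of smoothness. *)
Lemma hbound_weak_derivative (s th C : R) a f g : is_weak_derivative a f g ->
  0 <= th -> (mabs a)%:R + th <= s -> hbound s C f -> hbound th C g.
Proof.
move=> fg th0 ths hf m.
have u : uniq [seq madd k a | k <- midx d m].
  by rewrite map_inj_uniq ?midx_uniq//; exact: madd_inj.
apply: le_trans (hbound_ge0_sum hf u); rewrite [leRHS]big_map; apply: ler_sum => k _.
rewrite (sqr_hermite_coef_weak_derivative k fg) mulrA ler_wpM2r ?sqr_ge0//.
have n1 : 1 <= 1 + (mabs (madd k a))%:R :> R by rewrite lerDl.
have n0 : 0 < 1 + (mabs (madd k a))%:R :> R by exact: lt_le_trans n1.
apply: (@le_trans _ _ ((1 + (mabs (madd k a))%:R) `^ (th + (mabs a)%:R))).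
  rewrite powRD ?(gt_eqF n0) ?implybT// ler_pM ?powR_ge0 ?divr_ge0//.
    apply: ge0_ler_powR; rewrite ?nnegrE ?addr_ge0// lerD2l ler_nat.
    by rewrite mabs_madd leq_addr.
  rewrite ler_pdivrMr ?ltr0n ?mfact_gt0// powR_mulrn ?(ltW n0)//.
  apply: (@le_trans _ _ ((mabs (madd k a))%:R ^+ mabs a * (mfact k)%:R)).
    by rewrite -natrX -natrM ler_nat mfact_madd_le.
  rewrite ler_wpM2r//; apply: lerXn2r; rewrite ?nnegrE ?(ltW n0)//.
  by rewrite lerDr.
by rewrite ler_powR// addrC.
Qed.

Lemma hbound_norm_le (th C : R) f : 0 <= th -> 0 <= C -> hbound th C f -> `|f| <= C.
Proof.
move=> th0 C0 hf; rewrite -(@ler_pXn2r _ 2)// ?nnegrE//.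
apply: parseval_le => m; apply: le_trans (hf m); apply: ler_sum => k _.
by rewrite ler_peMl ?sqr_ge0// -[leLHS](powRr0 (1 + (mabs k)%:R)) ler_powR// lerDl.
Qed.

(** The largest coordinate of an index j is at least |j| / d, so that the m-th
    derivative in that direction multiplies the coefficient of index j by a factor of
    order |j|^(m/2). *)
Lemma hbound_of_derivatives (m : nat) (th B : R) : (0 < d)%N -> 0 <= th -> th <= 1 ->
  exists2 C : R, 0 < C & forall f, `|f| <= 1 ->
    (forall i, exists2 g, is_weak_derivative (mline m i) f g & hbound th B g) ->
    hbound (m%:R + th) C f.
Proof.
move=> d0 th0 th1; pose s : R := m%:R + th.
have s0 : 0 <= s by rewrite addr_ge0.
pose A1 : R := (1 + (d * m)%:R) `^ s.
pose A2 : R := ((2 * d * m) ^ m)%:R * (1 + m%:R).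
have A10 : 0 < A1 by rewrite powR_gt0// ltr_pwDl.
have A20 : 0 <= A2 by rewrite mulr_ge0// addr_ge0.
have C0 : 0 < A1 + A2 * (d%:R * B ^+ 2).
  by apply: ltr_pwDl => //; do 2 apply: mulr_ge0 => //; exact: sqr_ge0.
exists (Num.sqrt (A1 + A2 * (d%:R * B ^+ 2))) => [|f f1 hf M]; first by rewrite sqrtr_gt0.
rewrite sqr_sqrtr ?(ltW C0)//.
have [g hg] : exists g : 'I_d -> L2 R d, forall i,
    is_weak_derivative (mline m i) f (g i) /\ hbound th B (g i).
  have /choice[g hg] : forall i, exists g, is_weak_derivative (mline m i) f g /\ hbound th B g.
    by move=> i; have [g h1 h2] := hf i; exists g.
  by exists g.
pose h i (k : mindex) := (1 + (mabs k)%:R) `^ th * hermite_coef (g i) k ^+ 2.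
have h0 i k : 0 <= h i k by rewrite mulr_ge0 ?powR_ge0 ?sqr_ge0.
(* If the largest coordinate of j is below m, then |j| <= d m and the norm of f
   suffices; otherwise j = k + m e_i, and the coefficient of index k of the i-th
   derivative is available. *)
have key j : (1 + (mabs j)%:R) `^ s * hermite_coef f j ^+ 2 <=
    A1 * hermite_coef f j ^+ 2 +
    A2 * \sum_(i < d | (m <= j i)%N) h i (msub j (mline m i)).
  have [i ji] := ex_large_coord j d0.
  have [mj|jm] := leqP m (j i); last first.
    rewrite -[leLHS]addr0 lerD//; last by rewrite mulr_ge0// sumr_ge0.
    rewrite ler_wpM2r ?sqr_ge0//; apply: ge0_ler_powR; rewrite ?nnegrE ?addr_ge0//.
    by rewrite lerD2l ler_nat (leq_trans ji)// leq_mul2l (ltnW jm) orbT.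
  rewrite -[leLHS]add0r lerD//; first by rewrite mulr_ge0 ?sqr_ge0// ltW.
  apply: (@le_trans _ _ (A2 * h i (msub j (mline m i)))); last first.
    by rewrite ler_wpM2l// (bigD1 i)//= lerDl sumr_ge0.
  rewrite /h; set k := msub j (mline m i); have kj : madd k (mline m i) = j by exact: msubK.
  have ffE : (mfact j)%:R / (mfact k)%:R = (j i ^_ m)%:R :> R.
    rewrite -{1}kj mfact_mline natrM mulrAC divff ?mul1r; last first.
      by rewrite pnatr_eq0 -lt0n mfact_gt0.
    by congr (_ ^_ _)%:R; rewrite -[in RHS]kj !ffunE eqxx.
  rewrite (sqr_hermite_coef_weak_derivative k (hg i).1) kj ffE.
  set e := hermite_coef f j ^+ 2; set p := (1 + (mabs k)%:R) `^ th.
  rewrite [leRHS](_ : _ = ((2 * d * m) ^ m)%:R * (j i ^_ m)%:R * ((1 + m%:R) * p) * e);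
    last by rewrite /A2; ring.
  rewrite ler_wpM2r ?sqr_ge0// /p.
  have jk : mabs j = (mabs k + m)%N by rewrite -kj mabs_madd mabs_mline.
  have n0 : 1 + (mabs j)%:R != 0 :> R by rewrite gt_eqF// ltr_pwDl.
  rewrite /s powRD ?n0 ?implybT//.
  rewrite powR_mulrn ?addr_ge0//.
  apply: ler_pM; rewrite ?exprn_ge0 ?addr_ge0 ?powR_ge0//.
    rewrite nat1r -natrX -natrM ler_nat.
    have [->|m0] := posnP m; first by rewrite !expn0.
    apply: (@leq_trans ((2 * d * j i) ^ m)%N).
      by rewrite leq_exp2r//; nia.
    by rewrite (expnMn _ (j i)) (expnMn _ m) -mulnA leq_mul2l expn_le_ffact ?orbT.
  apply: (@le_trans _ _ (((1 + m%:R) * (1 + (mabs k)%:R)) `^ th)).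
    apply: ge0_ler_powR; rewrite ?nnegrE ?mulr_ge0 ?addr_ge0//.
    by rewrite jk !nat1r -natrM ler_nat; nia.
  rewrite powRM ?addr_ge0// ler_wpM2r ?powR_ge0//.
  by rewrite -[leRHS]powRr1 ?addr_ge0// ler_powR// lerDl.
apply: (@le_trans _ _ (\sum_(j <- midx d M) (A1 * hermite_coef f j ^+ 2 +
    A2 * \sum_(i < d | (m <= j i)%N) h i (msub j (mline m i))))).
  by apply: ler_sum => j _; exact: key.
rewrite big_split/= -!mulr_sumr; apply: lerD.
  rewrite -[leRHS]mulr1 ler_wpM2l ?(ltW A10)//.
  apply: (le_trans (bessel f (midx_uniq M))).
  by rewrite -(expr1n _ 2) lerXn2r ?nnegrE.
rewrite ler_wpM2l// (exchange_big_dep xpredT)//=.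
rewrite [leRHS](_ : _ = \sum_(i < d) B ^+ 2); last by rewrite sumr_const card_ord mulr_natl.
apply: ler_sum => i _; rewrite -big_filter.
have u : uniq [seq msub j (mline m i) | j : mindex <- midx d M & (m <= (j : mindex) i)%N].
  rewrite map_inj_in_uniq ?filter_uniq ?midx_uniq// => j j'.
  rewrite !mem_filter => /andP[mj _] /andP[mj' _] E.
  by rewrite -(msubK mj) -(msubK mj') E.
by apply: le_trans (hbound_ge0_sum (hg i).2 u); rewrite [leRHS]big_map.
Qed.

End norm_comparison.

Section sobolev_ball_comparison.
Context {R : realType} {d : nat}.
Local Notation mindex := {ffun 'I_d -> nat}.
Implicit Types (f g : L2 R d) (a k : mindex).

Lemma sobolev_int_normE m f : sobolev_int_norm m f =
  Num.sqrt (\sum_(a <- midx d m) `|weak_derivative a f| ^+ 2).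
Proof.
rewrite /sobolev_int_norm (_ : [set a | _] = [set` midx d m]).
  by rewrite -fsbig_seq ?midx_uniq.
by apply/seteqP; split => a /=; rewrite mem_midx.
Qed.

Definition top_midx (m : nat) : seq mindex := [seq a <- midx d m | mabs a == m].

Lemma top_midx_uniq m : uniq (top_midx m).
Proof. by rewrite filter_uniq ?midx_uniq. Qed.

Lemma mem_top_midx m a : (a \in top_midx m) = (mabs a == m).
Proof. by rewrite mem_filter mem_midx; case: eqP => // ->; rewrite leqnn. Qed.

Lemma sobolev_seminormE s f : sobolev_seminorm s f =
  (\sum_(a <- top_midx (Num.truncn s))
    fractional_energy (2 * (s - (Num.truncn s)%:R))
      (Lspace_fun (weak_derivative a f)) `^ 2^-1)%E.
Proof.
rewrite /sobolev_seminorm (_ : [set a | _] = [set` top_midx (Num.truncn s)]).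
  by rewrite -fsbig_seq ?top_midx_uniq.
by apply/seteqP; split => a /=; rewrite mem_top_midx => /eqP.
Qed.

Lemma fractional_energy_ge0 (sigma : R) (F : 'rV[R]_d -> R) :
  (0 <= fractional_energy sigma F)%E.
Proof.
apply: integral_ge0 => y _; apply: integral_ge0 => x _; apply: mule_ge0.
  by rewrite lee_fin exprn_ge0.
by apply: integral_ge0 => t _; rewrite lee_fin mulr_ge0 ?mehler_ge0 ?powR_ge0.
Qed.

Lemma sqrt_poweR_le (x : \bar R) (c : R) : (0 <= x)%E -> 0 <= c ->
  (x `^ 2^-1 <= c%:E)%E <-> (x <= (c ^+ 2)%:E)%E.
Proof.
move=> x0 c0; split=> h.
  have := @gt0_ler_poweR R 2 (ler0n _ _) _ _ _ _ h.
  rewrite !in_itv/= !leey poweR_ge0 lee_fin c0 => /(_ isT isT).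
  by rewrite -poweRrM mulVf// poweRe1// ?poweR_EFin powR_mulrn.
have := @gt0_ler_poweR R 2^-1 _ _ _ _ _ h.
rewrite invr_ge0 ler0n !in_itv/= !leey x0 lee_fin sqr_ge0 => /(_ isT isT isT).
by rewrite ?poweR_EFin -powR_mulrn// -powRrM mulfV// powRr1.
Qed.

Lemma sumr_seq_const (I : Type) (r : seq I) (x : R) :
  \sum_(a <- r) x = x *+ size r.
Proof. by rewrite big_const_seq count_predT iter_addr_0. Qed.

Lemma sobolev_int_norm_ge0 m f : 0 <= sobolev_int_norm m f.
Proof. by rewrite /sobolev_int_norm sqrtr_ge0. Qed.

Lemma sobolev_int_norm_le m f (C : R) : (forall a, (mabs a <= m)%N -> `|weak_derivative a f| <= C) ->
  0 <= C -> sobolev_int_norm m f <= Num.sqrt (size (midx d m))%:R * C.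
Proof.
move=> h C0; rewrite sobolev_int_normE -[X in _ * X]ger0_norm// -sqrtr_sqr -sqrtrM//.
rewrite ler_sqrt; last by rewrite mulr_ge0// sqr_ge0.
rewrite mulr_natl -sumr_seq_const; rewrite !big_seq; apply: ler_sum => a.
by rewrite mem_midx => /h am; apply: lerXn2r; rewrite ?nnegrE.
Qed.

Lemma weak_derivative_norm_le m f a : sobolev_int_norm m f <= 1 -> (mabs a <= m)%N ->
  `|weak_derivative a f| <= 1.
Proof.
rewrite sobolev_int_normE -(sqrtr1 R) ler_sqrt ?ler01// sqrtr1 => h am.
rewrite -(@ler_pXn2r _ 2)// ?nnegrE// expr1n; apply: le_trans h.
rewrite (big_rem a)/=; last by rewrite mem_midx.
by rewrite lerDl sumr_ge0// => b _; rewrite sqr_ge0.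
Qed.

Lemma weak_derivative0 f : weak_derivative [ffun=> 0%N] f = f.
Proof.
apply: weak_derivativeE => u _; rewrite /mabs big1 => [|i _]; last by rewrite ffunE.
rewrite expr0 mul1r; congr (Rintegral _ _ _); apply/funext => x; congr (_ * _ x).
by rewrite /mpartial; elim: (enum _) => //= i s ->; rewrite ffunE.
Qed.

Lemma mabs0 : mabs ([ffun=> 0%N] : mindex) = 0%N.
Proof. by rewrite /mabs big1// => i _; rewrite ffunE. Qed.

Section fractional_order.
Variable th : R.
Hypotheses (th0 : 0 < th) (th1 : th < 1).

Lemma powR_add1_le n : (1 + n%:R) `^ th <= 1 + 2 * n%:R `^ th :> R.
Proof.
case: n => [|n]; first by rewrite addr0 powR1 powR0 ?mulr0 ?addr0// gt_eqF.
apply: (@le_trans _ _ ((2 * n.+1%:R) `^ th)).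
  apply: ge0_ler_powR; rewrite ?nnegrE ?addr_ge0 ?(ltW th0)//.
  by rewrite nat1r -natrM ler_nat; lia.
rewrite powRM// -[leLHS]add0r lerD// ler_wpM2r ?powR_ge0//.
by rewrite -[leRHS]powRr1// ler_powR ?(ltW th1)// ler1n.
Qed.

(** The norm compensates for the vanishing of the energy on constants. *)
Lemma hbound_of_energy : exists2 B : R, 0 < B & forall g, `|g| <= 1 ->
  (fractional_energy (2 * th) (Lspace_fun g) <= 1)%E -> hbound th B g.
Proof.
have [c c0 hc] := @fractional_energy_ge R d th th0.
have B0 : 0 < 1 + 2 / c by rewrite addr_gt0// divr_gt0.
exists (Num.sqrt (1 + 2 / c)) => [|g g1 eg M]; first by rewrite sqrtr_gt0.
rewrite sqr_sqrtr ?(ltW B0)//.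
apply: (@le_trans _ _ (\sum_(k <- midx d M) (hermite_coef g k ^+ 2 +
    2 * ((mabs k)%:R `^ th * hermite_coef g k ^+ 2)))).
  apply: ler_sum => k _; rewrite mulrA -[X in _ <= X + _]mul1r -mulrDl.
  by rewrite ler_wpM2r ?sqr_ge0// powR_add1_le.
rewrite big_split/= -mulr_sumr; apply: lerD.
  apply: (le_trans (bessel g (midx_uniq M))).
  by rewrite -(expr1n _ 2) lerXn2r ?nnegrE.
rewrite ler_wpM2l// -[c^-1]mul1r ler_pdivlMr// mulrC -lee_fin.
exact: le_trans (hc g M) eg.
Qed.

Lemma energy_of_hbound : exists2 C : R, 0 < C & forall M (c : mindex -> R) (b : R),
  hbound th b (hcomb (midx d M) c) ->
  (fractional_energy (2 * th) (Lspace_fun (hcomb (midx d M) c)) <= (C * b ^+ 2)%:E)%E.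
Proof.
have [C C0 hC] := @fractional_energy_hcomb R d th th0 th1; exists C => // M c b hb.
apply: (le_trans (hC M c)); rewrite lee_fin ler_wpM2l ?(ltW C0)//.
apply: le_trans (hb M); rewrite !big_seq; apply: ler_sum => k kM.
rewrite hermite_coef_hcomb ?midx_uniq// kM ler_wpM2r ?sqr_ge0//.
by apply: ge0_ler_powR; rewrite ?nnegrE ?addr_ge0 ?(ltW th0)// lerDr.
Qed.

End fractional_order.

Lemma hcomb_weak_derivativeE M (c : mindex -> R) a : exists M' c',
  weak_derivative a (hcomb (midx d M) c) = hcomb (midx d M') c' /\
  is_weak_derivative a (hcomb (midx d M) c) (hcomb (midx d M') c').
Proof.
have [M' [c' h]] := hcomb_weak_derivative M c a; exists M', c'; split => //.
exact: weak_derivativeE.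
Qed.

Lemma truncn_fracP (s : R) : 0 < s -> let m := Num.truncn s in let th := s - m%:R in
  [/\ 0 <= th, th < 1, s = m%:R + th & (s \is a Num.nat) = (th == 0)].
Proof.
move=> s0 m th; have /andP[h1 h2] := truncn_itv (ltW s0).
have E : s = m%:R + th by rewrite /th addrC subrK.
split => //; rewrite /th ?subr_ge0//.
  by rewrite ltrBlDl; move: h2; rewrite -/m -natr1.
by rewrite subr_eq0 natrEtruncn eq_sym.
Qed.

(** Integer and fractional orders are treated together: for th = 0 a bound of order
    th of the derivatives is a bound of their norms. *)
Lemma sobolev_ball_hbound (s : R) : (0 < d)%N -> 0 < s ->
  exists2 C : R, 0 < C & forall f, sobolev_ball d s f -> hbound s C f.
Proof.
move=> d0 s0; have [th0 th1 sE snat] := truncn_fracP s0.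
set m := Num.truncn s in th0 th1 sE snat; set th := s - m%:R in th0 th1 sE snat.
have [B B0 hB] : exists2 B : R, 0 < B & forall f, sobolev_ball d s f ->
    [/\ sobolev_int m f, sobolev_int_norm m f <= 1 &
     forall a, mabs a = m -> hbound th B (weak_derivative a f)].
  move: th0; rewrite le_eqVlt => /predU1P[th0|th0].
    exists 1 => // f; rewrite /sobolev_ball /sobolev /sobolev_norm/= snat -th0 eqxx lee_fin.
    move=> [f1 f2]; split => // a am M; rewrite expr1n.
    under eq_bigr do rewrite powRr0 mul1r.
    apply: (le_trans (bessel _ (midx_uniq M))); rewrite -(expr1n _ 2) lerXn2r ?nnegrE//.
    by apply: weak_derivative_norm_le f2 _; rewrite am.
  have [B B0 hB] := hbound_of_energy th0 th1; exists B => // f.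
  rewrite /sobolev_ball /sobolev /sobolev_norm/= snat gt_eqF//= => -[[f1 _] f2].
  have S0 : (0 <= sobolev_seminorm s f)%E.
    by rewrite sobolev_seminormE; apply: sume_ge0 => a _; exact: poweR_ge0.
  have f3 : sobolev_int_norm m f <= 1.
    by rewrite -lee_fin; apply: le_trans f2; rewrite leeDl.
  have f4 : (sobolev_seminorm s f <= 1)%E.
    by apply: le_trans f2; rewrite leeDr// lee_fin sobolev_int_norm_ge0.
  split => // a am; apply: hB; first by apply: weak_derivative_norm_le f3 _; rewrite am.
  rewrite -[X in (_ <= X)%E](_ : (1 ^+ 2)%:E = 1%E); last by rewrite expr1n.
  apply/sqrt_poweR_le => //; first exact: fractional_energy_ge0.
  apply: le_trans f4; rewrite sobolev_seminormE (big_rem a)/=; last by rewrite mem_top_midx am.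
  by rewrite leeDl//; apply: sume_ge0 => b _; exact: poweR_ge0.
have [C C0 hC] := @hbound_of_derivatives R d m th B d0 th0 (ltW th1).
exists C => // f /hB[f1 f2 f3]; rewrite sE; apply: hC => [|i].
  rewrite -(weak_derivative0 f); apply: weak_derivative_norm_le f2 _.
  by rewrite mabs0.
have [|g fg] := f1 (mline m i); first by rewrite mabs_mline.
by exists g => //; rewrite -(weak_derivativeE fg); apply: f3; exact: mabs_mline.
Qed.

(** Every term of the Sobolev norm is at most a multiple of c, and the number of terms
    only depends on d and s; this determines how small c has to be. *)
Lemma hbound_sobolev_ball (s : R) : 0 < s -> exists2 c : R, 0 < c &
  forall M (a : mindex -> R), hbound s c (hcomb (midx d M) a) ->
    sobolev_ball d s (hcomb (midx d M) a).
Proof.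
move=> s0; have [th0 th1 sE snat] := truncn_fracP s0.
set m := Num.truncn s in th0 th1 sE snat; set th := s - m%:R in th0 th1 sE snat.
pose N : R := (size (midx d m))%:R.
have N0 : 0 <= N by [].
have int_le M (a : mindex -> R) (c : R) : 0 <= c -> hbound s c (hcomb (midx d M) a) ->
    sobolev_int_norm m (hcomb (midx d M) a) <= Num.sqrt N * c.
  move=> c0 hc; apply: sobolev_int_norm_le => // b bm.
  have [M' [a' [-> h]]] := hcomb_weak_derivativeE M a b.
  apply: (hbound_norm_le (th := 0)) => //; apply: hbound_weak_derivative h _ _ hc => //.
  by rewrite addr0 sE -[leLHS]addr0 lerD// ler_nat.
have int_ex M (a : mindex -> R) : sobolev_int m (hcomb (midx d M) a).
  by move=> b _; have [M' [a' [_ h]]] := hcomb_weak_derivativeE M a b; exists (hcomb (midx d M') a').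
move: th0; rewrite le_eqVlt => /predU1P[th0|th0].
  exists (1 + Num.sqrt N)^-1 => [|M a hc]; first by rewrite invr_gt0 ltr_pwDl.
  rewrite /sobolev_ball /sobolev /sobolev_norm/= snat -th0 eqxx lee_fin; split => //.
  have c0 : 0 < 1 + Num.sqrt N by rewrite ltr_pwDl.
  rewrite (le_trans (int_le _ _ _ _ hc)) ?invr_ge0 ?(ltW c0)//.
  by rewrite ler_pdivrMr// mul1r lerDr.
have [C C0 hC] := @energy_of_hbound th th0 th1.
pose K : R := 1 + Num.sqrt N + (size (top_midx m))%:R * Num.sqrt C.
have K0 : 0 < K by rewrite /K -addrA ltr_pwDl// addr_ge0// mulr_ge0.
exists K^-1 => [|M a hc]; first by rewrite invr_gt0.
have Ki : 0 <= K^-1 by rewrite invr_ge0 ltW.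
have semi : (sobolev_seminorm s (hcomb (midx d M) a) <=
    ((size (top_midx m))%:R * Num.sqrt C * K^-1)%:E)%E.
  rewrite sobolev_seminormE -/m -/th.
  apply: (@le_trans _ _ (\sum_(b <- top_midx m) (Num.sqrt C * K^-1)%:E)%E).
    rewrite !big_seq; apply: lee_sum => b; rewrite mem_top_midx => /eqP bm.
    have [M' [a' [-> h]]] := hcomb_weak_derivativeE M a b.
    apply/sqrt_poweR_le; first exact: fractional_energy_ge0.
      by rewrite mulr_ge0.
    rewrite exprMn sqr_sqrtr ?(ltW C0)//; apply: hC.
    by apply: hbound_weak_derivative h _ _ hc; rewrite ?(ltW th0)// bm -sE.
  by rewrite sumEFin lee_fin sumr_seq_const -[leLHS]mulr_natl mulrA.
rewrite /sobolev_ball /sobolev /sobolev_norm/= snat gt_eqF//=; split.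
  by split => //; exact: le_lt_trans semi (ltry _).
apply: (@le_trans _ _ ((Num.sqrt N * K^-1)%:E +
    ((size (top_midx m))%:R * Num.sqrt C * K^-1)%:E)%E).
  by apply: leeD semi; rewrite lee_fin int_le.
rewrite -EFinD lee_fin -mulrDl ler_pdivrMr// mul1r /K -addrA lerDr//.
Qed.

End sobolev_ball_comparison.

Theorem theorem3p5 (R : realType) (d : nat) (s : R)
    (width : nat -> set (L2 R d) -> \bar R) :
  (0 < d)%N -> 0 < s ->
  (width = linear_width \/ width = kolmogorov_width) ->
  [/\ asymp_equiv (fun n => width n (sobolev_ball d s))
                  (fun n => width n (hermite_ball d s)),
      asymp_equiv (fun n => width n (hermite_ball d s))
                  (fun n => (n%:R `^ (- (s / (2 * d%:R))))%:E) &
      (width n (hermite_ball d s) / (n%:R `^ (- (s / (2 * d%:R))))%:E)%E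
        @[n --> \oo] -->
      ((1 / (d`!%:R `^ (d%:R^-1))) `^ (s / 2))%:E].
Proof.
move=> d0 s0 hw; have [C C0 hC] := @sobolev_ball_hbound R d s d0 s0.
have [c c0 hc] := @hbound_sobolev_ball R d s s0.
exact: (widths_of_comparison d0 s0 c0 C0 hw hC hc).
Qed.
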